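(* Suppose there exists $\ell\in\mathbb N$ such that, almost surely, for every $n\ge\ell$, all $0\le t_1<\cdots<t_n\le T$ and all $x_1,\dots,x_n\in\mathbb R^d$, the family $(K_T^{t_i}\varphi(t_i,x_i))_{1\le i\le n}$ spans $\mathbb R^d$. Then, conditionally on $\{N_T\ge\ell\}$, the law of $X_T$ is absolutely continuous with respect to the Lebesgue measure on $\mathbb R^d$.
   Context: Fix $T>0$ and $d\ge1$. $N$ is a nonlinear Hawkes process on $(\Omega,\mathcal F,\mathbb P)$ (with $\Omega$ the canonical space of càdlàg counting paths started at $0$ with unit jumps), i.e. a counting process with conditional intensity, with respect to its natural filtration, $\lambda^*(t)=\lambda_t+\gamma\big(\int_{(0,t)}\mu(t-s)\,dN_s\big)$. Standing assumptions: $\lambda:\mathbb R_+\to(0,\infty)$ is differentiable with bounded derivative and $\lambda_t\ge\lambda_*>0$ for all $t$; $\mu:\mathbb R_+\to\mathbb R_+$ is $C^1$ with bounded derivative and in $L^1([0,\infty))$; $\gamma:\mathbb R_+\to\mathbb R_+$ is $C^1$ with bounded derivative, $\gamma(0)=0$; and $\sup_{x\ge0}|\gamma'(x)|\int_0^\infty\mu(t)\,dt<1$. $X$ is the unique solution of the SDE $X_t=x_0+\int_0^tf(s,X_s)\,ds+\int_{(0,t]}g(s,X_{s-})\,dN_s$, $0\le t\le T$, with $x_0\in\mathbb R^d$, where $f,g:[0,T]\times\mathbb R^d\to\mathbb R^d$ are measurable and: (1) for each $t$, $f(t,\cdot)$ and $g(t,\cdot)$ are $C^1$; (2) $\sup_{t,x}(|\nabla_xf(t,x)|+|\nabla_xg(t,x)|)<\infty$;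 (3) for each $x$, $g(\cdot,x)$ is differentiable; (4) $\det(I_d+\nabla_xg(t,x))\ne0$ for all $(t,x)\in[0,T]\times\mathbb R^d$ and $(I_d+\nabla_xg)^{-1}$ is uniformly bounded. $K$ is the $\mathbb R^{d\times d}$-valued solution of $K_t=I_d+\int_0^t\nabla_xf(s,X_s)K_s\,ds+\int_{(0,t]}\nabla_xg(s,X_{s-})K_{s-}\,dN_s$, $0\le t\le T$; $K_t$ is invertible, $\widetilde K_t=K_t^{-1}$, and $K_t^s=K_t\widetilde K_s$ for $0\le s\le t\le T$. The function $\varphi:[0,T]\times\mathbb R^d\to\mathbb R^d$ is $$\varphi(t,x)=f(t,x+g(t,x))-(I_d+\nabla_xg(t,x))f(t,x)-\frac{\partial g}{\partial t}(t,x).$$ *)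

(* Defs.v *)
From HB Require Import structures.
From mathcomp Require Import all_boot all_order all_algebra.
From mathcomp Require Import all_classical all_reals all_analysis.
From mathcomp Require Import measurable_realfun.
Set Implicit Arguments.
Unset Strict Implicit.
Unset Printing Implicit Defensive.
Import Order.TTheory GRing.Theory Num.Theory.
Import numFieldNormedType.Exports.
Local Open Scope classical_set_scope.
Local Open Scope ring_scope.

(** The time set is the half-line of nonnegative reals.  A path is encoded as a
    function on the whole of [R] that vanishes on the nonpositive reals; left
    limits exist because the path is monotone. *)
Record counting_path (R : realType) := CountingPath {
  path_val :> R -> nat ;
  path_val_le0 : forall t, t <= 0 -> path_val t = 0%N ;
  path_val_homo : {homo path_val : s t / s <= t >-> (s <= t)%N} ;
  path_val_right : forall t, path_val s @[s --> t^'+] --> path_val t ;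
  path_val_unit : forall t, \forall s \near t^'-,
    (path_val t <= (path_val s).+1)%N }.

Program Definition zero_path (R : realType) : counting_path R :=
  @CountingPath R (fun=> 0%N) _ _ _ _.
Next Obligation. by []. Qed.
Next Obligation. by move=> *. Qed.
Next Obligation. by move=> R t; exact: cvg_cst. Qed.
Next Obligation. by move=> R t; exact: nearW. Qed.

HB.instance Definition _ (R : realType) := gen_eqMixin (counting_path R).
HB.instance Definition _ (R : realType) := gen_choiceMixin (counting_path R).
HB.instance Definition _ (R : realType) :=
  isPointed.Build (counting_path R) (zero_path R).

Definition coordinate_events (R : realType) (I : set R) :
    set (set (counting_path R)) :=
  [set A | exists2 t, I t &
           exists B : set nat, A = [set w : counting_path R | B (w t)]].

Notation path_space R :=
  (g_sigma_algebraType (@coordinate_events R `[0, +oo[)).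

Notation natural_history R t :=
  (g_sigma_algebraType (@coordinate_events R `[0, t])).

Notation borel T := (g_sigma_algebraType (@open T)).

Definition jump_times (R : realType) (w : counting_path R) : set R :=
  [set t | \forall s \near t^'-, (w s < w t)%N].

Definition predictable_rectangles (R : realType) :
    set (set (R * counting_path R)) :=
  [set [set 0] `*` A | A in @measurable _ (natural_history R 0)] `|`
  [set C | exists s t (A : set (counting_path R)),
     [/\ 0 <= s, s < t, @measurable _ (natural_history R s) A &
         C = `]s, t] `*` A]].

Definition predictable (R : realType) (C : R -> counting_path R -> \bar R) :=
  measurable_fun
    (`[0%R, +oo[ `*` setT : set (g_sigma_algebraType (@predictable_rectangles R)))
    (fun p => C p.1 p.2).

(** Bremaud's definition of the intensity of the coordinate process [N] with
    respect to its natural filtration: the Stieltjes integral of [C] against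
    [dN] is the sum of [C] over the (unit) jumps. *)
Definition has_intensity (R : realType) (P : probability (path_space R) R)
    (L : R -> counting_path R -> R) : Prop :=
  [/\ forall t w, 0 <= t -> 0 <= L t w,
      predictable (fun t w => (L t w)%:E),
      {ae P, forall w, forall t, 0 <= t ->
        (\int[lebesgue_measure]_(s in `[0%R, t]) (L s w)%:E < +oo)%E} &
      forall C : R -> counting_path R -> \bar R,
        predictable C -> (forall t w, (0 <= C t w)%E) ->
        (\int[P]_w (\esum_(s in jump_times w) C s w) =
         \int[P]_w (\int[lebesgue_measure]_(s in `[0%R, +oo[)
                       (C s w * (L s w)%:E)))%E].

(** Derivative relative to a subset [D] of the line: it is one-sided at the
    endpoints when [D] is an interval. *)
Section derive_within.
Context {R : realType} {V : normedModType R}.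
Variables (D : set R) (h : R -> V).

Definition difference_quotient (t s : R) : V := (s - t)^-1 *: (h s - h t).

Definition derivable_within (t : R) : Prop :=
  cvg (difference_quotient t s @[s --> within D t^']).

Definition derive_within (t : R) : V :=
  lim (difference_quotient t s @[s --> within D t^']).

End derive_within.

Definition differentiable_bounded_derivative (R : realType) (h : R -> R) :=
  (forall t, 0 <= t -> derivable_within `[0, +oo[ h t) /\
  (exists C, forall t, 0 <= t -> `|derive_within `[0, +oo[ h t| <= C).

Definition C1_bounded_derivative (R : realType) (h : R -> R) :=
  differentiable_bounded_derivative h /\
  {within `[0, +oo[, continuous (derive_within `[0, +oo[ h)}.

Record hawkes_parameters (R : realType) (lam mu gamma : R -> R) : Prop := {
  baseline_derivative : differentiable_bounded_derivative lam ;
  baseline_lower_bound :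
    exists2 lamstar, 0 < lamstar & forall t, 0 <= t -> lamstar <= lam t ;
  kernel_ge0 : forall t, 0 <= t -> 0 <= mu t ;
  kernel_derivative : C1_bounded_derivative mu ;
  kernel_integrable :
    lebesgue_measure.-integrable `[0, +oo[ (fun t => (mu t)%:E) ;
  rate_ge0 : forall x, 0 <= x -> 0 <= gamma x ;
  rate_derivative : C1_bounded_derivative gamma ;
  rate0 : gamma 0 = 0 ;
  stability :
    (ereal_sup [set `|derive_within `[0%R, +oo[ gamma x|%:E | x in `[0%R, +oo[]
     * \int[lebesgue_measure]_(t in `[0%R, +oo[) (mu t)%:E < 1)%E }.

Definition hawkes_intensity (R : realType) (lam mu gamma : R -> R)
    (t : R) (w : counting_path R) : R :=
  lam t + gamma (\sum_(s \in jump_times w `&` `]0, t[) mu (t - s)).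

Definition hawkes_process (R : realType) (P : probability (path_space R) R)
    (lam mu gamma : R -> R) : Prop :=
  hawkes_parameters lam mu gamma /\
  has_intensity P (hawkes_intensity lam mu gamma).

Definition mx_integral (R : realType) (m n : nat) (D : set R)
    (F : R -> 'M[R]_(m, n)) : 'M[R]_(m, n) :=
  \matrix_(i, j) \int[lebesgue_measure]_(s in D) F s i j.

Definition cadlag (R : realType) (V : normedModType R) (T : R) (y : R -> V) :=
  (forall t, 0 <= t < T -> y s @[s --> t^'+] --> y t) /\
  (forall t, 0 < t <= T -> cvg (y s @[s --> t^'-])).

Definition left_limit (R : realType) (V : normedModType R) (y : R -> V)
    (t : R) : V := lim (y s @[s --> t^'-]).

(** [y_t = y0 + int_0^t a_s ds + int_(0,t] b_s dN_s] on [0, T], along [w]. *)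
Definition integral_equation (R : realType) (m n : nat) (T : R)
    (w : counting_path R) (y0 : 'M[R]_(m, n)) (a b y : R -> 'M[R]_(m, n)) :=
  [/\ cadlag T y,
      forall i j, lebesgue_measure.-integrable `[0, T]
                    (fun s => (a s i j)%:E) &
      forall t, 0 <= t <= T ->
        y t = y0 + mx_integral `[0, t] a
              + \sum_(s \in jump_times w `&` `]0, t]) b s].

Definition adapted (R : realType) (m n : nat) (T : R)
    (Y : R -> counting_path R -> 'M[R]_(m, n)) :=
  forall t, 0 <= t <= T ->
    @measurable_fun _ _ (natural_history R t) (borel 'M[R]_(m, n)) setT (Y t).

(** Jacobian matrix for column vectors: entry [(i, j)] is the partial
    derivative of the [i]-th component along the [j]-th coordinate (the library's
    [jacobian] is the transpose, for row vectors). *)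
Definition jac (R : realType) (d : nat) (h : 'cV[R]_d -> 'cV[R]_d)
    (x : 'cV[R]_d) : 'M[R]_d :=
  \matrix_(i, j) ('d h x (delta_mx j 0)) i 0.

Definition C1 (R : realType) (d : nat) (h : 'cV[R]_d -> 'cV[R]_d) :=
  (forall x, differentiable h x) /\ continuous (jac h).

Record sde_coefficients (R : realType) (d : nat) (T : R)
    (f g : R -> 'cV[R]_d -> 'cV[R]_d) : Prop := {
  drift_measurable :
    @measurable_fun _ _ (borel (R * 'cV[R]_d)%type) (borel 'cV[R]_d)
      (`[0, T] `*` setT) (fun p => f p.1 p.2) ;
  jump_measurable :
    @measurable_fun _ _ (borel (R * 'cV[R]_d)%type) (borel 'cV[R]_d)
      (`[0, T] `*` setT) (fun p => g p.1 p.2) ;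
  coefficients_C1 : forall t, 0 <= t <= T -> C1 (f t) /\ C1 (g t) ;
  jac_bounded : exists C, forall t x, 0 <= t <= T ->
    `|jac (f t) x| + `|jac (g t) x| <= C ;
  jump_derivable : forall x t, 0 <= t <= T ->
    derivable_within `[0, T] (g^~ x) t ;
  jump_det : forall t x, 0 <= t <= T -> \det (1%:M + jac (g t) x) != 0 ;
  jump_inv_bounded : exists C, forall t x, 0 <= t <= T ->
    `|invmx (1%:M + jac (g t) x)| <= C }.

Definition sde_solution (R : realType) (P : probability (path_space R) R)
    (d : nat) (T : R) (x0 : 'cV[R]_d) (f g : R -> 'cV[R]_d -> 'cV[R]_d)
    (X : R -> counting_path R -> 'cV[R]_d) : Prop :=
  adapted T X /\
  {ae P, forall w, integral_equation T w x0
    (fun s => f s (X s w)) (fun s => g s (left_limit (X^~ w) s)) (X^~ w)}.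

Definition tangent_solution (R : realType) (P : probability (path_space R) R)
    (d : nat) (T : R) (f g : R -> 'cV[R]_d -> 'cV[R]_d)
    (X : R -> counting_path R -> 'cV[R]_d)
    (K : R -> counting_path R -> 'M[R]_d) : Prop :=
  adapted T K /\
  {ae P, forall w, integral_equation T w 1%:M
    (fun s => jac (f s) (X s w) *m K s w)
    (fun s => jac (g s) (left_limit (X^~ w) s) *m left_limit (K^~ w) s)
    (K^~ w)}.

Definition transition (R : realType) (d : nat)
    (K : R -> counting_path R -> 'M[R]_d) (s t : R) (w : counting_path R) :
    'M[R]_d := K t w *m invmx (K s w).

Definition phi (R : realType) (d : nat) (T : R)
    (f g : R -> 'cV[R]_d -> 'cV[R]_d) (t : R) (x : 'cV[R]_d) : 'cV[R]_d :=
  f t (x + g t x) - (1%:M + jac (g t) x) *m f t x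
  - derive_within `[0, T] (g^~ x) t.

Definition box (R : realType) (d : nat) (ab : 'cV[R]_d * 'cV[R]_d) :
    set 'cV[R]_d :=
  [set x | forall i, ab.1 i 0 <= x i 0 <= ab.2 i 0].

Definition box_volume (R : realType) (d : nat) (ab : 'cV[R]_d * 'cV[R]_d) : R :=
  \prod_i Num.max 0 (ab.2 i 0 - ab.1 i 0).

(** Outer measure formula: infimum of the total volume of countable covers by
    boxes; on Borel sets this is the [d]-dimensional Lebesgue measure. *)
Definition lebesgue_cV (R : realType) (d : nat) (A : set (borel 'cV[R]_d)) :
    \bar R :=
  ereal_inf [set (\sum_(0 <= k <oo) (box_volume (ab k))%:E)%E
            | ab in [set ab : nat -> 'cV[R]_d * 'cV[R]_d |
                     A `<=` \bigcup_k box (ab k)]].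

Definition conditional_law (R : realType) (P : probability (path_space R) R)
    (d : nat) (E : set (path_space R)) (Y : counting_path R -> 'cV[R]_d)
    (A : set (borel 'cV[R]_d)) : \bar R :=
  (P (E `&` Y @^-1` A) * ((fine (P E))^-1)%:E)%E.

(* Main.v *)
(* For Lebesgue-null [A] and [n >= l] the event [N_T = n, X_T in A] is shown to be negligible by a
   change of variables in the jump times [tau_1 < ... < tau_n].  Boundedness of the intensity before
   the [n]-th jump gives [P(|tau_i - a_i| <= r for all i) <= C r^n].  To first order, [X_T] moves by
   [- sum_i K_T^{tau_i} phi(tau_i, X_{tau_i -}) h_i] when the jump times move by [h]: between jumps
   this is the linearization of the flow, at almost every time (a Lebesgue point of the drift); each
   jump contributes the three terms of [phi].  Since these vectors span, [d] of the jump times can be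
   traded for the [d] coordinates of [X_T]: near any given path, jump times are a Lipschitz function
   of [X_T] and of the remaining [n - d] jump times.  Countably many pieces suffice, and on each of
   them the event is covered by the boxes that cover [A], times an interval per remaining jump.
   As the coefficients are only measurable in time and differentiable in space, neighbourhoods of a
   path are described by countably many conditions, which include closeness of the Jacobians of [g]. *)
From HB Require Import structures.
Require Import Defs.
From mathcomp Require Import all_boot all_order all_algebra.
From mathcomp Require Import all_classical all_reals all_analysis.
From mathcomp Require Import measurable_realfun.
From mathcomp Require Import ring lra.
Set Implicit Arguments.
Unset Strict Implicit.
Unset Printing Implicit Defensive.
Import Order.TTheory GRing.Theory Num.Theory.
Import numFieldNormedType.Exports.
Local Open Scope classical_set_scope.
Local Open Scope ring_scope.


(** * Counting paths and their jump times *)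

(** The expansion of the terminal value is available only at almost every configuration of jump
    times and without a uniform modulus, so no inverse function theorem applies; the Lipschitz bound
    is obtained by contradiction. If it failed around a path [w] with every integer constant, there
    would be paths [wk k] approaching [w] whose jump times move by a total [delta k > 0], while the
    coordinates of X_T and the unselected jump times move by o(delta k). The expansion at the single
    path [w] and the invertible matrix of selected responses then give delta k = o(delta k). Hence
    expansions are proved along sequences, relative to a scale [delta], and the Lipschitz constant
    is some integer [j.+1] without a formula. No joint density of the jump times is built either:
    the cube estimate turns covers by cubes into bounds on outer probability, so the sets of paths
    involved may be arbitrary. The exceptional times (those that are not Lebesgue points of the
    drift, and T itself) form one null set common to all spatial points, and the existence of an
    intensity forbids jumps there almost surely. *)

Section jump_times.
Context {R : realType}.
Implicit Types (w : counting_path R) (s t T : R) (i : nat).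

(* The [i.+1]-st jump time; junk value [0] if there are at most [i] jumps. *)
Definition jump w i : R := inf [set t | (i < w t)%N].

Lemma path_gt0 w i t : (i < w t)%N -> 0 < t.
Proof. by move=> it; rewrite ltNge; apply: contraL it => /path_val_le0 ->. Qed.

(** The topology of [nat] is discrete, so right continuity means being locally constant to the
    right. *)
Lemma path_right w t : \forall s \near t^'+, w s = w t.
Proof. exact: (@path_val_right R w t _ (discrete_set1 (w t))). Qed.

Lemma path_at_right w t : exists2 s, t < s & w s = w t.
Proof.
have /filter_ex[s [ts ws]] : \forall s \near t^'+, t < s /\ w s = w t.
  by near=> s; split; near: s; [exact: nbhs_right_gt|exact: path_right].
by exists s.
Unshelve. all: by end_near. Qed.

(** The infimum defining [jump w i] is attained: the path is constant just after it, and points of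
    the set lie arbitrarily close to it. *)
Lemma jumpP w i T t : (i < w T)%N -> (i < w t)%N = (jump w i <= t).
Proof.
move=> iT; have lb : lbound [set t | (i < w t)%N] 0 by move=> s /path_gt0/ltW.
have hi : has_inf [set t | (i < w t)%N] by split; [exists T|exists 0].
apply/idP/idP => [it|]; first by apply: ge_inf => //; exists 0.
have [s js ws] := path_at_right w (jump w i).
move=> jt; apply: leq_trans (path_val_homo w jt); rewrite -ws.
have sj : 0 < s - jump w i by rewrite subr_gt0.
have [t' it' t's] := inf_adherent sj hi.
apply: leq_trans it' (path_val_homo w _); apply: ltW.
by move: t's; rewrite -/(jump w i) addrCA subrr addr0.
Qed.

Lemma jump_gt w i T t : (i < w T)%N -> (t < jump w i) = (w t <= i)%N.
Proof. by move=> iT; rewrite ltNge -(jumpP _ iT) -leqNgt. Qed.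

Lemma jump_le w i T : (i < w T)%N -> jump w i <= T.
Proof. by move=> iT; rewrite -(jumpP _ iT). Qed.

Lemma jump_gt0 w i T : (i < w T)%N -> 0 < jump w i.
Proof. by move=> iT; rewrite (jump_gt _ iT) path_val_le0. Qed.

Lemma path_jump w i T : (i < w T)%N -> w (jump w i) = i.+1.
Proof.
move=> iT; apply/eqP; rewrite eqn_leq (jumpP _ iT) lexx andbT.
have /filter_ex[s [sj]] : \forall s \near (jump w i)^'-,
    s < jump w i /\ (w (jump w i) <= (w s).+1)%N.
  by near=> s; split; near: s; [exact: nbhs_left_lt|exact: path_val_unit].
by move=> /leq_trans; apply; rewrite ltnS -(jump_gt _ iT).
Unshelve. all: by end_near. Qed.

Lemma jump_lt w i j T : (j < w T)%N -> (i < j)%N -> jump w i < jump w j.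
Proof.
by move=> jT ij; rewrite (jump_gt _ jT) (path_jump (ltn_trans ij jT)).
Qed.

Lemma jump_inj w T : {in gtn (w T) &, injective (jump w)}.
Proof.
move=> i j; rewrite !inE => iT jT ij.
case: (ltngtP i j) => // h; first by have := jump_lt jT h; rewrite ij ltxx.
by have := jump_lt iT h; rewrite ij ltxx.
Qed.

Lemma jump_jump_times w i T : (i < w T)%N -> jump_times w (jump w i).
Proof.
move=> iT; rewrite /jump_times/= (path_jump iT); near=> s.
by rewrite ltnS -(jump_gt _ iT); near: s; exact: nbhs_left_lt.
Unshelve. all: by end_near. Qed.

(** The index is [(w t).-1]: if that jump came strictly before [t], the path would already have the
    value [w t] just before [t], and [t] would not be a jump time. *)
Lemma jump_times_jump w t T : t <= T -> jump_times w t ->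
  exists2 i, (i < w T)%N & t = jump w i.
Proof.
move=> tT jt; have [s [st wst]] : exists s, s < t /\ (w s < w t)%N.
  apply: (filter_ex (F := t^'-)); near=> s.
  by split; near: s; [exact: nbhs_left_lt|exact: jt].
have wt0 : (0 < w t)%N by case: (w t) wst.
have it : ((w t).-1 < w t)%N by rewrite prednK.
exists (w t).-1; first exact: leq_trans it (path_val_homo w tT).
apply/eqP; rewrite eq_le -(jumpP _ it) it andbT leNgt; apply/negP => jlt.
have [s' [s't s'j]] : exists s', (w s' < w t)%N /\ jump w (w t).-1 < s'.
  by apply: (filter_ex (F := t^'-)); near=> s'; split; near: s';
    [exact: jt|exact: nbhs_left_gt].
move: (ltW s'j); rewrite -(jumpP _ it) => /leq_ltn_trans/(_ s't).
by rewrite prednK// ltnn.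
Unshelve. all: by end_near. Qed.

Lemma jump_timesE w T t : t <= T ->
  jump_times w `&` `]0, t] = [set jump w i | i in [set i | (i < w t)%N]].
Proof.
move=> tT; apply/seteqP; split => [s [js]|_ [i it <-]] /=.
  rewrite in_itv/= => /andP[s0 st].
  by have [i iwt ->] := jump_times_jump st js; exists i.
split; first exact: (jump_jump_times it).
by rewrite /= in_itv/= (jump_gt0 it) (jump_le it).
Qed.

End jump_times.

Section sum_over_jumps.
Context {R : realType}.
Implicit Types (w : counting_path R) (s t T : R).

Lemma sum_jump_times (V : nmodType) w t (b : R -> V) :
  \sum_(s \in jump_times w `&` `]0, t]) b s = \sum_(i < w t) b (jump w i).
Proof.
rewrite (jump_timesE _ (lexx t)) fsbig_image; last first.
  by move=> i j; rewrite !inE => it jt; apply: (@jump_inj _ _ t); rewrite inE.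
by rewrite (fsbig_ord _ _ (fun i => b (jump w i))).
Qed.

End sum_over_jumps.

Section mx_entries.
Context {R : pzRingType} {m n : nat}.
Implicit Types A B : 'M[R]_(m, n).

Lemma addmxE A B i j : (A + B) i j = A i j + B i j. Proof. by rewrite mxE. Qed.
Lemma oppmxE A i j : (- A) i j = - A i j. Proof. by rewrite mxE. Qed.
Lemma scalemxE a A i j : (a *: A) i j = a * A i j. Proof. by rewrite mxE. Qed.
Lemma zeromxE i j : (0 : 'M[R]_(m, n)) i j = 0. Proof. by rewrite mxE. Qed.

End mx_entries.

(* Plain [mxE] would also unfold the entries of atoms such as Jacobians. *)
Ltac mx_ring := apply/matrixP => ? ?;
  rewrite ?(addmxE, oppmxE, scalemxE, zeromxE); ring.

(** * Matrix norms and integrals *)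

Section mx_norm_theory.
Context {R : realType}.

Lemma mx_norm_le m n (M : 'M[R]_(m, n)) (e : R) :
  0 <= e -> (forall i j, `|M i j| <= e) -> `|M| <= e.
Proof.
move=> e0 Me; rewrite /Num.norm/= mx_normrE; apply/bigmax_leP; by split.
Qed.

Lemma mx_norm_coord m n (M : 'M[R]_(m, n)) i j : `|M i j| <= `|M|.
Proof.
rewrite [leRHS]/Num.norm/= mx_normrE.
by apply/bigmax_geP; right; exists (i, j).
Qed.

Lemma cvg_mx_coord (T : Type) (F : set_system T) {FF : Filter F} m n
    (h : T -> 'M[R]_(m, n)) (M : 'M[R]_(m, n)) :
  (forall i j, h x i j @[x --> F] --> M i j) -> h x @[x --> F] --> M.
Proof.
move=> hM; apply/cvgrPdist_le => e e0.
have : \forall x \near F, forall ij : 'I_m * 'I_n,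
    `|M ij.1 ij.2 - h x ij.1 ij.2| <= e.
  apply: (@filter_forall _ _ (fun ij x => `|M ij.1 ij.2 - h x ij.1 ij.2| <= e)).
  by move=> [i j]; have /cvgrPdist_le/(_ _ e0) := hM i j.
apply: filterS => x hx; apply: mx_norm_le => [|i j]; first exact: ltW.
by rewrite !mxE; exact: (hx (i, j)).
Qed.

(** The norm of a matrix is its largest entry, which is submultiplicative only up to the inner
    dimension; the factors [d%:R] in later constants come from here. *)
Lemma mx_norm_mulmx m n p (A : 'M[R]_(m, n)) (B : 'M[R]_(n, p)) :
  `|A *m B| <= n%:R * `|A| * `|B|.
Proof.
apply: mx_norm_le => [|i j]; first by rewrite !mulr_ge0.
rewrite mxE (le_trans (ler_norm_sum _ _ _))//.
rewrite (@le_trans _ _ (\sum_(k < n) `|A| * `|B|))//; last first.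
  by rewrite sumr_const card_ord -[leLHS]mulr_natl mulrA.
by apply: ler_sum => k _; rewrite normrM ler_pM// mx_norm_coord.
Qed.

End mx_norm_theory.

Lemma measurable_segment {R : realType} (a b : R) :
  @measurable _ (g_sigma_algebraType R.-ocitv.-measurable) `[a, b].
Proof. exact: measurable_itv. Qed.

Section mx_integral_theory.
Context {R : realType} {m n : nat}.
Notation mu := (@lebesgue_measure R).
Implicit Types (F G : R -> 'M[R]_(m, n)) (a b u : R).

Definition mx_integrable (D : set R) F :=
  forall i j, mu.-integrable D (EFin \o (fun s => F s i j)).

Lemma mx_integrableS (D E : set R) F : measurable D -> measurable E ->
  E `<=` D -> mx_integrable D F -> mx_integrable E F.
Proof. by move=> mD mE ED DF i j; apply: integrableS (DF i j). Qed.

Lemma sub_mx_integrable a b c e F : a <= c -> e <= b ->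
  mx_integrable `[a, b] F -> mx_integrable `[c, e] F.
Proof.
move=> ac eb; apply: mx_integrableS; [exact: measurable_itv|exact: measurable_itv|].
by apply: subset_itv; rewrite bnd_simp.
Qed.

Lemma mx_integral_split b a c F : a <= b -> b <= c -> mx_integrable `[a, c] F ->
  mx_integral `[a, c] F = mx_integral `[a, b] F + mx_integral `[b, c] F.
Proof.
move=> ab bc iF; apply/matrixP => i j; rewrite !mxE.
have bcF : mu.-integrable `]b, c] (fun s => (F s i j)%:E).
  apply: integrableS (iF i j); [exact: measurable_itv|exact: measurable_itv|].
  by apply: subset_itv; rewrite bnd_simp.
apply/eqP; rewrite addrC -subr_eq; apply/eqP.
rewrite -(Rintegral_itv_obnd_cbnd bcF).
by rewrite -(@Rintegral_itvB _ (fun s => F s i j) (BLeft a) (BRight c) b (iF i j)) ?bnd_simp.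
Qed.

Lemma eq_mx_integrable D F G : measurable D -> (forall s, D s -> F s = G s) ->
  mx_integrable D F -> mx_integrable D G.
Proof.
by move=> mD FG iF i j; apply: eq_integrable (iF i j) => // s /[!inE]/= /FG ->.
Qed.

(** Between two jumps the integrands to be compared agree only on a half-open interval, because the
    solution jumps at the right end. Integrability does not see that endpoint. *)
Lemma mx_integrable_bndo a b F :
  mx_integrable `[a, b[ F <-> mx_integrable `[a, b] F.
Proof.
split=> iF i j; last first.
  apply: integrableS (iF i j); [exact: measurable_itv|exact: measurable_itv|].
  exact: subset_itv_co_cc.
have [ab|ba] := leP a b; last by rewrite set_itv_ge ?bnd_simp -?ltNge//;
  exact: integrable_set0.
apply/integrableP; split.
  have mF := measurable_int _ (iF i j).
  rewrite -(@setUitv1 _ _ _ _ true)//; apply/measurable_funU => //; split => //.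
  exact: measurable_fun_set1.
rewrite -integral_itv_bndo_bndc; last first.
  by apply: measurableT_comp => //; exact: measurable_int (iF i j).
by case/integrableP : (iF i j).
Qed.

Lemma eq_mx_integral_bndo a b F G : mx_integrable `[a, b] F ->
  (forall s, a <= s < b -> F s = G s) ->
  mx_integral `[a, b] F = mx_integral `[a, b] G.
Proof.
move=> /mx_integrable_bndo iF FG.
have iG : mx_integrable `[a, b[ G.
  by apply: eq_mx_integrable iF => // s /=; rewrite in_itv/=; exact: FG.
apply/matrixP => i j; rewrite !mxE.
rewrite -(Rintegral_itv_bndo_bndc (iF i j)) -(Rintegral_itv_bndo_bndc (iG i j)).
by apply: eq_Rintegral => s /[!inE]/=; rewrite in_itv/= => /FG ->.
Qed.

Lemma mx_integrableD a b F G :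
  mx_integrable `[a, b] F -> mx_integrable `[a, b] G ->
  mx_integrable `[a, b] (fun s => F s + G s).
Proof.
move=> iF iG i j.
have := integrableD (measurable_segment a b) (iF i j) (iG i j).
by apply: eq_integrable => // s _; rewrite /= mxE EFinD.
Qed.

Lemma mx_integralB a b F G :
  mx_integrable `[a, b] F -> mx_integrable `[a, b] G ->
  mx_integral `[a, b] (fun s => F s - G s) = mx_integral `[a, b] F - mx_integral `[a, b] G.
Proof.
move=> iF iG; apply/matrixP => i j; rewrite !mxE.
rewrite -(RintegralB (measurable_segment a b) (iF i j) (iG i j)).
by apply: eq_Rintegral => s _; rewrite !mxE.
Qed.

Lemma mx_integrableB a b F G :
  mx_integrable `[a, b] F -> mx_integrable `[a, b] G ->
  mx_integrable `[a, b] (fun s => F s - G s).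
Proof.
move=> iF iG i j.
have := integrableB (measurable_segment a b) (iF i j) (iG i j).
by apply: eq_integrable => // s _; rewrite /= !mxE EFinB.
Qed.

Lemma mx_integral1 a F : mx_integral `[a, a] F = 0.
Proof. by apply/matrixP => i j; rewrite !mxE set_itv1 Rintegral_set1. Qed.

Lemma norm_mx_integral_le a b F (H : R -> R) :
  mx_integrable `[a, b] F -> mu.-integrable `[a, b] (EFin \o H) ->
  (forall s, a <= s <= b -> `|F s| <= H s) ->
  `|mx_integral `[a, b] F| <= \int[mu]_(s in `[a, b]) H s.
Proof.
move=> iF iH FH; apply: mx_norm_le => [|i j].
  by apply: Rintegral_ge0 => s /FH; exact: le_trans.
rewrite mxE; apply: (le_trans (le_normr_Rintegral (measurable_segment a b) (iF i j))).
apply: le_Rintegral => //; first exact: integrable_norm.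
by move=> s /=; rewrite in_itv/= => Ds; rewrite (le_trans (mx_norm_coord _ _ _))// FH.
Qed.

Lemma mx_integral_continuous a b F : a <= b -> mx_integrable `[a, b] F ->
  {within `[a, b], continuous (fun u => mx_integral `[a, u] F)}.
Proof.
move=> ab iF u; apply: cvg_mx_coord => i j.
have /= := parameterized_integral_continuous ab (iF i j).
move=> /(_ u); rewrite /parameterized_integral.
have E x : mx_integral `[a, x] F i j = \int[mu]_(t in `[a, x]) F t i j.
  by rewrite mxE.
by rewrite /from_subspace E (funext E).
Qed.

End mx_integral_theory.

Section mx_integral_mulmx.
Context {R : realType}.
Notation mu := (@lebesgue_measure R).

Lemma mx_integrable_mulmxr m n p a b (F : R -> 'M[R]_(m, n)) (A : 'M[R]_(n, p)) :
  mx_integrable `[a, b] F -> mx_integrable `[a, b] (fun s => F s *m A).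
Proof.
move=> iF i j.
have := @integrable_sum _ _ _ mu _ (measurable_segment a b) _ (index_enum 'I_n) xpredT _
  (fun k _ => integrableZr (measurable_segment a b) (A k j) (iF i k)).
apply: eq_integrable => // s _ /=.
by rewrite mxE -sumEFin; apply: eq_bigr => k _; rewrite EFinM.
Qed.

Lemma mx_integral_mulmxr m n p a b (F : R -> 'M[R]_(m, n)) (A : 'M[R]_(n, p)) :
  mx_integrable `[a, b] F ->
  mx_integral `[a, b] (fun s => F s *m A) = mx_integral `[a, b] F *m A.
Proof.
move=> iF; apply/matrixP => i j; rewrite !mxE.
apply: EFin_inj; rewrite -sumEFin.
have iFA k : mu.-integrable `[a, b] (fun s => (F s i k * A k j)%:E).
  have := integrableZr (measurable_segment a b) (A k j) (iF i k).
  by apply: eq_integrable => // s _ /=; rewrite EFinM.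
rewrite /Rintegral fineK; last first.
  by apply: integrable_fin_num => //; exact: (mx_integrable_mulmxr A iF i j).
under eq_integral do rewrite mxE -sumEFin.
rewrite integral_sum//; apply: eq_bigr => k _.
rewrite mxE -(RintegralZr (A k j) (measurable_segment a b) (iF i k)) /Rintegral fineK//.
by apply: integrable_fin_num => //; exact: iFA.
Qed.

End mx_integral_mulmx.

(** The integral of a nonnegative function is a supremum over the simple functions below it, so the
    comparison holds for arbitrary functions. Sums over jump times can thus be integrated without
    proving them measurable in the path. *)
Lemma ge0_le_integralT d (T : measurableType d) (R : realType)
    (m : {measure set T -> \bar R}) (D : set T) (f g : T -> \bar R) :
  (forall x, D x -> (0 <= f x)%E) -> (forall x, D x -> (f x <= g x)%E) ->
  (\int[m]_(x in D) f x <= \int[m]_(x in D) g x)%E.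
Proof.
move=> f0 fg; rewrite !ge0_integralE//; last first.
  by move=> x Dx; exact: le_trans (f0 _ Dx) (fg _ Dx).
apply: ereal_sup_le => _ [h /= hf <-]; exists h => //= x.
apply: le_trans (hf x) _; rewrite !patchE; case: ifPn => // /[!inE]; exact: fg.
Qed.

(** * Probability that the jumps lie in a small cube *)

Section predictable_sets.
Context {R : realType}.
Implicit Types (s t a b : R) (A : set (counting_path R)).
Notation history t := (natural_history R t).
Notation predictable_set :=
  (@measurable _ (g_sigma_algebraType (@predictable_rectangles R))).

Lemma measurable_path_history s t (B : set nat) : 0 <= s -> s <= t ->
  @measurable _ (history t) [set w : counting_path R | B (w s)].
Proof.
move=> s0 st; apply: sub_sigma_algebra; exists s; first by rewrite /= in_itv/= s0 st.
by exists B.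
Qed.

Lemma measurable_path s (B : set nat) : 0 <= s ->
  @measurable _ (path_space R) [set w : counting_path R | B (w s)].
Proof.
move=> s0; apply: sub_sigma_algebra; exists s; first by rewrite /= in_itv/= s0.
by exists B.
Qed.

Lemma history_sub t A : @measurable _ (history t) A ->
  @measurable _ (path_space R) A.
Proof.
apply: (@sub_smallest2r _ _ _ _ _ _); first exact: smallest_sigma_algebra.
move=> _ [s /= + [B ->]]; rewrite in_itv/= => /andP[s0 st].
by exists s; [rewrite /= in_itv/= s0|exists B].
Qed.

Lemma predictable_rectangle a b A : 0 <= a -> @measurable _ (history a) A ->
  predictable_set (`]a, b] `*` A).
Proof.
move=> a0 mA; have [ab|ba] := ltP a b.
  by apply: sub_sigma_algebra; right; exists a, b, A.
rewrite set_itv_ge ?bnd_simp -?leNgt// set0X; exact: measurable0.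
Qed.

Lemma predictable_half_line a A : 0 <= a -> @measurable _ (history a) A ->
  predictable_set (`]a, +oo[ `*` A).
Proof.
move=> a0 mA.
rewrite (_ : _ `*` _ = \bigcup_k (`]a, a + k%:R] `*` A)).
  by apply: bigcupT_measurable => k; exact: predictable_rectangle.
apply/seteqP; split => [[s w] [/=]|[s w] [k _ [/=]]].
  rewrite in_itv/= andbT => as_ Aw; exists (Num.bound (s - a)) => //.
  split => //=; rewrite in_itv/= as_/= -lerBlDl.
  by apply/ltW/archi_boundP; rewrite subr_ge0 ltW.
by rewrite !in_itv/= => /andP[-> _].
Qed.

Lemma predictable_domain : predictable_set (`[0, +oo[ `*` setT).
Proof.
rewrite (_ : _ `*` _ = ([set 0] `*` setT) `|` (`]0, +oo[ `*` setT)).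
  apply: measurableU; last exact: predictable_half_line.
  by apply: sub_sigma_algebra; left; exists setT.
apply/seteqP; split => [[s w] [/=]|[s w]].
  rewrite in_itv/= andbT le_eqVlt => /predU1P[<-|s0] _; first by left.
  by right; split => //=; rewrite in_itv/= s0.
by move=> [[/= -> _]|[/=]]; rewrite ?in_itv/= ?lexx// andbT => /ltW -> _.
Qed.

Lemma predictable_indic (C : set (R * counting_path R)) : predictable_set C ->
  predictable (fun t w => (\1_C (t, w))%:E).
Proof.
move=> mC; rewrite /predictable; apply/measurable_EFinP.
have mC1 : @measurable_fun _ _ (g_sigma_algebraType (@predictable_rectangles R))
    (measurableTypeR R) (`[0%R, +oo[ `*` setT) (\1_C : _ -> R).
  exact: measurable_indic.
by congr (measurable_fun _ _) : mC1; apply/funext => -[].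
Qed.

Lemma predictable_time (B : set (measurableTypeR R)) : measurable B ->
  predictable (fun t w => (\1_B t)%:E).
Proof.
move=> mB; apply/measurable_EFinP.
have mfst : @measurable_fun _ _ (g_sigma_algebraType (@predictable_rectangles R))
    (measurableTypeR R) (`[0%R, +oo[ `*` setT) fst.
  apply: (measurability (@RGenOInfty.G R) (RGenOInfty.measurableE R)).
  move=> _ [_ [x ->] <-]; rewrite (_ : _ `&` _ =
    if x < 0 then `[0, +oo[ `*` setT else `]x, +oo[ `*` setT).
    case: ltP => x0; first exact: predictable_domain.
    exact: predictable_half_line.
  apply/seteqP; split => -[s w] /=; rewrite ?in_itv/= ?andbT.
    by move=> [[s0 _] xs]; case: ltP => x0; split => //=; rewrite in_itv/= ?s0 ?xs.
  case: ltP => x0 [/=]; rewrite in_itv/= andbT => xs _; split => //.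
    exact: lt_le_trans xs.
  by split => //; exact: le_trans (ltW xs).
have m1 : measurable_fun setT (\1_B : measurableTypeR R -> measurableTypeR R).
  exact: measurable_indic.
exact: (measurableT_comp m1 mfst).
Qed.

Lemma rational_between s t : 0 <= s -> s < t ->
  exists q : rat, s < ratr q < t.
Proof. by move=> s0 /rat_in_itvoo[q]; rewrite in_itv/= => h; exists q. Qed.

End predictable_sets.

Section rectangle_bound.
Context {R : realType} (P : probability (path_space R) R).
Implicit Types (w : counting_path R) (a b : nat -> R).
Notation predictable_set :=
  (@measurable _ (g_sigma_algebraType (@predictable_rectangles R))).
Notation mu := (@lebesgue_measure R).

(** In terms of jump times this says [a i < jump w i <= b i] for [i < m]. The formulation by values
    of the path shows that finitely many coordinates decide it. *)
Definition jumps_in (m : nat) a b : set (counting_path R) :=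
  [set w | forall i, (i < m)%N -> (w (a i) <= i < w (b i))%N].

Lemma measurable_jumps_in_history m a b (t : R) :
  (forall i, 0 <= a i <= t) -> (forall i, 0 <= b i <= t) ->
  @measurable _ (natural_history R t) (jumps_in m a b).
Proof.
move=> at_ bt; rewrite (_ : jumps_in m a b = \bigcap_(i in `I_m)
   ([set w : counting_path R | [set k | (k <= i)%N] (w (a i))] `&`
    [set w : counting_path R | [set k | (i < k)%N] (w (b i))])).
  apply: fin_bigcap_measurable => // i _; have /andP[ai0 ait] := at_ i.
  have /andP[bi0 bit] := bt i.
  by apply: measurableI; apply: measurable_path_history.
apply/seteqP; split => w /= wab i im; last by have [/= -> ->] := wab i im.
by have /andP[] := wab i im.
Qed.

Lemma measurable_jumps_in m a b : (forall i, 0 <= a i) -> (forall i, 0 <= b i) ->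
  @measurable _ (path_space R) (jumps_in m a b).
Proof.
(* The sum is a crude common bound for the endpoints of index below [m]; truncation by [t] changes
   only the other ones, on which the event does not depend. *)
move=> a0 b0; pose t := \sum_(i < m) (a i + b i).
rewrite (_ : jumps_in m a b =
  jumps_in m (fun i => Num.min (a i) t) (fun i => Num.min (b i) t)).
  apply: (@history_sub _ t); apply: measurable_jumps_in_history => i;
    rewrite ge_min lexx orbT le_min ?a0 ?b0/= andbT; apply: sumr_ge0 => j _;
    exact: addr_ge0.
suff leab i : (i < m)%N -> a i <= t /\ b i <= t.
  by apply/seteqP; split => w /= + i im => /(_ i im);
    have [ai bi] := leab i im; rewrite !min_l.
move=> im; rewrite /t (bigD1 (Ordinal im))//=.
have s0 : 0 <= \sum_(j < m | j != Ordinal im) (a j + b j).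
  by apply: sumr_ge0 => j _; exact: addr_ge0.
by rewrite -addrA lerDl addr_ge0//= addrCA lerDl addr_ge0.
Qed.

(* The event [jumps_in m a b] is decided as soon as the [m]-th jump has occurred. *)
Lemma jumps_in_min m a b (q : R) w : (m <= w q)%N ->
  jumps_in m (fun i => Num.min (a i) q) (fun i => Num.min (b i) q) w <->
  jumps_in m a b w.
Proof.
move=> mq; split=> /= wab i im; have /andP[wa wb] := wab i im; apply/andP; split.
- have [aq|qa] := leP (a i) q; first by move: wa; rewrite min_l.
  by move: wa; rewrite min_r ?ltW// leqNgt (leq_trans im mq).
- by apply: leq_trans wb _; apply: path_val_homo; rewrite ge_min lexx.
- by apply: leq_trans wa; apply: path_val_homo; rewrite ge_min lexx.
- by rewrite minEle; case: ifP => // _; exact: leq_trans im mq.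
Qed.

(** The pairs of a time in []a m, b m]] and a path whose first [m] jumps occurred strictly before
    that time, in their windows, and whose next jump did not. Conditions on the past strictly before
    [s] are tested at rational times, clamped to be nonnegative, so that the set is built from
    countably many predictable rectangles. *)
Definition next_jump_set m a b : set (R * counting_path R) :=
  (`]a m, b m] `*` setT) `&`
  (\bigcup_(q : rat) (`]Num.max 0 (ratr q), +oo[ `*`
     ([set w : counting_path R | [set k | (m <= k)%N] (w (Num.max 0 (ratr q)))] `&`
      jumps_in m (fun i => Num.min (a i) (Num.max 0 (ratr q)))
                 (fun i => Num.min (b i) (Num.max 0 (ratr q)))))) `\`
  \bigcup_(q : rat) (`]Num.max 0 (ratr q), +oo[ `*`
     [set w : counting_path R | [set k | (m < k)%N] (w (Num.max 0 (ratr q)))]).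

Lemma predictable_next_jump_set m a b : (forall i, 0 <= a i) ->
  (forall i, 0 <= b i) -> predictable_set (next_jump_set m a b).
Proof.
move=> a0 b0.
have q0 (q : rat) : 0 <= Num.max 0 (ratr q) :> R by rewrite le_max lexx.
apply: measurableD; [apply: measurableI|].
- exact: predictable_rectangle.
- apply: bigcupT_measurable_rat => q; apply: predictable_half_line => //.
  apply: measurableI; first exact: measurable_path_history.
  by apply: measurable_jumps_in_history => i; rewrite le_min q0 ge_min lexx orbT ?a0 ?b0.
- apply: bigcupT_measurable_rat => q; apply: predictable_half_line => //.
  exact: measurable_path_history.
Qed.

Lemma next_jump_setP m a b s w : (forall i, 0 <= a i) -> next_jump_set m a b (s, w) ->
  [/\ a m < s <= b m, jumps_in m a b w & forall q, q < s -> (w q <= m)%N].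
Proof.
move=> a0 [[[/= + _] [q _ [_ [/= mq /(jumps_in_min _ _ mq) wab]]]]].
rewrite in_itv/= => /andP[as_ sb] nq; split; rewrite ?as_//.
move=> q' q's; rewrite leqNgt; apply/negP => mq'; apply: nq.
have s0 : 0 < s := le_lt_trans (a0 m) as_.
have : Num.max 0 q' < s by rewrite gt_max s0 q's.
move=> /rational_between[|r /andP[qr rs]]; first by rewrite le_max lexx.
have r0 : Num.max 0 (ratr r) = ratr r :> R.
  by rewrite max_r// ltW// (le_lt_trans _ qr)// le_max lexx.
exists r => //; split; rewrite r0/= ?in_itv/= ?rs//.
apply: leq_trans mq' _; apply: path_val_homo.
by rewrite ltW// (le_lt_trans _ qr)// le_max lexx orbT.
Qed.

Lemma jump_next_jump_set m a b w : (forall i, 0 <= a i) ->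
  jumps_in m.+1 a b w -> next_jump_set m a b (jump w m, w).
Proof.
move=> a0 wab; have /andP[wam wbm] := wab m (ltnSn m).
have aj : a m < jump w m by rewrite (jump_gt _ wbm).
have [q q0 [qj mq]] : exists2 q : rat, 0 <= ratr q :> R &
    ratr q < jump w m /\ (m <= w (ratr q))%N.
  have [r [r0 rj mr]] : exists r : R, [/\ 0 <= r, r < jump w m & (m <= w r)%N].
    case: m wab wbm {wam aj} => [|m] wab wbm.
      by exists 0; rewrite (jump_gt0 wbm).
    have mb := ltn_trans (ltnSn m) wbm.
    exists (jump w m); split; first exact/ltW/(jump_gt0 mb).
      exact: jump_lt wbm _.
    by rewrite (path_jump mb).
  have [q /andP[rq qj]] := rational_between r0 rj.
  exists q; first exact/ltW/(le_lt_trans r0).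
  by split => //; apply: leq_trans mr _; exact/path_val_homo/ltW.
split.
  split; first by split; rewrite //= in_itv/= aj (jump_le wbm).
  exists q => //; rewrite max_r//; split; first by rewrite /= in_itv/= qj.
  split => //; apply/(jumps_in_min _ _ mq) => i im; apply: wab.
  exact: ltn_trans im _.
move=> [r _ [/=]]; rewrite in_itv/= andbT => rj.
by rewrite ltnNge -(jump_gt _ wbm) rj.
Qed.

Variable L : R -> counting_path R -> R.
Hypothesis PL : has_intensity P L.

(* The indicator of [next_jump_set], integrated against the counting process, dominates the
   indicator of [jumps_in m.+1 a b]; on that set the intensity is at most [M]. *)
Lemma jumps_in_bound (T M r : R) (n : nat) : 0 <= M -> 0 <= r ->
  (forall s w, 0 < s <= T -> (forall q, q < s -> (w q < n)%N) -> L s w <= M) ->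
  forall m, (m <= n)%N -> forall a b,
  (forall i, 0 <= a i) -> (forall i, 0 <= b i <= T) -> (forall i, b i - a i <= r) ->
  (P (jumps_in m a b) <= ((M * r) ^+ m)%:E)%E.
Proof.
move=> M0 r0 LM; elim=> [|m IH] mn a b a0 bT abr.
  rewrite expr0; apply: probability_le1; apply: measurable_jumps_in => // i.
  by case/andP: (bT i).
have b0 i : 0 <= b i by case/andP: (bT i).
have mE k := measurable_jumps_in k a0 b0.
have [L0 _ _ LP] := PL.
have := LP _ (predictable_indic (predictable_next_jump_set m a0 b0))
  (fun t w => ltac:(by rewrite lee_fin)).
move=> eqP.
rewrite -[X in P X]setIT -integral_indic//.
(* On [jumps_in m.+1 a b] the single term at [s = jump w m] already contributes 1. *)
apply: (@le_trans _ _ (\int[P]_w (\esum_(s in jump_times w)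
    (\1_(next_jump_set m a b) (s, w))%:E))%E).
  apply: ge0_le_integralT => w _; first by rewrite lee_fin.
  rewrite indicE; case: (boolP (w \in _)) => [|_]; last first.
    by apply: esum_ge0 => *; rewrite lee_fin.
  rewrite inE => wE; apply: esum_ge; exists [set jump w m].
    split; first exact: finite_set1.
    move=> _ ->; have /andP[_ wb] := wE m (ltnSn m); exact: jump_jump_times wb.
  by rewrite fsbig_set1 indicE mem_set//; exact: jump_next_jump_set.
rewrite eqP.
apply: (@le_trans _ _ (\int[P]_w ((M * r)%:E * (\1_(jumps_in m a b) w)%:E)))%E.
  apply: ge0_le_integralT => w _.
    by apply: integral_ge0 => s; rewrite /= in_itv/= andbT => s0; rewrite mule_ge0// lee_fin// L0.
  (* On [next_jump_set] fewer than [n] jumps precede [s], so the intensity is at most [M]; and the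
     set projects into a time window of length at most [r] and into the event for the first [m]
     jumps. *)
  apply: (@le_trans _ _ (\int[mu]_(s in `[0%R, +oo[)
     ((M * \1_(jumps_in m a b) w)%:E * (\1_(`]a m, b m]) s)%:E)))%E.
    apply: ge0_le_integralT => s; rewrite /= in_itv/= andbT => s0.
      by rewrite mule_ge0// lee_fin// L0.
    rewrite -!EFinM lee_fin indicE; case: (boolP (_ \in _)) => [|_]; last first.
      by rewrite mul0r !mulr_ge0.
    rewrite inE => /(next_jump_setP a0)[/andP[as_ sb] wE wq].
    rewrite mul1r indicE mem_set// mulr1 indicE mem_set/=; last by rewrite in_itv/= as_.
    rewrite mulr1; apply: LM.
      rewrite (le_lt_trans (a0 m) as_) (le_trans sb)//.
      by case/andP: (bT m).
    by move=> q /wq qm; exact: leq_ltn_trans mn.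
  rewrite ge0_integralZl//; last 2 first.
  - by apply/measurable_EFinP; exact: measurable_indic.
  - by rewrite lee_fin mulr_ge0.
  rewrite integral_indic// setIidl; last first.
    move=> s /=; rewrite !in_itv/= => /andP[as_ _].
    by rewrite (le_trans (a0 m) (ltW as_)).
  have mI : (mu `]a m, b m] <= r%:E)%E.
    by rewrite lebesgue_measure_itv/=; case: ifPn => // ab; rewrite -EFinB lee_fin.
  apply: (le_trans (lee_wpmul2l _ mI)); first by rewrite lee_fin mulr_ge0.
  by rewrite -!EFinM lee_fin mulrAC.
rewrite ge0_integralZl ?lee_fin ?mulr_ge0//; last first.
  by apply/measurable_EFinP; exact: measurable_indic.
rewrite integral_indic// setIT exprS [leRHS]EFinM.
apply: lee_wpmul2l; first by rewrite lee_fin mulr_ge0.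
exact: IH (ltnW mn) _ _ a0 bT abr.
Qed.

(** With the deterministic process [\1_N] the intensity identity equates the expected number of
    jumps in [N] with the expected integral of the intensity over [N], which is 0. *)
Lemma no_jump_in_null_set (B : set (measurableTypeR R)) : mu.-negligible B ->
  {ae P, forall w, forall s, jump_times w s -> ~ B s}.
Proof.
move=> [N [mN N0 BN]].
(* The index of the jump and an integer horizon leave countably many events, on each of which
   [jump w i] is a genuine jump time and a measurable function. *)
have bad0 i k : P.-negligible [set w : counting_path R | (i < w k%:R)%N /\ N (jump w i)].
  have mD : @measurable _ (path_space R) [set w : counting_path R | (i < w k%:R)%N].
    exact: (@measurable_path _ _ [set j | (i < j)%N]).
  have mj : @measurable_fun _ _ (path_space R) (measurableTypeR R)
      [set w : counting_path R | (i < w k%:R)%N] (jump ^~ i).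
    apply: (measurability (@RGenOInfty.G R) (RGenOInfty.measurableE R)).
    move=> _ [_ [x ->] <-]; rewrite (_ : _ `&` _ =
      [set w : counting_path R | (i < w k%:R)%N] `&`
      [set w : counting_path R | [set j | (j <= i)%N] (w (Num.max 0 x))]).
      by apply: measurableI => //; apply: measurable_path; rewrite le_max lexx.
    apply/seteqP; split => w /= [ik]; rewrite in_itv/= andbT => xj; split => //.
      by rewrite -(jump_gt _ ik) gt_max (jump_gt0 ik).
    by move: xj; rewrite -(jump_gt _ ik) gt_max => /andP[].
  have mbad := mj mD _ mN.
  apply/negligibleP => //; apply/eqP; rewrite -measure_le0.
  have [L0 _ _ LP] := PL.
  set bad := [set w : counting_path R | _].
  apply: (@le_trans _ _ (\int[P]_w (\1_bad w)%:E)%E).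
    by rewrite integral_indic// setIT.
  apply: (@le_trans _ _ (\int[P]_w (\esum_(s in jump_times w) (\1_N s)%:E))%E).
    apply: ge0_le_integralT => w _; first by rewrite lee_fin.
    rewrite indicE; case: (boolP (w \in _)) => [|_]; last first.
      by apply: esum_ge0 => *; rewrite lee_fin.
    rewrite inE => -[/= ik Nj]; apply: esum_ge; exists [set jump w i].
      split; first exact: finite_set1.
      by move=> _ ->; exact: jump_jump_times ik.
    by rewrite fsbig_set1 indicE mem_set.
  rewrite (LP _ (predictable_time mN)) => [|t w]; last by rewrite lee_fin.
  rewrite integral0_eq// => w _.
  apply/eqP; rewrite eq_le integral_ge0 ?andbT; last first.
    by move=> s; rewrite /= in_itv/= andbT => s0; rewrite mule_ge0// lee_fin// L0.
  (* The integrand is at most [+oo * \1_N s], whose integral is [+oo * 0 = 0], whatever the size of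
     the intensity. *)
  rewrite -[leRHS](mule0 +oo%E) -N0 -[in leRHS](setIT N) -integral_indic//.
  rewrite -ge0_integralZl//; last by apply/measurable_EFinP; exact: measurable_indic.
  rewrite [leLHS]integral_mkcond; apply: ge0_le_integralT => s _.
    rewrite patchE; case: ifPn => // /[!inE]/=; rewrite in_itv/= andbT => s0.
    by rewrite mule_ge0// lee_fin// L0.
  rewrite patchE; case: ifPn => [|_]; last by rewrite mule_ge0// lee_fin.
  rewrite inE/= in_itv/= andbT => s0; rewrite indicE.
  case: (s \in N); first by rewrite mule1 leey.
  by rewrite mul0e mule0.
suff : P.-negligible (~` [set w : counting_path R |
  forall s, jump_times w s -> ~ B s]) by [].
apply: negligibleS (negligible_bigcup (fun i => negligible_bigcup (bad0 i))).
move=> w /= /existsNP[s /not_implyP[js /contrapT Bs]].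
have sk : s <= (Num.bound `|s|)%:R.
  by rewrite (le_trans (ler_norm s))// ltW// archi_boundP.
have [i ik sj] := jump_times_jump sk js.
exists i => //; exists (Num.bound `|s|) => //; split => //; rewrite -sj.
exact: BN.
Qed.

End rectangle_bound.

(** * One-sided derivatives and local boundedness of the Hawkes intensity *)

Section derive_within_theory.
Context {R : realType} {V : normedModType R}.

Lemma near_derive_within (D : set R) (h : R -> V) (t e : R) : 0 < e ->
  derivable_within D h t -> \forall s \near t, D s ->
  `|h s - h t - (s - t) *: derive_within D h t| <= e * `|s - t|.
Proof.
move=> e0 dh; have /cvgrPdist_le/(_ _ e0) := dh.
rewrite -/(derive_within D h t) => dhe.
have : \forall s \near t, s != t -> D s ->
  `|derive_within D h t - difference_quotient h t s| <= e by exact: dhe.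
apply: filterS => s hs Ds.
have [->|st] := eqVneq s t; first by rewrite !subrr scale0r subr0 !normr0 mulr0.
have := hs st Ds; rewrite distrC /difference_quotient => {}hs.
have st0 : s - t != 0 by rewrite subr_eq0.
have -> : h s - h t - (s - t) *: derive_within D h t =
    (s - t) *: ((s - t)^-1 *: (h s - h t) - derive_within D h t).
  by rewrite scalerBr scalerA divff// scale1r.
by rewrite normrZ mulrC ler_wpM2r.
Qed.

Lemma continuous_of_derivable_within (D : set R) (h : R -> V) :
  (forall t, D t -> derivable_within D h t) -> {within D, continuous h}.
Proof.
move=> dh; apply/subspace_continuousP => t Dt.
apply/cvgrPdist_le => e e0.
suff : \forall s \near t, D s -> `|h t - h s| <= e by [].
set l := derive_within D h t.
have l0 : 0 < `|l| + 1 by rewrite ltr_wpDl.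
have t1 : \forall s \near t, `|s - t| <= e / (`|l| + 1).
  have /cvgrPdist_le : (fun s : R => s) s @[s --> t] --> t by exact: cvg_id.
  by move=> /(_ _ (divr_gt0 e0 l0)); apply: filterS => s; rewrite distrC.
near=> s => Ds.
have := near (near_derive_within ltr01 (dh _ Dt)) s.
move=> /(_ ltac:(by [])) /(_ Ds) hs.
rewrite distrC -[h s - h t](subrK ((s - t) *: l)).
apply: (le_trans (ler_normD _ _)); rewrite normrZ.
apply: (le_trans (lerD hs (lexx _))).
rewrite mul1r -{1}[`|s - t|]mulr1 -mulrDr [1 + _]addrC -ler_pdivlMr//.
by near: s.
Unshelve. all: by end_near. Qed.

End derive_within_theory.

Section hawkes_bound.
Context {R : realType}.

Lemma derivable_within_bounded (h : R -> R) (b : R) : 0 <= b ->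
  differentiable_bounded_derivative h ->
  exists M, forall t, 0 <= t <= b -> h t <= M.
Proof.
move=> b0 [dh _].
have ch : {within `[0, b], continuous h}.
  apply: (@continuous_subspaceW _ _ `[0, b] `[0, +oo[).
    by apply: subset_itvl; rewrite bnd_simp.
  by apply: continuous_of_derivable_within => t /=; rewrite in_itv/= andbT; exact: dh.
have [c _ hc] := EVT_max b0 ch.
by exists (h c) => t tb; apply: hc; rewrite in_itv.
Qed.

(** With fewer than [n] jumps strictly before [s], the argument of [gamma] stays in the compact
    interval [[0, n * M2]], where [M2] bounds the kernel on [[0, T]]; a function with one-sided
    derivatives is continuous, hence bounded there. *)
Lemma hawkes_intensity_bound (lam mu gamma : R -> R) (T : R) (n : nat) :
  0 <= T -> hawkes_parameters lam mu gamma ->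
  exists2 M, 0 <= M & forall s (w : counting_path R), 0 < s <= T ->
    (forall q, q < s -> (w q < n)%N) -> hawkes_intensity lam mu gamma s w <= M.
Proof.
move=> T0 [dlam _ mu0 [dmu _] _ _ [dgamma _] _ _].
have [M1 hM1] := derivable_within_bounded T0 dlam.
have [M2 hM2] := derivable_within_bounded T0 dmu.
have M20 : 0 <= M2 by apply: le_trans (mu0 0 (lexx _)) (hM2 _ _); rewrite lexx T0.
have nM0 : 0 <= n%:R * M2 by rewrite mulr_ge0.
have [M3 hM3] := derivable_within_bounded nM0 dgamma.
exists (Num.max 0 (M1 + M3)); first by rewrite le_max lexx.
move=> s w /andP[s0 sT] wn; rewrite le_max; apply/orP; right.
rewrite /hawkes_intensity lerD//; first by apply: hM1; rewrite (ltW s0) sT.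
apply: hM3.
(* The intensity sums over jumps strictly before [s]; a possible jump at [s] is removed by an
   indicator. *)
have -> : jump_times w `&` `]0, s[ = (jump_times w `&` `]0, s]) `&` [set x | x < s].
  apply/seteqP; split => [x [jx]|x [[jx]]] /=; rewrite !in_itv/=.
    by move=> /andP[-> xs]; rewrite ltW.
  by move=> /andP[-> _] ->.
rewrite fsbig_mkcondr sum_jump_times.
have wsn : (w s <= n)%N.
  have /filter_ex[q [qs wq]] : \forall q \near s^'-, q < s /\ (w s <= (w q).+1)%N.
    by near=> q; split; near: q; [exact: nbhs_left_lt|exact: path_val_unit].
  exact: leq_trans wq (wn _ qs).
have term (i : 'I_(w s)) : 0 <= (if jump w i \in [set x | x < s] then mu (s - jump w i)
    else 0) <= M2.
  case: ifPn => [|_]; last by rewrite lexx M20.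
  rewrite inE/= => js; apply/andP; split; first by apply: mu0; rewrite subr_ge0 ltW.
  apply: hM2; rewrite subr_ge0 (ltW js)/=.
  by rewrite (le_trans _ sT)// gerBl ltW// (jump_gt0 (ltn_ord i)).
apply/andP; split; first by apply: sumr_ge0 => i _; case/andP: (term i).
apply: (@le_trans _ _ (\sum_(i < w s) M2)).
  by apply: ler_sum => i _; case/andP: (term i).
by rewrite sumr_const card_ord -[leLHS]mulr_natl ler_wpM2r// ler_nat.
Unshelve. all: by end_near. Qed.

End hawkes_bound.

(** * Negligible sets of paths *)

Section outer_null.
Context d (T : measurableType d) (R : realType) (P : {measure set T -> \bar R}).

(** Since [S] may fail to be measurable, its nullity is reached from outside, by intersecting
    measurable covers of measure at most [1 / k.+1]. *)
Lemma small_covers_negligible (S : set T) :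
  (forall e : R, 0 < e ->
     exists N, [/\ measurable N, S `<=` N & (P N <= e%:E)%E]) ->
  P.-negligible S.
Proof.
move=> small.
have /choice[N hN] : forall k : nat, exists N,
    [/\ measurable N, S `<=` N & (P N <= (k.+1%:R^-1)%:E)%E].
  by move=> k; apply: small; rewrite invr_gt0.
have mN : measurable (\bigcap_k N k).
  by apply: bigcapT_measurable => k; case: (hN k).
exists (\bigcap_k N k); split => //; last first.
  by move=> x Sx k _; have [_ + _] := hN k; exact.
have le_inv k : (P (\bigcap_k N k) <= (k.+1%:R^-1)%:E)%E.
  have [mNk _ Pk] := hN k; apply: le_trans Pk; apply: le_measure; rewrite ?inE//.
  exact: bigcap_inf.
have fin : P (\bigcap_k N k) \is a fin_num.
  rewrite ge0_fin_numE//; exact: le_lt_trans (le_inv 0%N) (ltry _).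
apply/eqP; rewrite eq_le measure_ge0 andbT -(fineK fin) lee_fin.
rewrite leNgt; apply/negP => /ltr_add_invr[k].
rewrite add0r ltNge => /negP; apply.
by rewrite -lee_fin fineK.
Qed.

Lemma measure_bigsetU_le (I : Type) (s : seq I) (E : I -> set T) (p : pred I) :
  (forall i, measurable (E i)) ->
  (P (\big[setU/set0]_(i <- s | p i) E i) <= \sum_(i <- s | p i) P (E i))%E.
Proof.
move=> mE; elim: s => [|i s IH]; first by rewrite !big_nil measure0.
rewrite !big_cons; case: ifP => // _.
apply: (le_trans (measureU2 _ (mE i) _)); first exact: bigsetU_measurable.
by rewrite leeD.
Qed.

End outer_null.

Section lipschitz_preimage.
Context {R : realType} (P : probability (path_space R) R).
Variables (n : nat) (T M c : R).
Hypotheses (T0 : 0 < T) (M0 : 0 <= M) (c0 : 0 < c).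
Hypothesis jumps_bound : forall r a b, 0 <= r ->
  (forall i, 0 <= a i) -> (forall i, 0 <= b i <= T) -> (forall i, b i - a i <= r) ->
  (P (jumps_in n a b) <= ((M * r) ^+ n)%:E)%E.
Variables (S : set (counting_path R)) (G : counting_path R -> 'I_n -> R).
Hypothesis ST : forall w, S w -> w T = n.
Hypothesis lipschitz : forall w w' e, S w -> S w' ->
  (forall k, `|G w k - G w' k| <= e) ->
  forall i, (i < n)%N -> `|jump w i - jump w' i| <= c * e.

Lemma prod_addr_cvg (I : Type) (s : seq I) (l : I -> R) :
  \prod_(i <- s) (l i + r) @[r --> 0] --> \prod_(i <- s) l i.
Proof.
elim: s => [|i s IH].
  by rewrite big_nil; under eq_fun do rewrite big_nil; exact: cvg_cst.
rewrite big_cons; under eq_fun do rewrite big_cons.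
apply: cvgM IH; rewrite -[X in _ --> X]addr0.
by apply: cvgD; [exact: cvg_cst|exact: cvg_id].
Qed.

(** If a path [w0] of [S] has its coordinates in the cube, every other such path has its jump times
    within [c * r] of those of [w0], so [n] windows of length [3 * c * r] capture them all. *)
Lemma cell_cover (lo : 'I_n -> R) (r : R) : 0 < r -> exists N : set (path_space R),
  [/\ measurable N,
      forall w, S w -> (forall i, lo i <= G w i <= lo i + r) -> N w &
      (P N <= ((M * (3 * c * r)) ^+ n)%:E)%E].
Proof.
move=> r0; have cr0 : 0 < c * r by rewrite mulr_gt0.
have [[w0 Sw0 Gw0]|noS] := pselect (exists2 w, S w &
    forall i, lo i <= G w i <= lo i + r); last first.
  exists set0; split => //; first by move=> w Sw Gw; apply: noS; exists w.
  by rewrite measure0 lee_fin exprn_ge0// !mulr_ge0// ltW.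
(* The windows of [jumps_in] are open on the left, so the lower end is moved a further [c * r] down;
   this makes the factor 3. Beyond index [n], [b] takes the default value 0 to satisfy the bounds
   required at all indices. *)
pose a i := Num.max 0 (jump w0 i - 2 * (c * r)).
pose b i := if (i < n)%N then Num.min T (jump w0 i + c * r) else 0.
have j0 i : (i < n)%N -> 0 < jump w0 i by move=> il; apply: (@jump_gt0 _ _ _ T); rewrite ST.
have a0 i : 0 <= a i by rewrite le_max lexx.
have bT i : 0 <= b i <= T.
  rewrite /b; case: ifP => [/j0 ji|_]; last by rewrite lexx ltW.
  by rewrite le_min (ltW T0) ge_min lexx addr_ge0// ltW.
exists (jumps_in n a b); split.
- by apply: measurable_jumps_in => // i; case/andP: (bT i).
- move=> w Sw Gw i il; have iT : (i < w T)%N by rewrite ST.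
  have : `|jump w i - jump w0 i| <= c * r.
    apply: lipschitz => // k; have /andP[] := Gw k; have /andP[] := Gw0 k.
    by move=> *; rewrite ler_norml; apply/andP; split; lra.
  rewrite ler_norml => /andP[j1 j2]; apply/andP; split.
    rewrite -(jump_gt _ iT) gt_max (jump_gt0 iT)/=; lra.
  rewrite (jumpP _ iT) /b il le_min (jump_le iT)/=; lra.
- apply: jumps_bound => //; first by rewrite !mulr_ge0// ltW.
  move=> i; rewrite /b; case: ifP => [il|_]; last first.
    by rewrite (@le_trans _ _ 0)// ?sub0r ?oppr_le0// !mulr_ge0// ltW.
  have : Num.min T (jump w0 i + c * r) <= jump w0 i + c * r by rewrite ge_min lexx orbT.
  have : jump w0 i - 2 * (c * r) <= a i by rewrite le_max lexx orbT.
  lra.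
Qed.

(** Only cubes are controlled, so the box is cut into cells of side [r]. Their total volume is at
    most the product of the [l i + r], which tends to the volume of the box; the error [e] pays for
    this, also when some [l i] is 0. *)
Lemma box_cover (lo l : 'I_n -> R) (e : R) : 0 < e -> (forall i, 0 <= l i) ->
  exists N : set (path_space R),
  [/\ measurable N,
      forall w, S w -> (forall i, lo i <= G w i <= lo i + l i) -> N w &
      (P N <= ((M * (3 * c)) ^+ n * \prod_i l i + e)%:E)%E].
Proof.
move=> e0 l0; set C := (M * (3 * c)) ^+ n.
have C0 : 0 <= C by rewrite exprn_ge0// !mulr_ge0// ltW.
have C1 : 0 < C + 1 by rewrite ltr_wpDl.
have [r [r0 rl]] : exists r, 0 < r /\
    \prod_i (l i + r) <= \prod_i l i + e / (C + 1).
  have /cvgrPdist_le/(_ _ (divr_gt0 e0 C1)) hl :=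
    cvg_at_right_filter (@prod_addr_cvg _ (index_enum 'I_n) l).
  apply: (@filter_ex _ (0 : R)^'+); near=> r.
  split; first by near: r; exact: nbhs_right_gt.
  rewrite -lerBlDl; apply: le_trans (ler_norm _) _; rewrite distrC.
  by near: r.
(* [N i] cells cover side [i] and satisfy [N i * r <= l i + r]. All indices live in one type ['I_K],
   so that the sum over cells factors as a product of sums over the sides. *)
pose N i := (Num.trunc (l i / r)).+1.
pose K := (\sum_i N i)%N.
have NK i : (N i <= K)%N by rewrite /K (bigD1 i)//= leq_addr.
pose Q (i : 'I_n) : pred 'I_K := fun j => (j < N i)%N.
have /choice[E hE] := fun h : {ffun 'I_n -> 'I_K} =>
  cell_cover (fun i => lo i + (h i)%:R * r) r0.
exists (\big[setU/set0]_(h in family Q) E h); split.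
- by apply: bigsetU_measurable => h _; case: (hE h).
- move=> w Sw Gw.
  have x0 i : 0 <= (G w i - lo i) / r.
    by rewrite divr_ge0 ?(ltW r0)// subr_ge0; case/andP: (Gw i).
  have hN i : (Num.trunc ((G w i - lo i) / r) < N i)%N.
    rewrite ltnS; apply: le_truncn; rewrite ler_pM2r ?invr_gt0//.
    by rewrite lerBlDl; case/andP: (Gw i).
  pose h : {ffun 'I_n -> 'I_K} := [ffun i => Ordinal (leq_trans (hN i) (NK i))].
  have hQ : h \in family Q.
    by apply/familyP => i; rewrite /h ffunE; exact: hN.
  rewrite -bigcup_seq_cond; exists h => //=.
    by rewrite mem_index_enum hQ.
  have [_ + _] := hE h; apply => // i; rewrite ffunE/=.
  have := x0 i; rewrite -truncn_le => t1.
  have t2 : (G w i - lo i) / r < (Num.trunc ((G w i - lo i) / r)).+1%:R.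
    by rewrite -truncn_le_nat.
  move: t1 t2; set t := Num.trunc _.
  rewrite ler_pdivlMr// ltr_pdivrMr// -natr1 mulrDl mul1r => t1 t2.
  by apply/andP; split; lra.
- have mE h : measurable (E h) by case: (hE h).
  apply: (le_trans (measure_bigsetU_le _ _ _ mE)).
  apply: (@le_trans _ _ (\sum_(h in family Q) ((M * (3 * c * r)) ^+ n)%:E)%E).
    by apply: lee_sum => h _; case: (hE h).
  have -> : (M * (3 * c * r)) ^+ n = C * \prod_(i < n) r.
    by rewrite prodr_const card_ord -exprMn; congr (_ ^+ _); ring.
  rewrite sumEFin lee_fin -mulr_sumr -(bigA_distr_big_dep Q (fun _ _ => r))/=.
  apply: (@le_trans _ _ (C * \prod_i (l i + r))).
    apply: ler_wpM2l => //; apply: ler_prod => i _.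
    apply/andP; split; first by apply: sumr_ge0 => j _; exact: ltW.
    rewrite -(big_ord_widen K (fun=> r) (NK i)) sumr_const card_ord -[leLHS]mulr_natl.
    rewrite /N -natr1 mulrDl mul1r lerD2r -ler_pdivlMr// truncn_le.
    by rewrite divr_ge0// ltW.
  apply: (le_trans (ler_wpM2l C0 rl)); rewrite mulrDr lerD2l.
  rewrite mulrCA -[leRHS]mulr1 ler_wpM2l ?(ltW e0)//.
  by rewrite ler_pdivrMr// mul1r lerDl.
Unshelve. all: by end_near. Qed.

(* [G] parametrizes the jump times of the paths in [S] in a Lipschitz way, so a cover of [G @` S]
   by boxes gives a cover of the jump times by cubes, whose probabilities are bounded. *)
Lemma lipschitz_preimage_negligible :
  (forall e : R, 0 < e -> exists lo l : nat -> 'I_n -> R,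
    [/\ forall k i, 0 <= l k i,
        forall w, S w -> exists k, forall i, lo k i <= G w i <= lo k i + l k i &
        (\sum_(0 <= k <oo) (\prod_i l k i)%:E <= e%:E)%E]) ->
  P.-negligible S.
Proof.
move=> cover; apply: small_covers_negligible => e e0.
set C := (M * (3 * c)) ^+ n.
have C0 : 0 <= C by rewrite exprn_ge0// !mulr_ge0// ltW.
have C1 : 0 < C + 1 by rewrite ltr_wpDl.
have e2 : 0 < e / 2 by rewrite divr_gt0.
have [lo [l [l0 Sk sl]]] := cover _ (divr_gt0 e2 C1).
have /choice[N hN] := fun k => box_cover (lo k)
  (divr_gt0 e2 (exprn_gt0 k.+1 (ltr0n R 2))) (l0 k).
have mN k : measurable (N k) by case: (hN k).
exists (\bigcup_k N k); split; first exact: bigcupT_measurable.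
  move=> w Sw; have [k wk] := Sk _ Sw; exists k => //.
  by have [_ + _] := hN k; apply.
have mU : measurable (\bigcup_k N k) by exact: bigcupT_measurable.
have PU : (P (\bigcup_k N k) <= \sum_(0 <= k <oo) P (N k))%E.
  exact: measure_sigma_subadditive.
apply: (le_trans PU).
apply: (@le_trans _ _ (\sum_(0 <= k <oo)
    ((C * \prod_i l k i)%:E + (e / 2 / (2 ^ k.+1)%:R)%:E))%E).
  apply: lee_nneseries => // k _; have [_ _] := hN k.
  by rewrite EFinD natrX.
have p0 k : 0 <= \prod_i l k i by apply: prodr_ge0.
apply: (le_trans (epsilon_trick _ _ _)); [|exact: ltW|].
  by move=> k; rewrite lee_fin mulr_ge0.
under eq_eseriesr do rewrite EFinM.
rewrite nneseriesZl; last by move=> k _; rewrite lee_fin.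
rewrite [e in leRHS](splitr e) [leRHS]EFinD leeD//.
apply: (le_trans (lee_wpmul2l _ sl)); first by rewrite lee_fin.
rewrite -EFinM lee_fin mulrCA -[leRHS]mulr1 ler_wpM2l ?(ltW e2)//.
by rewrite ler_pdivrMr// mul1r lerDl.
Qed.

End lipschitz_preimage.

(** * First-order expansions *)

Section jacobian_increment.
Context {R : realType} {d : nat}.
Implicit Types (h : 'cV[R]_d -> 'cV[R]_d) (x y z v : 'cV[R]_d).

Lemma diff_jac h z v : differentiable h z -> 'd h z v = jac h z *m v.
Proof.
move=> dh; rewrite {1}(matrix_sum_delta v) linear_sum; apply/colP => i.
rewrite summxE mxE; apply: eq_bigr => j _.
by rewrite big_ord1 linearZ !mxE mulrC.
Qed.

Lemma is_derive_line h x v (s : R) i : differentiable h (x + s *: v) ->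
  is_derive s 1 (fun s => h (x + s *: v) i 0) ((jac h (x + s *: v) *m v) i 0).
Proof.
set z := x + s *: v => dh.
have dz : r^-1 *: ((h \o shift z) (r *: v) - h z) @[r --> 0^'] --> jac h z *m v.
  rewrite -diff_jac// -deriveE//; exact: (diff_derivable (v := v) dh).
have dzi : r^-1 *: (((fun s => h (x + s *: v) i 0) \o shift s) (r *: 1) -
    h (x + s *: v) i 0) @[r --> 0^'] --> (jac h z *m v) i 0.
  have E : (fun r : R => r^-1 *: (((fun s => h (x + s *: v) i 0) \o shift s) (r *: 1) -
      h (x + s *: v) i 0)) = (fun M : 'cV[R]_d => M i 0) \o
      (fun r : R => r^-1 *: ((h \o shift z) (r *: v) - h z)).
    apply/funext => r /=; rewrite !mxE; congr (_ * (h _ i 0 - _)).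
    by rewrite /z [r%:A]mulr1 scalerDl addrCA.
  rewrite E; exact: cvg_comp dz (@coord_continuous _ _ _ i 0 _).
split; first by apply/cvg_ex; eexists; exact: dzi.
exact: cvg_lim dzi.
Qed.

(** Mean value theorem for each coordinate of [h - J] along the segment from [x] to [y]; the
    intermediate point depends on the coordinate. Taking [J = 0] gives the Lipschitz bound. *)
Lemma jac_increment_le h (J : 'M[R]_d) x y (e : R) : 0 <= e ->
  (forall z, differentiable h z) ->
  (forall s, 0 <= s <= 1 -> `|jac h (x + s *: (y - x)) - J| <= e) ->
  `|h y - h x - J *m (y - x)| <= d%:R * e * `|y - x|.
Proof.
move=> e0 dh hJ; apply: mx_norm_le => [|i j]; first by rewrite !mulr_ge0.
rewrite (ord1 j) {j}; set v := y - x.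
pose f (s : R) := h (x + s *: v) i 0 - s * (J *m v) i 0.
have df (s : R) : is_derive s 1 f ((jac h (x + s *: v) *m v) i 0 - (J *m v) i 0).
  rewrite /f; apply: is_deriveB; first exact: is_derive_line.
  have := is_deriveM (is_derive_id s 1) (is_derive_cst ((J *m v) i 0) s 1).
  by rewrite scaler0 add0r /GRing.scale/= mulr1.
have cf : {within `[0, 1], continuous f}.
  apply: derivable_within_continuous => s _; exact: ex_derive.
have [c c01 fc] := MVT ltr01 (fun s _ => df s) cf.
have -> : (h y - h x - J *m v) i 0 = f 1 - f 0.
  rewrite /f scale1r scale0r addr0 mul0r subr0 mul1r /v [x + (y - x)]addrC subrK !mxE; ring.
rewrite fc subr0 mulr1; have -> : (jac h (x + c *: v) *m v) i 0 - (J *m v) i 0 =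
    ((jac h (x + c *: v) - J) *m v) i 0 by rewrite mulmxBl !mxE.
apply: le_trans (mx_norm_coord _ _ _) _; apply: le_trans (mx_norm_mulmx _ _) _.
apply: ler_wpM2r => //; apply: ler_wpM2l => //; apply: hJ.
by move: c01; rewrite in_itv/= => /andP[/ltW -> /ltW ->].
Qed.

Lemma near_jac h x (e : R) : 0 < e -> differentiable h x ->
  \forall v \near (0 : 'cV[R]_d), `|h (x + v) - h x - jac h x *m v| <= e * `|v|.
Proof.
move=> e0 dh; have /= dhx := diff_locallyxC dh.
have /eqaddoP/(_ _ e0) : (fun v => h (x + v)) =
    (fun v => h x + 'd h x v) +o_ (0 : 'cV[R]_d) id by exact/funext.
by apply: filterS => v; rewrite /= !fctE opprD addrA diff_jac.
Qed.

End jacobian_increment.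

(** * Landau symbols along sequences *)

Section asymptotics.
Context {R : realType} (delta : nat -> R).
Hypothesis delta0 : forall k, 0 <= delta k.

(** A single scale [delta] serves reals, vectors and matrices alike; in the end it is the total
    displacement of the jump times. *)
Definition smallo (V : normedZmodType R) (u : nat -> V) :=
  forall e : R, 0 < e -> \forall k \near \oo, `|u k| <= e * delta k.

Definition bigo (V : normedZmodType R) (u : nat -> V) :=
  exists C : R, \forall k \near \oo, `|u k| <= C * delta k.

Section normed.
Variable V : normedZmodType R.
Implicit Types u v : nat -> V.

Lemma eq_smallo u v : (\forall k \near \oo, u k = v k) -> smallo u -> smallo v.
Proof.
move=> uv su e e0; have := su _ e0; apply: filterS2 uv => k -> //.
Qed.

Lemma smallo0 : smallo (fun=> 0 : V).
Proof. by move=> e e0; apply: nearW => k; rewrite normr0 mulr_ge0// ltW. Qed.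

Lemma smalloD u v : smallo u -> smallo v -> smallo (fun k => u k + v k).
Proof.
move=> su sv e e0; have e2 : 0 < e / 2 by rewrite divr_gt0.
have := sv _ e2; apply: filterS2 (su _ e2) => k uk vk.
rewrite (le_trans (ler_normD _ _))// [e]splitr mulrDl; exact: lerD.
Qed.

Lemma smalloN u : smallo u -> smallo (fun k => - u k).
Proof. by move=> su e /su; apply: filterS => k; rewrite normrN. Qed.

Lemma smalloB u v : smallo u -> smallo v -> smallo (fun k => u k - v k).
Proof. by move=> su sv; apply: smalloD => //; exact: smalloN. Qed.

Lemma smallo_sum I (r : seq I) (p : pred I) (u : I -> nat -> V) :
  (forall i, smallo (u i)) -> smallo (fun k => \sum_(i <- r | p i) u i k).
Proof.
move=> su; elim: r => [|i r IH].
  by apply: eq_smallo smallo0; apply: nearW => k; rewrite big_nil.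
case pi : (p i).
  by apply: eq_smallo (smalloD (su i) IH); apply: nearW => k; rewrite big_cons pi.
by apply: eq_smallo IH; apply: nearW => k; rewrite big_cons pi.
Qed.

Lemma smallo_bigo u : smallo u -> bigo u.
Proof. by move=> su; exists 1; exact: su. Qed.

Lemma eq_bigo u v : (\forall k \near \oo, u k = v k) -> bigo u -> bigo v.
Proof. by move=> uv [C su]; exists C; apply: filterS2 su uv => k + <-. Qed.

Lemma bigoD u v : bigo u -> bigo v -> bigo (fun k => u k + v k).
Proof.
move=> [C uC] [E vE]; exists (C + E); apply: filterS2 uC vE => k uk vk.
by rewrite (le_trans (ler_normD _ _))// mulrDl lerD.
Qed.

Lemma bigoN u : bigo u -> bigo (fun k => - u k).
Proof. by move=> [C uC]; exists C; apply: filterS uC => k; rewrite normrN. Qed.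

Lemma bigoB u v : bigo u -> bigo v -> bigo (fun k => u k - v k).
Proof. by move=> su sv; apply: bigoD => //; exact: bigoN. Qed.

Lemma bigo_sum I (r : seq I) (p : pred I) (u : I -> nat -> V) :
  (forall i, bigo (u i)) -> bigo (fun k => \sum_(i <- r | p i) u i k).
Proof.
move=> su; elim: r => [|i r IH].
  apply: eq_bigo (smallo_bigo smallo0); apply: nearW => k; by rewrite big_nil.
case pi : (p i).
  by apply: eq_bigo (bigoD (su i) IH); apply: nearW => k; rewrite big_cons pi.
by apply: eq_bigo IH; apply: nearW => k; rewrite big_cons pi.
Qed.

Lemma bigo_pos u : bigo u -> exists2 C : R, 0 < C &
  \forall k \near \oo, `|u k| <= C * delta k.
Proof.
move=> [C uC]; exists (`|C| + 1); first by rewrite ltr_wpDl.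
apply: filterS uC => k /le_trans; apply; apply: ler_wpM2r => //.
by rewrite (le_trans (ler_norm _))// lerDl.
Qed.

Lemma smallo_dominated (W : normedZmodType R) (c : R) u (v : nat -> W) :
  (\forall k \near \oo, `|u k| <= c * `|v k|) -> smallo v -> smallo u.
Proof.
move=> uv sv e e0; have c0 : 0 < `|c| + 1 by rewrite ltr_wpDl.
have := sv _ (divr_gt0 e0 c0); apply: filterS2 uv => k uk vk.
apply: (le_trans uk); apply: (@le_trans _ _ ((`|c| + 1) * `|v k|)).
  by apply: ler_wpM2r => //; rewrite (le_trans (ler_norm _))// lerDl.
by rewrite mulrC -ler_pdivlMr// mulrAC.
Qed.

Hypothesis delta_cvg : delta k @[k --> \oo] --> 0.

Lemma bigo_cvg u : bigo u -> forall e : R, 0 < e -> \forall k \near \oo, `|u k| <= e.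
Proof.
move=> /bigo_pos[C C0 uC] e e0.
have /cvgrPdist_le/(_ _ (divr_gt0 e0 C0)) := delta_cvg.
apply: filterS2 uC => k uk; rewrite sub0r normrN ger0_norm// => de.
by rewrite (le_trans uk)// mulrC -ler_pdivlMr.
Qed.

End normed.

Lemma smallo_mulmx m n p (A : 'M[R]_(m, n)) (u : nat -> 'M[R]_(n, p)) :
  smallo u -> smallo (fun k => A *m u k).
Proof.
apply: (@smallo_dominated _ _ (n%:R * `|A|)); apply: nearW => k; exact: mx_norm_mulmx.
Qed.

Lemma bigo_mulmx m n p (A : 'M[R]_(m, n)) (u : nat -> 'M[R]_(n, p)) :
  bigo u -> bigo (fun k => A *m u k).
Proof.
move=> [C uC]; exists (n%:R * `|A| * C); apply: filterS uC => k uk.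
by rewrite (le_trans (mx_norm_mulmx _ _))// -[leRHS]mulrA ler_wpM2l// mulr_ge0.
Qed.

Lemma smallo_cvg_mulmx m n p (A : nat -> 'M[R]_(m, n)) (u : nat -> 'M[R]_(n, p)) :
  (forall e : R, 0 < e -> \forall k \near \oo, `|A k| <= e) -> bigo u ->
  smallo (fun k => A k *m u k).
Proof.
move=> A0 /bigo_pos[C C0 uC] e e0.
have n0 : 0 < (n%:R + 1) * C by rewrite mulr_gt0// ltr_wpDl.
apply: filterS2 (A0 _ (divr_gt0 e0 n0)) uC => k Ak uk.
rewrite (le_trans (mx_norm_mulmx _ _))//.
apply: (@le_trans _ _ ((n%:R + 1) * `|A k| * (C * delta k))).
  by apply: ler_pM => //; rewrite ?mulr_ge0// ler_wpM2r// lerDl.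
have -> : (n%:R + 1) * `|A k| * (C * delta k) =
  `|A k| * ((n%:R + 1) * C) * delta k by ring.
by rewrite ler_wpM2r// -ler_pdivlMr.
Qed.

Lemma bigo_scale (V : normedModType R) (t : nat -> R) (v : V) :
  bigo t -> bigo (fun k => t k *: v).
Proof.
move=> [C tC]; exists (C * `|v|); apply: filterS tC => k tk.
by rewrite normrZ mulrAC ler_wpM2r.
Qed.

End asymptotics.

(** * Integral inequalities and the Gronwall bound *)

Section scalar_integrals.
Context {R : realType}.
Notation mu := (@lebesgue_measure R).
Implicit Types (H : R -> R) (a b c e : R).

Lemma sub_integrable a b c e H : a <= c -> e <= b ->
  mu.-integrable `[a, b] (EFin \o H) -> mu.-integrable `[c, e] (EFin \o H).
Proof.
move=> ac eb; apply: integrableS; [exact: measurable_itv|exact: measurable_itv|].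
by apply: subset_itv; rewrite bnd_simp.
Qed.

Lemma Rintegral_sub_le a b c e H : a <= c -> e <= b ->
  mu.-integrable `[a, b] (EFin \o H) -> (forall s, a <= s <= b -> 0 <= H s) ->
  \int[mu]_(s in `[c, e]) H s <= \int[mu]_(s in `[a, b]) H s.
Proof.
move=> ac eb iH H0; apply: fine_le.
- exact: (integrable_fin_num (measurable_segment c e) (sub_integrable ac eb iH)).
- exact: (integrable_fin_num (measurable_segment a b) iH).
apply: ge0_subset_integral.
- exact: measurable_itv.
- exact: measurable_itv.
- exact: measurable_int iH.
- by move=> s /=; rewrite in_itv/= lee_fin => /H0.
- by apply: subset_itv; rewrite bnd_simp.
Qed.

Lemma continuous_integrable a b H : {within `[a, b], continuous H} ->
  mu.-integrable `[a, b] (EFin \o H).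
Proof. by move=> cH; apply: continuous_compact_integrable => //; exact: segment_compact. Qed.

Lemma integrable_cst a b (x : R) : mu.-integrable `[a, b] (EFin \o cst x).
Proof. by apply: continuous_integrable => s; exact: cst_continuous. Qed.

Lemma Rintegral_cst_segment a b (x : R) : a <= b ->
  \int[mu]_(s in `[a, b]) x = (b - a) * x.
Proof.
move=> ab; have mI : fine (mu `[a, b]) = b - a.
  rewrite lebesgue_measure_itv/= lte_fin; move: ab; rewrite le_eqVlt => /predU1P[->|->].
    by rewrite ltxx subrr.
  by [].
by rewrite -mI mulrC; exact: Rintegral_cst (measurable_segment a b) x.
Qed.

(** The gain [1 / c] makes integration a contraction in the sup norm weighted by this exponential,
    for [c] large. *)
Lemma integral_expR_le a b c : 0 < c -> a <= b ->
  \int[mu]_(s in `[a, b]) expR (c * (s - a)) <= expR (c * (b - a)) / c.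
Proof.
move=> c0; rewrite le_eqVlt => /predU1P[<-|ab].
  by rewrite set_itv1 Rintegral_set1 divr_ge0 ?expR_ge0// ltW.
pose F (s : R) := c^-1 * expR (c * (s - a)).
have dF (s : R) : is_derive s 1 F (expR (c * (s - a))).
  have d1 : is_derive s 1 (fun s => c * (s - a)) c.
    have := is_deriveZ c (is_deriveB (is_derive_id s 1) (is_derive_cst a s 1)).
    by rewrite subr0 /GRing.scale/= mulr1.
  have d2 : is_derive s 1 (expR \o (fun s => c * (s - a))) (c * expR (c * (s - a))).
    by rewrite mulrC; apply: is_derive1_comp.
  have := is_deriveZ c^-1 d2.
  by rewrite /GRing.scale/= mulKf// gt_eqF.
have cF (s : R) : {for s, continuous F}.
  by apply: differentiable_continuous; apply/derivable1_diffP; exact: ex_derive.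
rewrite /Rintegral (@continuous_FTC2 _ _ F)//.
- rewrite -EFinB/= /F subrr mulr0 expR0 mulr1 [leRHS]mulrC lerBlDl lerDr.
  by rewrite invr_ge0 ltW.
- apply: continuous_subspaceT => s.
  apply: (@continuous_comp _ _ _ (fun s => c * (s - a)) expR); last exact: continuous_expR.
  apply: continuousM; first exact: cst_continuous.
  by apply: continuousB; [exact: cvg_id|exact: cst_continuous].
- split; first by move=> s _; exact: ex_derive.
    by apply: cvg_at_right_filter; exact: cF.
  by apply: cvg_at_left_filter; exact: cF.
- by move=> s _; rewrite derive1E; exact: derive_val.
Qed.

End scalar_integrals.

Section norm1.
Context {R : realType} {m n : nat}.
Notation mu := (@lebesgue_measure R).
Implicit Types (A : 'M[R]_(m, n)) (F : R -> 'M[R]_(m, n)).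

(** A majorant of the matrix norm whose integrability follows at once from that of the entries. *)
Definition norm1 A : R := \sum_(ij : 'I_m * 'I_n) `|A ij.1 ij.2|.

Lemma norm1_ge0 A : 0 <= norm1 A.
Proof. exact: sumr_ge0. Qed.

Lemma le_norm1 A : `|A| <= norm1 A.
Proof.
apply: mx_norm_le => [|i j]; first exact: norm1_ge0.
by rewrite /norm1 (bigD1 (i, j))//= lerDl sumr_ge0.
Qed.

Lemma norm1_le A : norm1 A <= (m * n)%:R * `|A|.
Proof.
apply: (@le_trans _ _ (\sum_(ij : 'I_m * 'I_n) `|A|)).
  by apply: ler_sum => ij _; exact: mx_norm_coord.
by rewrite sumr_const card_prod !card_ord -[leLHS]mulr_natl.
Qed.

Lemma integrable_norm1 a b F : mx_integrable `[a, b] F ->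
  mu.-integrable `[a, b] (EFin \o (norm1 \o F)).
Proof.
move=> iF; have := @integrable_sum _ _ _ mu _ (measurable_segment a b) _
  (index_enum ('I_m * 'I_n)%type) xpredT _
  (fun ij _ => integrable_norm (iF ij.1 ij.2)).
by apply: eq_integrable => // s _ /=; rewrite -sumEFin.
Qed.

Lemma mx_integrable_bounded a b F (B : R) :
  (forall i j, @measurable_fun _ _ (measurableTypeR R) (measurableTypeR R) `[a, b]
     (fun v => F v i j)) ->
  (forall v, a <= v <= b -> `|F v| <= B) -> mx_integrable `[a, b] F.
Proof.
move=> mF FB i j; apply: (@le_integrable _ _ _ mu _ (measurable_segment a b) _
  (EFin \o cst B)).
- by apply/measurable_EFinP; exact: mF.
- move=> v /=; rewrite in_itv/= => vab; rewrite lee_fin.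
  by rewrite (le_trans _ (ler_norm _))// (le_trans (mx_norm_coord _ _ _))// FB.
- exact: integrable_cst.
Qed.

End norm1.

Section gronwall.
Context {R : realType}.
Notation mu := (@lebesgue_measure R).

(* Fixed-point iteration in the weighted sup norm: the bound [2A + B/2^k] on
   the weighted norm improves to [2A + B/2^(k+1)]. *)
Lemma weighted_iteration (phi : R -> R) (p q A B c : R) :
  0 <= A -> 0 <= B -> 0 <= c -> (forall u, p <= u <= q -> phi u <= B) ->
  (forall M, 0 <= M ->
    (forall v, p <= v <= q -> phi v <= M * expR (c * (v - p))) ->
    forall u, p <= u <= q -> phi u <= A + M / 2 * expR (c * (u - p))) ->
  forall u, p <= u <= q -> phi u <= 2 * A * expR (c * (u - p)).
Proof.
move=> A0 B0 c0 phiB step.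
have e1 u : p <= u <= q -> 1 <= expR (c * (u - p)).
  by move=> /andP[pu _]; rewrite -expR0 ler_expR mulr_ge0// subr_ge0.
have it k : forall u, p <= u <= q ->
    phi u <= (2 * A + B / 2 ^+ k) * expR (c * (u - p)).
  elim: k => [|k IH] u upq.
    rewrite expr0 divr1; apply: (le_trans (phiB _ upq)).
    rewrite -[leLHS]mulr1 ler_pM// ?e1// lerDr mulr_ge0//.
  have M0 : 0 <= 2 * A + B / 2 ^+ k by rewrite addr_ge0// ?mulr_ge0// invr_ge0 exprn_ge0.
  apply: (le_trans (step _ M0 IH _ upq)).
  have -> : (2 * A + B / 2 ^+ k) / 2 = A + B / 2 ^+ k.+1.
    by rewrite exprS invfM; field; rewrite expf_neq0.
  rewrite mulrDl [leRHS]mulrDl addrA lerD2r.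
  by rewrite [2 * A]mulr_natl mulr2n mulrDl lerD2r ler_peMr// e1.
move=> u upq; apply/ler_addgt0Pr => e e0.
set E := expR (c * (u - p)).
have E0 : 0 < E by exact: expR_gt0.
have BE0 : 0 <= B * E by rewrite mulr_ge0// ltW.
have [k ke] : exists k : nat, B * E / e < 2 ^+ k.
  exists (Num.bound (B * E / e)).
  apply: lt_trans (archi_boundP _) _; first by rewrite divr_ge0// ltW.
  by rewrite -natrX ltr_nat ltn_expl.
apply: (le_trans (it k u upq)); rewrite mulrDl lerD2l -/E mulrAC.
move: ke; rewrite ltr_pdivrMr// [_ * e]mulrC => /ltW.
by rewrite ler_pdivrMr// exprn_gt0.
Qed.

Variables (m n : nat) (y F : R -> 'M[R]_(m, n)) (p q L : R) (rho : R -> R).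
Hypotheses (pq : p <= q) (L0 : 0 <= L) (iF : mx_integrable `[p, q] F).
Hypothesis yF : forall u, p <= u <= q -> y u = y p + mx_integral `[p, u] F.
Hypothesis irho : mu.-integrable `[p, q] (EFin \o rho).
Hypothesis rho0 : forall v, p <= v <= q -> 0 <= rho v.
Hypothesis Fle : forall v, p <= v <= q -> `|F v| <= L * `|y v| + rho v.

(** With the exponent [c = 2 * (L + 1)], integrating [L * M * expR (c * (v - p))] gives at most half
    of [M * expR (c * (u - p))], which is the halving that [weighted_iteration] asks for. The
    iteration starts from the a priori bound by the integral of [norm1 (F v)]. *)
Lemma gronwall u : p <= u <= q ->
  `|y u| <= 2 * (`|y p| + \int[mu]_(v in `[p, q]) rho v) *
            expR (2 * (L + 1) * (u - p)).
Proof.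
have L1 : 0 < L + 1 by rewrite ltr_wpDl.
have iH := integrable_norm1 iF.
have irho0 : 0 <= \int[mu]_(v in `[p, q]) rho v.
  by apply: Rintegral_ge0 => v /=; rewrite in_itv/=; exact: rho0.
apply: (@weighted_iteration (fun u => `|y u|) p q _ (`|y p| + \int[mu]_(v in `[p, q]) norm1 (F v))).
- by rewrite addr_ge0.
- by rewrite addr_ge0// Rintegral_ge0// => v _; exact: norm1_ge0.
- by rewrite mulr_ge0// ltW.
- move=> {}u /[dup] upq /andP[pu uq]; rewrite yF// (le_trans (ler_normD _ _))// lerD2l.
  apply: (@le_trans _ _ (\int[mu]_(v in `[p, u]) norm1 (F v))).
    apply: norm_mx_integral_le; first exact: sub_mx_integrable iF.
      exact: sub_integrable iH.
    by move=> v _; exact: le_norm1.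
  by apply: Rintegral_sub_le => // v _; exact: norm1_ge0.
move=> M M0 yM {}u /[dup] upq /andP[pu uq].
rewrite yF// -addrA (le_trans (ler_normD _ _))// lerD2l.
set c := 2 * (L + 1) in yM *.
have c0 : 0 < c by rewrite mulr_gt0.
have iE : mu.-integrable `[p, u] (EFin \o (fun v => expR (c * (v - p)))).
  apply: continuous_integrable; apply: continuous_subspaceT => s.
  apply: (@continuous_comp _ _ _ (fun s => c * (s - p)) expR); last exact: continuous_expR.
  apply: continuousM; first exact: cst_continuous.
  by apply: continuousB; [exact: cvg_id|exact: cst_continuous].
have iE' : mu.-integrable `[p, u] (EFin \o (fun v => L * M * expR (c * (v - p)))).
  have := integrableZl (measurable_segment p u) (L * M) iE.
  by apply: eq_integrable => // s _ /=; rewrite EFinM.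
have irhou := sub_integrable (lexx p) uq irho.
apply: (@le_trans _ _ (\int[mu]_(v in `[p, u]) (rho v + L * M * expR (c * (v - p))))).
  apply: norm_mx_integral_le; first exact: sub_mx_integrable iF.
    have := integrableD (measurable_segment p u) irhou iE'.
    by apply: eq_integrable => // s _ /=; rewrite EFinD.
  move=> v /andP[pv vu]; have vpq : p <= v <= q by rewrite pv (le_trans vu).
  rewrite (le_trans (Fle vpq))// addrC lerD2l -mulrA ler_wpM2l//.
  exact: yM.
rewrite (RintegralD (measurable_segment p u) irhou iE') lerD//.
  exact: Rintegral_sub_le.
rewrite (RintegralZl (L * M) (measurable_segment p u) iE).
apply: (@le_trans _ _ (L * M * (expR (c * (u - p)) / c))).
  by rewrite ler_wpM2l ?mulr_ge0//; exact: integral_expR_le.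
rewrite mulrCA mulrC ler_wpM2r ?expR_ge0// ler_pdivrMr//.
rewrite /c -mulrA mulKf// mulrC ler_wpM2l// lerDl//.
Qed.

End gronwall.

Section continuous_paths.
Context {R : realType}.

Lemma measurable_path_generated (V : pointedType) (O : set (set V)) (a b : R)
    (c : R -> V) : (forall U, O U -> open (c @^-1` U : set (subspace `[a, b]))) ->
  @measurable_fun _ _ (measurableTypeR R) (g_sigma_algebraType O) `[a, b] c.
Proof.
move=> cO.
apply: (@measurability _ _ (measurableTypeR R) (g_sigma_algebraType O) `[a, b] c O) => //.
move=> _ [U OU <-]; apply: open_measurable_subspace; first exact: measurable_itv.
exact: cO.
Qed.

Lemma borel_continuous_measurable (V : ptopologicalType) (h : V -> R) (D : set V) :
  continuous h -> @measurable _ (borel V) D ->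
  @measurable_fun _ _ (borel V) (measurableTypeR R) D h.
Proof.
move=> ch mD; apply: (measurability (@RGenOInfty.G R) (RGenOInfty.measurableE R)).
move=> _ [_ [x ->] <-]; apply: measurableI => //; apply: sub_sigma_algebra.
by apply: open_comp; [move=> y _; exact: ch|exact: interval_open].
Qed.

Lemma within_continuous_pair (V W : topologicalType) (D : set R)
    (c : R -> V) (e : R -> W) : {within D, continuous c} -> {within D, continuous e} ->
  {within D, continuous (fun v => (c v, e v))}.
Proof. by move=> cc ce s; apply: cvg_pair; [exact: cc|exact: ce]. Qed.

Lemma within_continuous_id (D : set R) : {within D, continuous (fun v : R => v)}.
Proof. by apply: continuous_subspaceT => s; exact: cvg_id. Qed.

Lemma eq_within_continuous (V : topologicalType) (D : set R) (c e : R -> V) :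
  (forall v, D v -> c v = e v) -> {within D, continuous c} -> {within D, continuous e}.
Proof. by move=> ce; apply: subspace_eq_continuous => v /set_mem /ce. Qed.

End continuous_paths.

(** * Flow of the drift between two jumps *)

Section primitive.
Context {R : realType} {m n : nat}.
Implicit Types (y F : R -> 'M[R]_(m, n)) (a b c e u : R).

(** Absolute continuity with density [F], in integral form: a drift that is merely measurable in
    time gives no derivative at every point. *)
Definition primitive a b y F : Prop := mx_integrable `[a, b] F /\
  forall u, a <= u <= b -> y u = y a + mx_integral `[a, u] F.

Lemma primitive_integral a b c u y F : a <= c -> c <= u -> u <= b ->
  primitive a b y F -> y u = y c + mx_integral `[c, u] F.
Proof.
move=> ac cu ub [iF yE].
rewrite (yE u) ?(le_trans ac)//= (yE c) ?ac ?(le_trans cu)//.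
rewrite -addrA -mx_integral_split//.
exact: sub_mx_integrable iF.
Qed.

Lemma sub_primitive a b c e y F : a <= c -> e <= b ->
  primitive a b y F -> primitive c e y F.
Proof.
move=> ac eb yF; split; first by case: yF => iF _; exact: sub_mx_integrable iF.
move=> u /andP[cu ue]; apply: primitive_integral yF => //; exact: le_trans eb.
Qed.

Lemma primitive_continuous a b y F : a <= b -> primitive a b y F ->
  {within `[a, b], continuous y}.
Proof.
move=> ab [iF yE].
apply: (@eq_within_continuous _ _ _ (fun u => y a + mx_integral `[a, u] F)).
  by move=> u /=; rewrite in_itv/= => /yE ->.
move=> s; apply: cvgD; first exact: cvg_cst.
exact: mx_integral_continuous.
Qed.

Lemma primitive_cvg a b y F (u : R) (c : nat -> R) : primitive a b y F ->
  a <= u <= b -> (\forall k \near \oo, a <= c k <= b) ->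
  c k @[k --> \oo] --> u -> y (c k) @[k --> \oo] --> y u.
Proof.
move=> yF uab cab cu; have ab : a <= b by case/andP: uab => /le_trans; apply.
have /subspace_continuousP/(_ u) := primitive_continuous ab yF.
rewrite /= in_itv/= => /(_ uab); apply: cvg_comp.
move=> A; rewrite /within/= => uA; have := cu _ uA.
apply: filterS2 cab => k ckab; apply.
by rewrite /= in_itv.
Qed.

End primitive.

Section flow.
Context {R : realType} {d : nat}.
Notation mu := (@lebesgue_measure R).
Variables (T C : R) (f : R -> 'cV[R]_d -> 'cV[R]_d).
Implicit Types (z : R -> 'cV[R]_d) (a b p q u v : R) (x : 'cV[R]_d).

Hypothesis C0 : 0 <= C.
Hypothesis f_meas : @measurable_fun _ _ (borel (R * 'cV[R]_d)%type)
  (borel 'cV[R]_d) (`[0, T] `*` setT) (fun tx => f tx.1 tx.2).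
Hypothesis f_diff : forall v x, 0 <= v <= T -> differentiable (f v) x.
Hypothesis f_jac : forall v x, 0 <= v <= T -> `|jac (f v) x| <= C.
Hypothesis f_int : forall x, mx_integrable `[0, T] (fun v => f v x).

(** [L] is a Lipschitz constant of the drift in space, and [E] the resulting Gronwall factor over
    the whole horizon. *)
Let L := d%:R * C.
Let E := expR (2 * (L + 1) * T).

Let L0 : 0 <= L. Proof. by rewrite mulr_ge0. Qed.
Let L1 : 0 < L + 1. Proof. by rewrite ltr_wpDl. Qed.
Let E0 : 0 < E. Proof. exact: expR_gt0. Qed.

Lemma drift_jac_mulmx v x m (W : 'M[R]_(d, m)) : 0 <= v <= T ->
  `|jac (f v) x *m W| <= L * `|W|.
Proof.
move=> vT; rewrite (le_trans (mx_norm_mulmx _ _))// ler_wpM2r// ler_wpM2l//.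
exact: f_jac.
Qed.

Lemma drift_lipschitz v x y : 0 <= v <= T -> `|f v y - f v x| <= L * `|y - x|.
Proof.
move=> vT; have := @jac_increment_le _ _ (f v) 0 x y C C0.
rewrite mul0mx subr0; apply; first by move=> z; exact: f_diff.
by move=> s _; rewrite subr0; exact: f_jac.
Qed.

Lemma measurable_drift a b (c : R -> 'cV[R]_d) i : 0 <= a -> b <= T ->
  {within `[a, b], continuous c} ->
  @measurable_fun _ _ (measurableTypeR R) (measurableTypeR R) `[a, b]
    (fun v => f v (c v) i 0).
Proof.
move=> a0 bT cc.
have m1 : @measurable_fun _ _ (measurableTypeR R) (borel (R * 'cV[R]_d)%type)
    `[a, b] (fun v => (v, c v)).
  apply: measurable_path_generated; apply/continuousP.
  by apply: within_continuous_pair cc; exact: within_continuous_id.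
have cD : @measurable _ (borel (R * 'cV[R]_d)%type) (`[0, T] `*` setT).
  rewrite -[_ `*` _]setCK; apply: measurableC; apply: sub_sigma_algebra.
  apply: closed_openC.
  rewrite (_ : _ `*` _ = fst @^-1` `[0, T]); last first.
    by apply/seteqP; split => -[s x]//= [].
  by apply: closed_comp; [move=> s _; exact: cvg_fst|exact: itv_closed].
have m2 : @measurable_fun _ _ (borel 'cV[R]_d) (measurableTypeR R) setT
    (fun x => x i 0).
  apply: borel_continuous_measurable; first exact: coord_continuous.
  exact: measurableT.
have m3 := measurableT_comp m2 f_meas.
apply: (measurable_comp cD _ m3 m1).
move=> _ [v /= + <-]; rewrite in_itv/= => /andP[av vb]; split => //=.
by rewrite in_itv/= (le_trans a0)// (le_trans vb).
Qed.

(** Each entry is the limit of difference quotients of the drift along [z] and along its translates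
    by [k.+1%:R^-1 *: e], which are continuous paths as well. *)
Lemma measurable_jac_drift a b z i j : 0 <= a -> b <= T ->
  {within `[a, b], continuous z} ->
  @measurable_fun _ _ (measurableTypeR R) (measurableTypeR R) `[a, b]
    (fun v => jac (f v) (z v) i j).
Proof.
move=> a0 bT cz.
pose e : 'cV[R]_d := delta_mx j 0.
pose h (k : nat) v := k.+1%:R * (f v (z v + k.+1%:R^-1 *: e) i 0 - f v (z v) i 0).
apply: (@measurable_fun_cvg _ (measurableTypeR R) _ _ h) => [k|v].
  apply: measurable_funM; first exact: measurable_cst.
  apply: measurable_funB; last exact: measurable_drift.
  apply: measurable_drift => // s; apply: cvgD; first exact: cz.
  exact: cvg_cst.
rewrite /= in_itv/= => /andP[av vb].
have vT : 0 <= v <= T by rewrite (le_trans a0 av) (le_trans vb).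
apply/cvgrPdist_le => eps eps0.
have eps1 : 0 < eps / (`|e| + 1) by rewrite divr_gt0// ltr_wpDl.
have := near_jac eps1 (f_diff (z v) vT).
move=> /nbhs_norm0P[r r0 hr].
have ke : \forall k \near \oo, k.+1%:R^-1 * `|e| < r :> R.
  have : (k.+1%:R^-1 * `|e| : R) @[k --> \oo] --> 0 * `|e|.
    apply: cvgMl; exact: cvg_harmonic.
  rewrite mul0r => /cvgrPdist_lt/(_ _ r0); apply: filterS => k.
  rewrite sub0r normrN; exact: le_lt_trans (ler_norm _).
apply: filterS ke => k ke; rewrite /h.
have k0 : 0 < k.+1%:R^-1 :> R by rewrite invr_gt0.
have ne : `|k.+1%:R^-1 *: e| = k.+1%:R^-1 * `|e| by rewrite normrZ gtr0_norm.
have := hr (k.+1%:R^-1 *: e); rewrite /= ne => /(_ ke) hk.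
have je : (jac (f v) (z v) *m (k.+1%:R^-1 *: e)) i 0 = k.+1%:R^-1 * jac (f v) (z v) i j.
  rewrite -scalemxAr mxE; congr (_ * _); rewrite mxE (bigD1 j)//= big1 ?addr0.
    by rewrite [e j 0]mxE !eqxx mulr1.
  by move=> k' /negPf k'j; rewrite [e k' 0]mxE k'j mulr0.
rewrite distrC.
have -> : k.+1%:R * (f v (z v + k.+1%:R^-1 *: e) i 0 - f v (z v) i 0) -
    jac (f v) (z v) i j =
    k.+1%:R * ((f v (z v + k.+1%:R^-1 *: e) - f v (z v) -
      jac (f v) (z v) *m (k.+1%:R^-1 *: e)) i 0).
  rewrite [X in _ = _ * X]mxE [X in _ = _ * (X + _)]mxE [X in _ = _ * (_ + X)]mxE je.
  by rewrite [(- f v (z v)) i 0]mxE [RHS]mulrBr mulVKf.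
rewrite normrM ger0_norm//.
apply: (@le_trans _ _ (k.+1%:R * (eps / (`|e| + 1) * (k.+1%:R^-1 * `|e|)))).
  by rewrite ler_wpM2l//; exact: le_trans (mx_norm_coord _ _ _) hk.
have e1 : 0 < `|e| + 1 by rewrite ltr_wpDl.
have -> : k.+1%:R * (eps / (`|e| + 1) * (k.+1%:R^-1 * `|e|)) = eps * (`|e| / (`|e| + 1)).
  by rewrite mulrCA [X in _ * X = _]mulVKf// mulrAC mulrA.
by rewrite -[leRHS]mulr1 ler_wpM2l ?(ltW eps0)// ler_pdivrMr// mul1r lerDl.
Qed.

Definition flow a b z : Prop := primitive a b z (fun v => f v (z v)).

Definition tangent a b z m (kap : R -> 'M[R]_(d, m)) : Prop :=
  primitive a b kap (fun v => jac (f v) (z v) *m kap v).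

Lemma expR_le_E p u : 0 <= p -> p <= u <= T -> expR (2 * (L + 1) * (u - p)) <= E.
Proof.
move=> p0 /andP[pu uT]; rewrite ler_expR ler_wpM2l//; first by rewrite mulr_ge0// ltW.
by rewrite (le_trans _ uT)// gerBl.
Qed.

Lemma flow_distance p q z z' u : 0 <= p -> q <= T -> p <= u <= q ->
  flow p q z -> flow p q z' -> `|z' u - z u| <= 2 * E * `|z' p - z p|.
Proof.
move=> p0 qT /[dup] upq /andP[pu uq] [iz zE] [iz' zE'].
have pq := le_trans pu uq.
have yF w : p <= w <= q -> z' w - z w =
    z' p - z p + mx_integral `[p, w] (fun v => f v (z' v) - f v (z v)).
  move=> /[dup] wpq /andP[pw wq]; rewrite mx_integralB.
  - by rewrite (zE _ wpq) (zE' _ wpq) opprD addrACA.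
  - exact: sub_mx_integrable iz'.
  - exact: sub_mx_integrable iz.
have Fle v : p <= v <= q -> `|f v (z' v) - f v (z v)| <= L * `|z' v - z v| + cst 0 v.
  move=> /andP[pv vq]; rewrite /= addr0; apply: drift_lipschitz.
  by rewrite (le_trans p0 pv) (le_trans vq).
have := gronwall L0 (mx_integrableB iz' iz) yF (integrable_cst p q 0)
  (fun v _ => lexx 0) Fle upq.
move=> /le_trans; apply; rewrite Rintegral_cst_segment// mulr0 addr0 mulrAC.
rewrite ler_wpM2r// ler_wpM2l//; apply: expR_le_E => //.
by rewrite pu (le_trans uq).
Qed.

(** At a Lebesgue point [t] of [f^~ x] this is negligible against the length of a small interval
    around [t]. *)
Definition osc x t a b : R :=
  \int[mu]_(v in `[a, b]) norm1 (f v x - f t x).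

Lemma drift_diff_integrable x t a b : 0 <= a -> b <= T ->
  mx_integrable `[a, b] (fun v => f v x - f t x).
Proof.
move=> a0 bT; apply: mx_integrableB; first exact: sub_mx_integrable (f_int x).
by move=> i j; exact: integrable_cst.
Qed.

Lemma mx_integral_cst a b (w : 'cV[R]_d) : a <= b ->
  mx_integral `[a, b] (cst w) = (b - a) *: w.
Proof.
by move=> ab; apply/matrixP => i j; rewrite !mxE Rintegral_cst_segment.
Qed.

Lemma flow_short a b z t x : 0 <= a -> a <= b -> b <= T -> flow a b z ->
  `|mx_integral `[a, b] (fun v => f v (z v)) - (b - a) *: f t x| <=
  osc x t a b +
  L * (b - a) * (2 * (`|z a - x| + (osc x t a b + (b - a) * `|f t x|)) * E).
Proof.
move=> a0 ab bT zf; have [iz zE] := zf.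
set w := f t x; set Q := osc x t a b.
have iD := drift_diff_integrable x t a0 bT.
have iN := integrable_norm1 iD.
have bd v : a <= v <= b -> 0 <= v <= T.
  by move=> /andP[av vb]; rewrite (le_trans a0 av) (le_trans vb).
have irho : mu.-integrable `[a, b] (EFin \o (fun v => norm1 (f v x - w) + `|w|)).
  have := integrableD (measurable_segment a b) iN (integrable_cst a b `|w|).
  by apply: eq_integrable => // v _ /=; rewrite EFinD.
have yF u : a <= u <= b -> z u - x = z a - x + mx_integral `[a, u] (fun v => f v (z v)).
  by move=> /zE ->; rewrite addrAC.
have Fle v : a <= v <= b -> `|f v (z v)| <= L * `|z v - x| + (norm1 (f v x - w) + `|w|).
  move=> vab; have -> : f v (z v) = (f v (z v) - f v x) + ((f v x - w) + w).
    by rewrite !subrK.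
  rewrite (le_trans (ler_normD _ _))// lerD//; first exact/drift_lipschitz/bd.
  by rewrite (le_trans (ler_normD _ _))// lerD2r le_norm1.
have irhoE : \int[mu]_(v in `[a, b]) (norm1 (f v x - w) + `|w|) = Q + (b - a) * `|w|.
  rewrite (RintegralD (measurable_segment a b) iN (integrable_cst a b `|w|)); congr (_ + _).
  exact: Rintegral_cst_segment.
have zx u : a <= u <= b ->
    `|z u - x| <= 2 * (`|z a - x| + (Q + (b - a) * `|w|)) * E.
  move=> uab; have := gronwall L0 iz yF irho
    (fun v _ => addr_ge0 (norm1_ge0 _) (normr_ge0 w)) Fle uab.
  rewrite irhoE => /le_trans; apply; rewrite ler_wpM2l//.
    rewrite mulr_ge0// addr_ge0// addr_ge0// ?mulr_ge0 ?subr_ge0//.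
    by apply: Rintegral_ge0 => v _; exact: norm1_ge0.
  apply: expR_le_E => //; case/andP: uab => -> /= ub; exact: le_trans ub bT.
set B := 2 * _ * E in zx *.
have icst : mx_integrable `[a, b] (cst w) by move=> i j; exact: integrable_cst.
rewrite -mx_integral_cst// -mx_integralB//.
have irho2 : mu.-integrable `[a, b] (EFin \o (fun v => norm1 (f v x - w) + L * B)).
  have := integrableD (measurable_segment a b) iN (integrable_cst a b (L * B)).
  by apply: eq_integrable => // v _ /=; rewrite EFinD.
apply: (@le_trans _ _ (\int[mu]_(v in `[a, b]) (norm1 (f v x - w) + L * B))).
  apply: norm_mx_integral_le => //; first exact: mx_integrableB.
  move=> v vab; have -> : f v (z v) - cst w v = (f v x - w) + (f v (z v) - f v x).
    by rewrite /cst; mx_ring.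
  rewrite (le_trans (ler_normD _ _))// lerD ?le_norm1//.
  apply: (le_trans (drift_lipschitz _ _ (bd _ vab))).
  by rewrite ler_wpM2l// zx.
rewrite (RintegralD (measurable_segment a b) iN (integrable_cst a b (L * B))) lerD2l.
by rewrite Rintegral_cst_segment// mulrCA mulrA.
Qed.

Definition remainder z z' v : 'cV[R]_d :=
  f v (z' v) - f v (z v) - jac (f v) (z v) *m (z' v - z v).

Lemma remainder_le z z' v : 0 <= v <= T ->
  `|remainder z z' v| <= 2 * L * `|z' v - z v|.
Proof.
move=> vT; rewrite (le_trans (ler_normB _ _))// -mulrA mulr_natl mulr2n.
by rewrite lerD//; [exact: drift_lipschitz|exact: drift_jac_mulmx].
Qed.

Lemma remainder_integrable p q z z' : 0 <= p -> p <= q -> q <= T ->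
  flow p q z -> flow p q z' -> mx_integrable `[p, q] (remainder z z').
Proof.
move=> p0 pq qT zf zf'; apply: mx_integrableB.
  by apply: mx_integrableB; [case: zf'|case: zf].
have cz := primitive_continuous pq zf; have cz' := primitive_continuous pq zf'.
apply: (@mx_integrable_bounded _ _ _ _ _ _ (L * (2 * E * `|z' p - z p|))).
  move=> i j.
  rewrite (_ : (fun v => _) = (fun v => \sum_k (jac (f v) (z v) i k * (z' v - z v) k j))).
    apply: measurable_sum => k; apply: measurable_funM.
      exact: measurable_jac_drift.
    have czz : {within `[p, q], continuous (fun v => z' v - z v)}.
      by move=> s; apply: cvgB; [exact: cz'|exact: cz].
    have ck : {within `[p, q], continuous (fun v => (z' v - z v) k j)}.
      by move=> s; exact: (cvg_comp _ _ (czz s) (@coord_continuous _ _ _ k j _)).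
    exact: subspace_continuous_measurable_fun (measurable_itv _) ck.
  by apply/funext => v; rewrite mxE.
move=> v /[dup] vpq /andP[pv vq].
apply: (le_trans (drift_jac_mulmx _ _ _)); first by rewrite (le_trans p0 pv) (le_trans vq).
by rewrite ler_wpM2l//; exact: flow_distance vpq zf zf'.
Qed.

(** The difference [z' - z - kap *m v0] solves the linearized equation with source term
    [remainder z z'], so Gronwall applies to it. *)
Lemma flow_tangent p q z z' m (kap : R -> 'M[R]_(d, m)) (v0 : 'M[R]_(m, 1)) :
  0 <= p -> p <= q -> q <= T -> flow p q z -> flow p q z' -> tangent p q z kap ->
  `|z' q - z q - kap q *m v0| <= 2 * E *
    (`|z' p - z p - kap p *m v0| + \int[mu]_(v in `[p, q]) norm1 (remainder z z' v)).
Proof.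
move=> p0 pq qT zf zf' [ik kE]; have [iz zE] := zf; have [iz' zE'] := zf'.
have ikv := mx_integrable_mulmxr v0 ik.
pose F v := f v (z' v) - f v (z v) - jac (f v) (z v) *m kap v *m v0.
have iF : mx_integrable `[p, q] F by apply: mx_integrableB => //; exact: mx_integrableB.
pose y v := z' v - z v - kap v *m v0.
have yF u : p <= u <= q -> y u = y p + mx_integral `[p, u] F.
  move=> /[dup] upq /andP[pu uq].
  have izu := sub_mx_integrable (lexx p) uq iz.
  have izu' := sub_mx_integrable (lexx p) uq iz'.
  have iku := sub_mx_integrable (lexx p) uq ik.
  rewrite mx_integralB; last 2 first.
  - exact: mx_integrableB.
  - exact: mx_integrable_mulmxr.
  rewrite mx_integralB// mx_integral_mulmxr// /y (zE _ upq) (zE' _ upq) (kE _ upq).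
  by rewrite mulmxDl; mx_ring.
have irem := integrable_norm1 (remainder_integrable p0 pq qT zf zf').
have Fle v : p <= v <= q -> `|F v| <= L * `|y v| + norm1 (remainder z z' v).
  move=> /andP[pv vq].
  have -> : F v = jac (f v) (z v) *m y v + remainder z z' v.
    by rewrite /F /remainder /y mulmxBr mulmxA; mx_ring.
  rewrite (le_trans (ler_normD _ _))// lerD ?le_norm1// drift_jac_mulmx//.
  by rewrite (le_trans p0 pv) (le_trans vq).
have qpq : p <= q <= q by rewrite pq lexx.
have := gronwall L0 iF yF irem (fun v _ => norm1_ge0 _) Fle qpq.
move=> /le_trans; apply; rewrite -/(y p) [2 * E * _]mulrAC ler_wpM2l//.
  by rewrite mulr_ge0// addr_ge0// Rintegral_ge0// => v _; exact: norm1_ge0.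
by apply: expR_le_E => //; rewrite pq.
Qed.

(** Differentiability of the drift in space has no modulus uniform in time, so the estimate is a
    dominated convergence: divided by [delta k], the remainder stays bounded by the Lipschitz bound
    and tends to 0 at each time. *)
Lemma remainder_small a b z (p q delta : nat -> R) (zk : nat -> R -> 'cV[R]_d) (K : R) :
  0 <= a -> b <= T -> flow a b z ->
  (forall k, 0 < delta k) -> delta k @[k --> \oo] --> 0 -> 0 <= K ->
  (\forall k \near \oo, [/\ a <= p k, p k <= q k, q k <= b,
     flow (p k) (q k) (zk k) &
     forall u, p k <= u <= q k -> `|zk k u - z u| <= K * delta k]) ->
  smallo delta (fun k => \int[mu]_(v in `[p k, q k]) norm1 (remainder z (zk k) v)).
Proof.
move=> a0 bT zf delta0 deltac K0 [N _ HN] e e0.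
have {}HN k := HN (k + N)%N (leq_addl k N).
have bd v : a <= v <= b -> 0 <= v <= T.
  by move=> /andP[av vb]; rewrite (le_trans a0 av) (le_trans vb).
(* The shift by [N] makes the eventual hypotheses valid at every index; the extension by zero
   outside [[p k, q k]] gives all integrands the domain [[a, b]]. *)
pose r k v := norm1 (remainder z (zk (k + N)%N) v) / delta (k + N)%N.
pose h k := r k \_ `[p (k + N)%N, q (k + N)%N].
have r0 k v : 0 <= r k v by rewrite divr_ge0 ?norm1_ge0// ltW.
have irem k : mx_integrable `[p (k + N)%N, q (k + N)%N] (remainder z (zk (k + N)%N)).
  have [ap pq qb zkf _] := HN k.
  apply: remainder_integrable => //; first exact: le_trans ap.
    exact: le_trans bT.
  exact: sub_primitive zf.
have ir k : mu.-integrable `[p (k + N)%N, q (k + N)%N] (EFin \o r k).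
  have := integrableZr (measurable_segment _ _) (delta (k + N)%N)^-1 (integrable_norm1 (irem k)).
  by apply: eq_integrable => // v _ /=; rewrite EFinM.
have sub_pq k : `[a, b] `&` `[p (k + N)%N, q (k + N)%N] = `[p (k + N)%N, q (k + N)%N]%classic.
  have [ap pq qb _ _] := HN k; apply: setIidr.
  by apply: subset_itv; rewrite bnd_simp.
have mh k : @measurable_fun _ _ (measurableTypeR R) (measurableTypeR R) `[a, b] (h k).
  apply/measurable_restrict; [exact: measurable_itv|exact: measurable_itv|].
  by rewrite sub_pq; apply/measurable_EFinP; exact: measurable_int (ir k).
have rle k v (c : R) : p (k + N)%N <= v <= q (k + N)%N -> 0 <= c ->
    `|remainder z (zk (k + N)%N) v| <= c * delta (k + N)%N -> r k v <= (d * 1)%:R * c.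
  move=> vpq c0 rv; rewrite ler_pdivrMr// (le_trans (norm1_le _))//.
  by rewrite -mulrA ler_wpM2l.
have hB k v : a <= v <= b -> `|h k v| <= (d * 1)%:R * (2 * L * K).
  move=> vab; rewrite /h patchE; case: ifPn => [|_]; last first.
    by rewrite normr0 !mulr_ge0.
  rewrite inE/= in_itv/= => vpq; rewrite ger0_norm//; apply: rle => //.
    by rewrite !mulr_ge0.
  rewrite (le_trans (remainder_le _ _ (bd _ vab)))// -[leRHS]mulrA ler_wpM2l ?mulr_ge0//.
  by have [_ _ _ _] := HN k; exact.
have hcvg v : a <= v <= b -> h k v @[k --> \oo] --> 0.
  move=> vab; apply/cvgrPdist_le => e1 e10.
  have d1 : 0 < (d * 1)%:R + 1 :> R by rewrite ltr_wpDl.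
  have K1 : 0 < K + 1 by rewrite ltr_wpDl.
  have e2 : 0 < e1 / (((d * 1)%:R + 1) * (K + 1)) by rewrite divr_gt0// mulr_gt0.
  have := near_jac e2 (f_diff (z v) (bd _ vab)) => /nbhs_norm0P[rho rho0 hrho].
  have Kd : \forall k \near \oo, K * delta (k + N)%N < rho.
    have : K * delta (k + N)%N @[k --> \oo] --> K * 0.
      by apply: cvgMr; rewrite (cvg_shiftn N delta (nbhs (0 : R))).
    rewrite mulr0 => /cvgrPdist_lt/(_ _ rho0); apply: filterS => k.
    by rewrite sub0r normrN; exact: le_lt_trans (ler_norm _).
  apply: filterS Kd => k Kd; rewrite sub0r normrN /h patchE.
  case: ifPn => [|_]; last by rewrite normr0 ltW.
  rewrite inE/= in_itv/= => vpq; rewrite ger0_norm//.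
  have [_ _ _ _ /(_ v vpq) zkv] := HN k.
  have e2' := ltW e2.
  apply: (@le_trans _ _ ((d * 1)%:R * (e1 / (((d * 1)%:R + 1) * (K + 1)) * K))).
    apply: rle => //; first by rewrite mulr_ge0.
    have := hrho (zk (k + N)%N v - z v) (le_lt_trans zkv Kd).
    rewrite [z v + _]addrC subrK => /le_trans; apply.
    by rewrite -[leRHS]mulrA ler_wpM2l.
  have -> : (d * 1)%:R * (e1 / (((d * 1)%:R + 1) * (K + 1)) * K) =
      e1 * (((d * 1)%:R / ((d * 1)%:R + 1)) * (K / (K + 1))).
    by rewrite invfM; ring.
  rewrite -[leRHS]mulr1 ler_wpM2l ?(ltW e10)// -[leRHS]mulr1.
  by apply: ler_pM; rewrite ?divr_ge0 ?(ltW d1) ?(ltW K1)//;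
    rewrite ler_pdivrMr// mul1r lerDl.
have itvP v : `[a, b]%classic v -> a <= v <= b by rewrite /= in_itv.
have mhE k : measurable_fun `[a, b] (EFin \o h k) by apply/measurable_EFinP; exact: mh.
have hcvgE : \forall v \ae mu, `[a, b]%classic v -> (EFin \o h k) v @[k --> \oo] --> 0%E.
  apply: aeW => v /itvP vab; apply/fine_cvgP; split; first by apply: nearW.
  exact: hcvg.
pose B : R := (d * 1)%:R * (2 * L * K).
have hBE : \forall v \ae mu, forall k, `[a, b]%classic v ->
    (`|(EFin \o h k) v| <= (EFin \o cst B) v)%E.
  by apply: aeW => v k /itvP vab; rewrite lee_fin; exact: hB.
have [_ _] := dominated_convergence (measurable_segment a b) mhE
  (measurable_cst _) hcvgE (integrable_cst a b _) hBE.
rewrite integral0 => /fine_cvg/cvgrPdist_le/(_ _ e0)[M _ HM].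
exists (M + N)%N => // n /= MNn.
have nN : (n = (n - N) + N)%N by rewrite subnK// (leq_trans _ MNn)// leq_addl.
have := HM (n - N)%N; rewrite /= leq_subRL; last by rewrite (leq_trans _ MNn)// leq_addl.
rewrite addnC => /(_ MNn); rewrite sub0r normrN.
have -> : fine (\int[mu]_(x in `[a, b]) ((h (n - N)%N x)%:E))%E =
    (\int[mu]_(v in `[p n, q n]) norm1 (remainder z (zk n) v)) / delta n.
  rewrite -[LHS]/(\int[mu]_(x in `[a, b]) h (n - N)%N x).
  rewrite -Rintegral_mkcondr sub_pq /r -nN.
  have := integrable_norm1 (irem (n - N)%N); rewrite -nN => i1.
  exact: (RintegralZr (delta n)^-1 (measurable_segment _ _) i1).
by rewrite normrM [`|(delta n)^-1|]gtr0_norm ?invr_gt0// ler_pdivrMr.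
Qed.

Lemma osc_ge0 x t a b : 0 <= osc x t a b.
Proof. by apply: Rintegral_ge0 => v _; exact: norm1_ge0. Qed.

Lemma osc_sub_le x t a b c e : 0 <= a -> b <= T -> a <= c -> e <= b ->
  osc x t c e <= osc x t a b.
Proof.
move=> a0 bT ac eb; apply: Rintegral_sub_le => //.
  exact: integrable_norm1 (drift_diff_integrable x t a0 bT).
by move=> s _; exact: norm1_ge0.
Qed.

Section expansion.
Variable delta : nat -> R.
Hypothesis delta_gt0 : forall k, 0 < delta k.
Hypothesis delta_cvg : delta k @[k --> \oo] --> 0.

Let delta_ge0 k : 0 <= delta k. Proof. exact: ltW. Qed.

Lemma flow_short_small (al be : nat -> R) (yk : nat -> R -> 'cV[R]_d) t x :
  (\forall k \near \oo, [/\ 0 <= al k, al k <= be k, be k <= T,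
     be k - al k <= delta k & flow (al k) (be k) (yk k)]) ->
  (forall e : R, 0 < e -> \forall k \near \oo, `|yk k (al k) - x| <= e) ->
  smallo delta (fun k => osc x t (al k) (be k)) ->
  smallo delta (fun k => mx_integral `[al k, be k] (fun v => f v (yk k v)) -
                         (be k - al k) *: f t x).
Proof.
move=> ab yx so.
have m0 (e : R) : 0 < e -> \forall k \near \oo,
    2 * (`|yk k (al k) - x| + (osc x t (al k) (be k) + (be k - al k) * `|f t x|)) * E <= e.
  move=> e0; have e3 : 0 < e / (6 * E) by rewrite divr_gt0// mulr_gt0.
  have so' := bigo_cvg delta_ge0 delta_cvg (smallo_bigo so) e3.
  have bo : bigo delta (fun k => (be k - al k) * `|f t x|).
    exists `|f t x|; apply: filterS ab => k [_ ab _ bad _].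
    by rewrite normrM normr_id mulrC ler_wpM2l// ger0_norm// subr_ge0.
  have bo' := bigo_cvg delta_ge0 delta_cvg bo e3.
  apply: filterS3 (yx _ e3) so' bo' => k h1 h2 h3.
  have {}h2 := le_trans (ler_norm _) h2; have {}h3 := le_trans (ler_norm _) h3.
  rewrite mulrAC -ler_pdivlMl; last by rewrite mulr_gt0.
  apply: (@le_trans _ _ (e / (6 * E) + (e / (6 * E) + e / (6 * E)))).
    by rewrite lerD// lerD.
  have E0' : E != 0 by rewrite gt_eqF.
  by rewrite le_eqVlt; apply/orP; left; apply/eqP; field.
move=> e e0; have e2 : 0 < e / 2 by rewrite divr_gt0.
have eL : 0 < e / (2 * (L + 1)) by rewrite divr_gt0// mulr_gt0.
apply: filterS3 ab (so _ e2) (m0 _ eL) => k [al0 albe beT bad yf] h2 h3.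
apply: (le_trans (flow_short t x al0 albe beT yf)).
have -> : e * delta k = e / 2 * delta k + e / 2 * delta k by rewrite -mulrDl -splitr.
rewrite lerD//; first exact: le_trans (ler_norm _) h2.
apply: (@le_trans _ _ ((L + 1) * delta k * (e / (2 * (L + 1))))).
  apply: ler_pM => //.
  - by rewrite mulr_ge0// subr_ge0.
  - rewrite !mulr_ge0 ?(ltW E0)// addr_ge0// addr_ge0 ?osc_ge0//.
    by rewrite mulr_ge0// subr_ge0.
  - by apply: ler_pM; rewrite ?subr_ge0// lerDl.
have L1' : L + 1 != 0 by rewrite gt_eqF.
by rewrite le_eqVlt; apply/orP; left; apply/eqP; field.
Qed.

(* The two flows are compared on the common interval from [max a (ak k)] to [min b (bk k)]; the
   two short remaining pieces are linear up to [smallo] because [a] and [b] are Lebesgue points. *)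
Lemma flow_expansion a b z (kap : R -> 'M[R]_d) (ak bk : nat -> R)
    (zk : nat -> R -> 'cV[R]_d) :
  0 <= a -> a < b -> b <= T -> flow a b z -> tangent a b z kap ->
  kap a \in unitmx ->
  (forall k, [/\ 0 <= ak k, ak k <= bk k, bk k <= T & flow (ak k) (bk k) (zk k)]) ->
  (forall k, `|ak k - a| <= delta k) -> (forall k, `|bk k - b| <= delta k) ->
  bigo delta (fun k => zk k (ak k) - z a) ->
  (forall x, smallo delta (fun k => osc x a (Num.min a (ak k)) (Num.max a (ak k)))) ->
  (forall x, smallo delta (fun k => osc x b (Num.min b (bk k)) (Num.max b (bk k)))) ->
  smallo delta (fun k => zk k (bk k) - z b -
    (kap b *m (invmx (kap a) *m (zk k (ak k) - z a - (ak k - a) *: f a (z a))) +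
     (bk k - b) *: f b (z b))).
Proof.
move=> a0 ab bT zf kf ua zkf aka bkb za osca oscb.
pose p k := Num.max a (ak k); pose q k := Num.min b (bk k).
have bndp k : [/\ a <= p k, ak k <= p k, p k - a <= delta k & p k - ak k <= delta k].
  have := aka k; rewrite ler_norml => /andP[h1 h2].
  by rewrite /p; case: (leP a (ak k)) => h; rewrite ?lexx ?subrr ?delta_ge0; split => //; lra.
have bndq k : [/\ q k <= b, q k <= bk k, b - q k <= delta k & bk k - q k <= delta k].
  have := bkb k; rewrite ler_norml => /andP[h1 h2].
  by rewrite /q; case: (leP b (bk k)) => h; rewrite ?lexx ?subrr ?delta_ge0; split => //; lra.
have pq : \forall k \near \oo, p k <= q k.
  have ba2 : 0 < (b - a) / 2 by rewrite divr_gt0// subr_gt0.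
  have /cvgrPdist_le/(_ _ ba2) := delta_cvg; apply: filterS => k.
  rewrite sub0r normrN ger0_norm// => dk.
  have [_ _ h1 _] := bndp k; have [_ _ h2 _] := bndq k; lra.
have pc : p k @[k --> \oo] --> a.
  apply/cvgrPdist_le => e e0; have /cvgrPdist_le/(_ _ e0) := delta_cvg.
  apply: filterS => k; rewrite sub0r normrN ger0_norm// => dk.
  have [h1 _ h2 _] := bndp k; rewrite distrC ger0_norm; lra.
have qc : q k @[k --> \oo] --> b.
  apply/cvgrPdist_le => e e0; have /cvgrPdist_le/(_ _ e0) := delta_cvg.
  apply: filterS => k; rewrite sub0r normrN ger0_norm// => dk.
  have [h1 _ h2 _] := bndq k; rewrite ger0_norm; lra.
have pab : \forall k \near \oo, a <= p k <= b.
  apply: filterS pq => k pqk; have [-> _ _ _] := bndp k; have [qb _ _ _] := bndq k.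
  exact: le_trans qb.
have qab : \forall k \near \oo, a <= q k <= b.
  apply: filterS pq => k pqk; have [ap _ _ _] := bndp k; have [-> _ _ _] := bndq k.
  by rewrite (le_trans ap).
have aab : a <= a <= b by rewrite lexx ltW.
have bab : a <= b <= b by rewrite lexx ltW.
pose Dp k := zk k (p k) - z (p k).
(* One of the intervals [[ak k, p k]] and [[a, p k]] is a point; on the other the motion is linear
   up to o(delta), and both cases are treated by the same difference. *)
have S1 : smallo delta (fun k => Dp k - (zk k (ak k) - z a - (ak k - a) *: f a (z a))).
  have s1 : smallo delta (fun k => mx_integral `[ak k, p k] (fun v => f v (zk k v)) -
                                   (p k - ak k) *: f a (z a)).
    apply: flow_short_small.
    - apply: filterS pq => k pqk; have [h0 h1 h2 h3] := zkf k.
      have [h4 h5 h6 h7] := bndp k; have [h8 h9 _ _] := bndq k; split => //; first lra.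
      by apply: sub_primitive h3 => //; lra.
    - exact: bigo_cvg za.
    - apply: (smallo_dominated (c := 1) _ (osca (z a))); apply: nearW => k; rewrite mul1r.
      rewrite !ger0_norm ?osc_ge0//; have [h0 h1 h2 h3] := zkf k.
      apply: osc_sub_le => //; first by rewrite le_min a0.
        by rewrite ge_max (le_trans (ltW ab) bT) (le_trans h1).
      by rewrite ge_min lexx orbT.
  have s2 : smallo delta (fun k => mx_integral `[a, p k] (fun v => f v (z v)) -
                                   (p k - a) *: f a (z a)).
    apply: (@flow_short_small (fun=> a) p (fun=> z)).
    - apply: filterS pab => k /andP[h1 h2].
      have [h4 h5 h6 h7] := bndp k; split => //; first lra.
      exact: sub_primitive zf.
    - by move=> e e0; apply: nearW => k; rewrite subrr normr0 ltW.
    - apply: (smallo_dominated (c := 1) _ (osca (z a))); apply: nearW => k; rewrite mul1r.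
      rewrite !ger0_norm ?osc_ge0//; have [h0 h1 h2 h3] := zkf k.
      apply: osc_sub_le => //; first by rewrite le_min a0.
        by rewrite ge_max (le_trans (ltW ab) bT) (le_trans h1).
      by rewrite ge_min lexx.
  apply: eq_smallo (smalloB s1 s2); apply: filterS2 pq pab => k pqk /andP[h1 h2].
  have [h4 h5 h6 h7] := bndp k; have [h8 h9 _ _] := bndq k.
  rewrite /Dp (primitive_integral (lexx a) h1 h2 zf).
  have [g0 g1 g2 g3] := zkf k.
  rewrite (primitive_integral (lexx _) h5 (le_trans pqk h9) g3).
  by mx_ring.
have bDp : bigo delta Dp.
  have ba : bigo delta (fun k => ak k - a) by exists 1; apply: nearW => k; rewrite mul1r.
  apply: eq_bigo (bigoD (smallo_bigo S1) (bigoB za (bigo_scale (f a (z a)) ba))).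
  by apply: nearW => k; rewrite subrK.
have [K0 K00 DpK] := bigo_pos delta_ge0 bDp.
have S3 : \forall k \near \oo, [/\ a <= p k, p k <= q k, q k <= b,
     flow (p k) (q k) (zk k) &
     forall u, p k <= u <= q k -> `|zk k u - z u| <= 2 * E * K0 * delta k].
  apply: filterS2 pq DpK => k pqk DpKk.
  have [h4 h5 h6 h7] := bndp k; have [h8 h9 _ _] := bndq k; have [g0 g1 g2 g3] := zkf k.
  have zkpq : flow (p k) (q k) (zk k) by exact: sub_primitive g3.
  split => // u upq; rewrite -mulrA.
  apply: (le_trans (flow_distance _ _ upq _ zkpq)); [lra|lra|exact: sub_primitive zf|].
  by rewrite ler_wpM2l// mulr_ge0// ltW.
have K1 : 0 <= 2 * E * K0 by rewrite !mulr_ge0// ltW.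
have Srem := remainder_small a0 bT zf delta_gt0 delta_cvg K1 S3.
have Dq : bigo delta (fun k => zk k (q k) - z (q k)).
  exists (2 * E * K0); apply: filterS S3 => k [_ pqk _ _]; apply.
  by rewrite pqk lexx.
have zqb : z (q k) @[k --> \oo] --> z b by exact: primitive_cvg zf bab qab qc.
have zkqb (e : R) : 0 < e -> \forall k \near \oo, `|zk k (q k) - z b| <= e.
  move=> e0; have e2 : 0 < e / 2 by rewrite divr_gt0.
  have /cvgrPdist_le/(_ _ e2) h1 := zqb.
  apply: filterS2 h1 (bigo_cvg delta_ge0 delta_cvg Dq e2) => k h1 h2.
  have -> : zk k (q k) - z b = (zk k (q k) - z (q k)) - (z b - z (q k)) by mx_ring.
  by rewrite (le_trans (ler_normB _ _))// [e]splitr lerD.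
have S2 : smallo delta (fun k => zk k (bk k) - z b - (zk k (q k) - z (q k)) -
                                 (bk k - b) *: f b (z b)).
  have osc' (c e : nat -> R) : (forall k, Num.min b (bk k) <= c k) ->
      (forall k, e k <= Num.max b (bk k)) ->
      smallo delta (fun k => osc (z b) b (c k) (e k)).
    move=> hc he; apply: (smallo_dominated (c := 1) _ (oscb (z b))).
    apply: nearW => k; rewrite mul1r !ger0_norm ?osc_ge0//.
    have [h0 h1 h2 h3] := zkf k; apply: osc_sub_le => //.
      by rewrite le_min (ltW (le_lt_trans a0 ab)) (le_trans h0).
    by rewrite ge_max bT.
  have s1 : smallo delta (fun k => mx_integral `[q k, bk k] (fun v => f v (zk k v)) -
                                   (bk k - q k) *: f b (z b)).
    apply: flow_short_small => //; last first.
      by apply: osc' => k; rewrite ?lexx ?le_max ?lexx ?orbT.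
    apply: filterS pq => k pqk; have [h0 h1 h2 h3] := zkf k.
    have [h4 h5 h6 h7] := bndp k; have [h8 h9 g1 g2] := bndq k; split => //; first lra.
    by apply: sub_primitive h3 => //; lra.
  have s2 : smallo delta (fun k => mx_integral `[q k, b] (fun v => f v (z v)) -
                                   (b - q k) *: f b (z b)).
    apply: (@flow_short_small q (fun=> b) (fun=> z)).
    - apply: filterS qab => k /andP[h1 h2].
      have [h8 h9 g1 g2] := bndq k; split => //; first lra.
      exact: sub_primitive zf.
    - by move=> e e0; have /cvgrPdist_le/(_ _ e0) := zqb; apply: filterS => k; rewrite distrC.
    - by apply: osc' => k; rewrite ?lexx ?le_max ?lexx.
  apply: eq_smallo (smalloB s1 s2); apply: filterS2 pq qab => k pqk /andP[h1 h2].
  have [h4 h5 h6 h7] := bndp k; have [h8 h9 _ _] := bndq k.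
  rewrite (primitive_integral h1 h2 (lexx b) zf).
  have [g0 g1 g2 g3] := zkf k.
  rewrite (primitive_integral (le_trans h5 pqk) h9 (lexx _) g3).
  by mx_ring.
(* The displacement at [p k] is expressed in the coordinates in which [kap] is linear. Exchanging
   [kap (p k)] with [kap a], or [kap (q k)] with [kap b], costs o(delta), since [kap] is continuous
   and [v] is O(delta). *)
pose v k := invmx (kap a) *m Dp k.
have bv : bigo delta v by exact: bigo_mulmx.
have kv k : kap a *m v k = Dp k by rewrite /v mulmxA mulmxV// mul1mx.
have kap_small (c : nat -> R) (l : R) : a <= l <= b ->
    (\forall k \near \oo, a <= c k <= b) -> c k @[k --> \oo] --> l ->
    smallo delta (fun k => (kap (c k) - kap l) *m v k).
  move=> lab cab cl; apply: smallo_cvg_mulmx => // e e0.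
  have /cvgrPdist_le/(_ _ e0) := primitive_cvg kf lab cab cl.
  by apply: filterS => k; rewrite distrC.
have S4 : smallo delta (fun k => zk k (q k) - z (q k) - kap (q k) *m v k).
  have s0 : smallo delta (fun k => Dp k - kap (p k) *m v k).
    have := smalloN (kap_small p a aab pab pc); apply: eq_smallo.
    apply: nearW => k; rewrite mulmxBl kv; mx_ring.
  have s1 : smallo delta (fun k => `|Dp k - kap (p k) *m v k| +
      \int[mu]_(s in `[p k, q k]) norm1 (remainder z (zk k) s)).
    apply: (smalloD _ Srem) => e /s0.
    by apply: filterS => k; rewrite normr_id.
  apply: (smallo_dominated (c := 2 * E) _ s1).
  apply: filterS S3 => k [h1 h2 h3 h4 _].
  rewrite [X in _ <= _ * X]ger0_norm; last first.
    by rewrite addr_ge0// Rintegral_ge0// => s _; exact: norm1_ge0.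
  apply: flow_tangent => //; first lra.
  - exact: le_trans bT.
  - exact: sub_primitive zf.
  - exact: sub_primitive kf.
have S5 : smallo delta (fun k => kap (q k) *m v k - kap b *m v k).
  by apply: eq_smallo (kap_small q b bab qab qc); apply: nearW => k; rewrite mulmxBl.
have S6 := smallo_mulmx (kap b) (smallo_mulmx (invmx (kap a)) S1).
apply: eq_smallo (smalloD (smalloD S2 S4) (smalloD S5 S6)).
apply: nearW => k; rewrite [in X in _ + (_ + X) = _]mulmxBr [kap b *m (_ - _)]mulmxBr.
by rewrite -/(v k); mx_ring.
Qed.

End expansion.
End flow.

(** * Lebesgue points of the drift, common to all spatial points *)

Section lebesgue_points.
Context {R : realType}.
Notation mu := (@lebesgue_measure R).

Lemma lebesgue_pt_smallo (T t : R) (h : R -> R) (delta s : nat -> R) :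
  0 <= t <= T -> mu.-integrable `[0, T] (EFin \o h) -> lebesgue_pt (h \_ `[0, T]) t ->
  (forall k, 0 < delta k) -> delta k @[k --> \oo] --> 0 ->
  (forall k, 0 <= s k <= T) -> (forall k, `|s k - t| <= delta k) ->
  smallo delta (fun k =>
    \int[mu]_(v in `[Num.min t (s k), Num.max t (s k)]) `|h v - h t|).
Proof.
move=> tT ih ht delta_gt0 delta_cvg sT st e e0.
(* The open ball of radius [2 * delta k] contains the closed interval between [t] and [s k] and has
   length [4 * delta k], whence the tolerance [e / 4]. *)
have e4 : 0 < e / 4 by rewrite divr_gt0.
have r0 : (2 * delta k) @[k --> \oo] --> (0 : R)^'+.
  have d2 : (2 * delta k) @[k --> \oo] --> (0 : R) by rewrite -(mulr0 2); exact: cvgMr.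
  move=> A A0.
  have : \forall k \near \oo, 0 < 2 * delta k -> A (2 * delta k) by exact: (d2 _ A0).
  rewrite -[nbhs _ A]/(\forall k \near \oo, A (2 * delta k)).
  by apply: filterS => k; apply; rewrite mulr_gt0.
have := cvg_comp _ _ r0 ht.
move/fine_cvgP => [fin /cvgrPdist_le/(_ _ e4)].
apply: filterS2 fin => k fk /=; rewrite sub0r normrN ger0_norm ?fine_ge0 ?davg_ge0//.
rewrite -lee_fin fineK// /davg/= /iavg/=.
have d0 := delta_gt0 k; have d2 : 0 <= 2 * delta k by rewrite mulr_ge0// ltW.
rewrite (lebesgue_measure_ball _ d2) inver mulrn_eq0/= mulf_eq0 pnatr_eq0/= gt_eqF//.
rewrite lee_pdivrMl ?mulrn_wgt0 ?mulr_gt0// -EFinM => le1.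
have [t0 tT'] := andP tT; have [s0 sT'] := andP (sT k).
have sub0T v : Num.min t (s k) <= v <= Num.max t (s k) -> 0 <= v <= T.
  move=> /andP[h1 h2]; rewrite (le_trans _ h1) ?le_min ?t0//=.
  by rewrite (le_trans h2)// ge_max tT'.
have iD : mu.-integrable `[Num.min t (s k), Num.max t (s k)] (EFin \o (fun v => `|h v - h t|)).
  have ih' : mu.-integrable `[Num.min t (s k), Num.max t (s k)] (EFin \o h).
    apply: integrableS ih; [exact: measurable_itv|exact: measurable_itv|].
    by move=> v /=; rewrite !in_itv/=; exact: sub0T.
  have := integrable_norm (integrableB (measurable_segment _ _) ih' (integrable_cst _ _ (h t))).
  by apply: eq_integrable => // v _ /=.
rewrite ger0_norm; last exact: Rintegral_ge0.
rewrite -lee_fin /Rintegral fineK; last first.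
  by apply: integrable_fin_num iD; exact: measurable_itv.
have -> : e * delta k = (2 * delta k) *+ 2 * (e / 4) by rewrite mulr2n; field.
apply: le_trans le1.
have tt : (h \_ `[0, T]) t = h t.
  by rewrite patchE ifT//; apply/mem_set; rewrite /= in_itv/= tT.
have mh : measurable_fun (setT : set R) (h \_ `[0, T]).
  by case: (integrable_locally_restrict (measurable_itv `[0, T]) ih).
have -> : (\int[mu]_(v in `[Num.min t (s k), Num.max t (s k)]) (`|h v - h t|)%:E =
  \int[mu]_(v in `[Num.min t (s k), Num.max t (s k)])
     `|((h \_ `[0%R, T]) v - (h \_ `[0%R, T]) t)%:E|)%E.
  apply: eq_integral => v /set_mem; rewrite /= in_itv/= => vst.
  by rewrite tt patchE ifT//; apply/mem_set; rewrite /= in_itv/=; exact: sub0T.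
apply: ge0_subset_integral; [exact: measurable_itv|exact: measurable_ball| |by []|].
  apply: measurableT_comp => //; apply/measurable_EFinP.
  by apply: measurable_funB => //; exact: measurable_funS mh.
move=> v /=; rewrite in_itv/= => /andP[h1 h2].
have := st k; rewrite ler_norml => /andP[h3 h4].
rewrite /ball/= ltr_norml.
move: h1 h2; rewrite ge_min le_max => /orP[h1|h1] /orP[h2|h2]; apply/andP; split; lra.
Qed.

Lemma Rintegral_sum a b (I : Type) (r : seq I) (F : I -> R -> R) :
  (forall i, mu.-integrable `[a, b] (EFin \o F i)) ->
  \int[mu]_(v in `[a, b]) (\sum_(i <- r) F i v) = \sum_(i <- r) \int[mu]_(v in `[a, b]) F i v.
Proof.
move=> iF; rewrite /Rintegral.
under eq_integral do rewrite -sumEFin.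
rewrite (integral_sum (measurable_segment a b) iF) -sum_fine// => i _.
by apply: integrable_fin_num (iF i); exact: measurable_itv.
Qed.

Lemma rational_matrix_dense m n (A : 'M[R]_(m, n)) (e : R) : 0 < e ->
  exists Q : 'M[rat]_(m, n), `|map_mx ratr Q - A| <= e.
Proof.
move=> e0.
have /choice[q qx] : forall ij : 'I_m * 'I_n, exists q : rat,
    A ij.1 ij.2 - e < ratr q < A ij.1 ij.2 + e.
  move=> ij; have : A ij.1 ij.2 - e < A ij.1 ij.2 + e by lra.
  by move=> /rat_in_itvoo[q]; rewrite in_itv/= => qx; exists q.
exists (\matrix_(i, j) q (i, j)); apply: mx_norm_le => [|i j]; first exact: ltW.
have /andP[h1 h2] := qx (i, j); rewrite !mxE ler_norml; lra.
Qed.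

Variables (d : nat) (T C : R) (f : R -> 'cV[R]_d -> 'cV[R]_d).
Hypothesis C0 : 0 <= C.
Hypothesis f_diff : forall v x, 0 <= v <= T -> differentiable (f v) x.
Hypothesis f_jac : forall v x, 0 <= v <= T -> `|jac (f v) x| <= C.
Hypothesis f_int : forall x, mx_integrable `[0, T] (fun v => f v x).

Definition drift_lebesgue_point t : Prop := forall (x : 'cV[R]_d) (delta s : nat -> R),
  (forall k, 0 < delta k) -> delta k @[k --> \oo] --> 0 ->
  (forall k, 0 <= s k <= T) -> (forall k, `|s k - t| <= delta k) ->
  smallo delta (fun k => osc f x t (Num.min t (s k)) (Num.max t (s k))).

Lemma osc_lipschitz x y t a b : 0 <= t <= T -> 0 <= a -> a <= b -> b <= T ->
  osc f x t a b <= osc f y t a b + (d * 1)%:R * (2 * (d%:R * C * `|x - y|)) * (b - a).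
Proof.
move=> tT a0 ab bT.
have iN z := integrable_norm1 (drift_diff_integrable f_int z t a0 bT).
set c := (X in _ + X * _).
have ic : mu.-integrable `[a, b] (EFin \o (fun v => norm1 (f v y - f t y) + c)).
  have := integrableD (measurable_segment a b) (iN y) (integrable_cst a b c).
  by apply: eq_integrable => // v _ /=; rewrite EFinD.
have -> : osc f y t a b + c * (b - a) = \int[mu]_(v in `[a, b]) (norm1 (f v y - f t y) + c).
  rewrite (RintegralD (measurable_segment a b) (iN y) (integrable_cst a b c)).
  by rewrite Rintegral_cst_segment// mulrC.
apply: le_Rintegral; [exact: measurable_itv|exact: iN|exact: ic|].
move=> v /=; rewrite in_itv/= => /andP[av vb].
have vT : 0 <= v <= T by rewrite (le_trans a0 av) (le_trans vb).
have -> : f v x - f t x = (f v y - f t y) + ((f v x - f v y) - (f t x - f t y)) by mx_ring.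
have ne A B : norm1 (A + B : 'cV[R]_d) <= norm1 A + norm1 B.
  by rewrite /norm1 -big_split/=; apply: ler_sum => ij _; rewrite mxE ler_normD.
rewrite (le_trans (ne _ _))// lerD2l (le_trans (norm1_le _))// ler_wpM2l//.
rewrite (le_trans (ler_normB _ _))// mulr_natl mulr2n.
by rewrite lerD//; exact: drift_lipschitz C0 f_diff f_jac _ _ _ _.
Qed.

(** Lebesgue differentiation gives one null set for each [x]. Those of the rational points are
    collected, and the other points are reached through [osc_lipschitz], whose error is proportional
    to the length of the interval with a small factor. *)
Lemma drift_lebesgue_points : exists2 N : set R, mu.-negligible N &
  forall t, 0 <= t <= T -> ~ N t -> drift_lebesgue_point t.
Proof.
pose q x : R -> 'I_d -> R -> R := fun _ i v => f v x i 0.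
have ih x i : mu.-integrable `[0, T] (EFin \o (fun v => f v x i 0)) := f_int x i 0.
pose N (y : 'cV[rat]_d) := \bigcup_(k : nat) [set t | exists2 i : 'I_d, i = k :> nat &
  ~ lebesgue_pt ((fun v => f v (map_mx ratr y) i 0) \_ `[0, T]) t].
exists (\bigcup_(k : nat) (if unpickle k is Some y then N y else set0)).
  apply: negligible_bigcup => k; case: unpickle => [y|]; last exact: negligible_set0.
  apply: negligible_bigcup => j.
  have [jd|jd] := ltnP j d; last first.
    rewrite (_ : [set _ | _] = set0); first exact: negligible_set0.
    by rewrite -subset0 => t [i ij]; move: (ltn_ord i); rewrite ij ltnNge jd.
  have ae := lebesgue_differentiation (integrable_locally_restrict
    (measurable_itv `[0, T]) (ih (map_mx ratr y) (Ordinal jd))).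
  apply: negligibleS ae => t [i ij /=] H /= H'; apply: H.
  by rewrite (_ : i = Ordinal jd)//; exact: val_inj.
move=> t tT Nt x delta s delta_gt0 delta_cvg sT st e e0.
pose c : R := (d * 1)%:R * (2 * (d%:R * C)).
have c1 : 0 < c + 1 by rewrite ltr_wpDl// !mulr_ge0.
have [y yx] := rational_matrix_dense x (divr_gt0 e0 (mulr_gt0 (@ltr0n R 2) c1)).
set y' := map_mx ratr y in yx.
have osc_y : smallo delta (fun k => osc f y' t (Num.min t (s k)) (Num.max t (s k))).
  apply: (@eq_smallo _ _ _ (fun k => \sum_(ij : 'I_d * 'I_1)
      \int[mu]_(v in `[Num.min t (s k), Num.max t (s k)])
         `|f v y' ij.1 ij.2 - f t y' ij.1 ij.2|)).
    apply: nearW => k; have [t0 tT'] := andP tT; have [s0 sT'] := andP (sT k).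
    rewrite /osc -Rintegral_sum//.
      by apply: eq_Rintegral => v _; apply: eq_bigr => ij _; rewrite !mxE.
    move=> ij; have iD := @drift_diff_integrable _ _ _ _ f_int y' t
      (Num.min t (s k)) (Num.max t (s k)).
    have := integrable_norm (iD _ _ ij.1 ij.2); rewrite le_min t0 s0 ge_max tT' sT'.
    move=> /(_ isT isT); apply: eq_integrable => // v _ /=; by rewrite !mxE.
  apply: smallo_sum => [k|[i j]/=]; first exact: ltW.
  rewrite (ord1 j).
  apply: (lebesgue_pt_smallo tT (ih y' i)) => //.
  apply: contrapT => H; apply: Nt; exists (pickle y) => //; rewrite pickleK.
  by exists i => //; exists i.
have e2 : 0 < e / 2 by rewrite divr_gt0.
apply: filterS (osc_y _ e2) => k.
rewrite !ger0_norm ?osc_ge0// => le1.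
have [t0 tT'] := andP tT; have [s0 sT'] := andP (sT k).
apply: (le_trans (@osc_lipschitz x y' t _ _ tT _ _ _)).
- by rewrite le_min t0.
- by rewrite ge_min le_max lexx.
- by rewrite ge_max tT'.
rewrite (_ : e * delta k = e / 2 * delta k + e / 2 * delta k); last by rewrite -mulrDl -splitr.
rewrite lerD//.
have ms : Num.max t (s k) - Num.min t (s k) <= delta k.
  have := st k; rewrite ler_norml => /andP[h3 h4].
  rewrite maxEle minEle; case: ifP => _; lra.
have d0 := ltW (delta_gt0 k).
apply: (@le_trans _ _ ((d * 1)%:R * (2 * (d%:R * C * `|x - y'|)) * delta k)).
  by rewrite ler_wpM2l// !mulr_ge0.
rewrite ler_wpM2r//.
have -> : (d * 1)%:R * (2 * (d%:R * C * `|x - y'|)) = c * `|x - y'| by rewrite /c; ring.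
apply: (@le_trans _ _ ((c + 1) * (e / (2 * (c + 1))))); last first.
  suff -> : (c + 1) * (e / (2 * (c + 1))) = e / 2 by [].
  by field; rewrite gt_eqF.
apply: ler_pM => //; [by rewrite !mulr_ge0|by rewrite lerDl|by rewrite distrC].
Qed.

End lebesgue_points.

(** * Expansion of the terminal value along sequences of paths *)

Section skeleton.
Context {R : realType} (T : R) (w : counting_path R).
Notation mu := (@lebesgue_measure R).
Hypothesis T0 : 0 <= T.
Implicit Types (i j : nat) (u t : R).

(** The index is shifted: [knot 0] is the start and [knot i.+1] is [jump w i]. Past the last jump
    the knots equal [T], so the stretch up to the horizon is the piece of index [w T]. *)
Definition knot i : R :=
  if i is j.+1 then if (j < w T)%N then jump w j else T else 0.

Lemma knot_jump i : (i < w T)%N -> knot i.+1 = jump w i.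
Proof. by rewrite /knot => ->. Qed.

Lemma knot_last : knot (w T).+1 = T.
Proof. by rewrite /knot ltnn. Qed.

Lemma knot_ge0 i : 0 <= knot i.
Proof.
case: i => [|i]//=; case: ifP => // iT; apply: ltW; exact: jump_gt0 iT.
Qed.

Lemma knot_le i : knot i <= T.
Proof. case: i => [|i]//=; case: ifP => // iT; exact: jump_le. Qed.

Lemma knot_lt i : (i < w T)%N -> knot i < knot i.+1.
Proof.
move=> iT; rewrite (knot_jump iT); case: i iT => [|i] iT; first exact: jump_gt0 iT.
rewrite knot_jump; last exact: ltnW.
exact: jump_lt iT _.
Qed.

Lemma knot_le_succ i : (i <= w T)%N -> knot i <= knot i.+1.
Proof.
rewrite leq_eqVlt => /orP[/eqP ->|/knot_lt/ltW//].
by rewrite knot_last knot_le.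
Qed.

Lemma path_knot i : (i <= w T)%N -> w (knot i) = i.
Proof.
case: i => [_|i iT]; first by rewrite path_val_le0.
by rewrite (knot_jump iT); exact: path_jump iT.
Qed.

Lemma path_between_knots i u : (i <= w T)%N -> knot i <= u <= T ->
  (u < knot i.+1) || (i == w T) -> w u = i.
Proof.
move=> iT /andP[iu uT] ui; apply/eqP; rewrite eqn_leq -{2}(path_knot iT) path_val_homo// andbT.
case/orP: ui => [|/eqP ->]; last exact: path_val_homo.
move: iT; rewrite leq_eqVlt => /orP[/eqP -> _|iT]; first exact: path_val_homo.
by rewrite (knot_jump iT) (jump_gt _ iT).
Qed.

Section integral_equation.
Variables (m n : nat) (y0 : 'M[R]_(m, n)) (a b y : R -> 'M[R]_(m, n)).
Hypothesis yE : integral_equation T w y0 a b y.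

(** The solution continued from [knot i] by its drift integral alone. It is continuous up to the
    next knot, where its value is the left limit of [y]. *)
Definition piece i u := y (knot i) + mx_integral `[knot i, u] a.

Lemma integral_equation0 : y 0 = y0.
Proof.
case: yE => _ _ /(_ 0); rewrite lexx T0 mx_integral1 sum_jump_times path_val_le0//.
by rewrite big_ord0 !addr0; apply.
Qed.

Lemma integral_equationE i u : (i <= w T)%N -> knot i <= u <= T ->
  y u = piece i u + \sum_(i <= j < w u) b (jump w j).
Proof.
move=> iT /andP[iu uT]; have [_ ia yt] := yE.
have u0 : 0 <= u by rewrite (le_trans (knot_ge0 i)).
rewrite /piece (yt u) ?u0// (yt (knot i)) ?knot_ge0 ?knot_le//.
rewrite !sum_jump_times path_knot// (@mx_integral_split _ _ _ (knot i) 0 u) ?knot_ge0//; last first.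
  exact: sub_mx_integrable ia.
have iwu : (i <= w u)%N by rewrite -{1}(path_knot iT) path_val_homo.
rewrite -[X in _ + X = _](big_mkord xpredT (fun j => b (jump w j))).
rewrite -(big_mkord xpredT (fun j => b (jump w j))) (big_cat_nat (n := i))//=.
by mx_ring.
Qed.

Lemma piece_eq i u : (i <= w T)%N -> knot i <= u <= T ->
  (u < knot i.+1) || (i == w T) -> y u = piece i u.
Proof.
move=> iT iu ui; rewrite (integral_equationE iT iu) (path_between_knots iT iu ui).
by rewrite big_geq// addr0.
Qed.

Lemma piece_knot i : piece i (knot i) = y (knot i).
Proof. by rewrite /piece mx_integral1 addr0. Qed.

Lemma piece_left_limit i : (i < w T)%N -> left_limit y (knot i.+1) = piece i (knot i.+1).
Proof.
move=> iT; set t := knot i.+1; have st : knot i < t := knot_lt iT.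
have [_ ia _] := yE.
apply: cvg_lim => //.
have ca : {within `[knot i, t], continuous (fun u => mx_integral `[knot i, u] a)}.
  apply: mx_integral_continuous; first exact: ltW.
  exact: (sub_mx_integrable (knot_ge0 i) (knot_le i.+1) ia).
have /subspace_continuousP/(_ t) := ca.
rewrite /= in_itv/= lexx (ltW st) => /(_ isT) ct.
have cp : piece i u @[u --> within `[knot i, t] (nbhs t)] --> piece i t.
  by apply: cvgD; [exact: cvg_cst|exact: ct].
move=> A At.
have {}cp : \forall u \near t, `[knot i, t]%classic u -> A (piece i u) := cp _ At.
have si : \forall u \near t, knot i < u by exact: lt_nbhsr.
rewrite -[nbhs _ _]/(\forall u \near t, u < t -> A (y u)).
apply: filterS2 cp si => u /= hA su ut.
rewrite (piece_eq (ltnW iT)); last by rewrite ut.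
  by apply: hA; rewrite in_itv/= (ltW su) ltW.
by rewrite (ltW su) (le_trans (ltW ut))// knot_le.
Qed.

Lemma piece_jump i : (i < w T)%N ->
  y (knot i.+1) = piece i (knot i.+1) + b (knot i.+1).
Proof.
move=> iT; rewrite (integral_equationE (ltnW iT)); last by rewrite knot_le_succ ?knot_le// ltnW.
by rewrite path_knot// big_nat1 knot_jump.
Qed.

Lemma piece_last : y T = piece (w T) T.
Proof. by rewrite (piece_eq (leqnn _)) ?knot_le ?lexx ?eqxx ?orbT. Qed.

Lemma primitive_piece i (F : R -> 'M[R]_(m, n)) : (i <= w T)%N ->
  (forall u, knot i <= u <= T -> (u < knot i.+1) || (i == w T) -> a u = F u) ->
  primitive (knot i) (knot i.+1) (piece i) F.
Proof.
move=> iT aF; have [_ ia _] := yE.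
have ia' : mx_integrable `[knot i, knot i.+1] a.
  exact: (sub_mx_integrable (knot_ge0 i) (knot_le i.+1) ia).
have aF' u : knot i <= u < knot i.+1 -> a u = F u.
  move=> /andP[iu ui]; apply: aF; last by rewrite ui.
  by rewrite iu (le_trans (ltW ui))// knot_le.
split.
  apply/mx_integrable_bndo; have /mx_integrable_bndo := ia'.
  by apply: eq_mx_integrable => // u /=; rewrite in_itv/=; exact: aF'.
move=> u /andP[iu ui]; rewrite piece_knot /piece; congr (_ + _).
apply: eq_mx_integral_bndo => [|s /andP[is_ su]].
  exact: sub_mx_integrable ia'.
by apply: aF'; rewrite is_ (lt_le_trans su).
Qed.

End integral_equation.

Section solution.
Variables (d : nat) (f g : R -> 'cV[R]_d -> 'cV[R]_d) (x0 : 'cV[R]_d).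
Variables (X : R -> 'cV[R]_d) (K : R -> 'M[R]_d).

(** The two integral equations along one path, rewritten as a finite alternation of continuous flows
    and jumps; left limits become values of a piece at its right end. *)
Record path_skeleton (z : nat -> R -> 'cV[R]_d) (kap : nat -> R -> 'M[R]_d) : Prop := {
  skeleton_flow : forall i, (i <= w T)%N -> flow f (knot i) (knot i.+1) (z i) ;
  skeleton_tangent : forall i, (i <= w T)%N ->
    tangent f (knot i) (knot i.+1) (z i) (kap i) ;
  skeleton_start : z 0 0 = x0 ;
  skeleton_tangent_start : kap 0 0 = 1%:M ;
  skeleton_jump : forall i, (i < w T)%N ->
    z i.+1 (knot i.+1) = z i (knot i.+1) + g (knot i.+1) (z i (knot i.+1)) ;
  skeleton_tangent_jump : forall i, (i < w T)%N ->
    kap i.+1 (knot i.+1) = kap i (knot i.+1) +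
      jac (g (knot i.+1)) (z i (knot i.+1)) *m kap i (knot i.+1) ;
  skeleton_end : z (w T) T = X T ;
  skeleton_tangent_knot : forall i, (i <= w T)%N -> kap i (knot i) = K (knot i) ;
  skeleton_tangent_end : kap (w T) T = K T }.

Lemma solution_skeleton :
  integral_equation T w x0 (fun s => f s (X s)) (fun s => g s (left_limit X s)) X ->
  integral_equation T w 1%:M (fun s => jac (f s) (X s) *m K s)
    (fun s => jac (g s) (left_limit X s) *m left_limit K s) K ->
  exists z kap, path_skeleton z kap.
Proof.
move=> XE KE.
exists (piece (fun s => f s (X s)) X), (piece (fun s => jac (f s) (X s) *m K s) K).
split=> [i iT|i iT|||i iT|i iT||i iT|].
- by apply: (primitive_piece XE) => // u iu ui; rewrite -(piece_eq XE).
- by apply: (primitive_piece KE) => // u iu ui; rewrite -(piece_eq XE)// -(piece_eq KE).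
- by rewrite -[RHS](integral_equation0 XE); exact: piece_knot.
- by rewrite -[RHS](integral_equation0 KE); exact: piece_knot.
- by rewrite piece_knot (piece_jump XE)// (piece_left_limit XE).
- by rewrite piece_knot (piece_jump KE)// (piece_left_limit XE)// (piece_left_limit KE).
- by rewrite (piece_last XE).
- exact: piece_knot.
- by rewrite (piece_last KE).
Qed.

End solution.
End skeleton.

Section skeleton_invertible.
Context {R : realType} {d : nat}.
Notation mu := (@lebesgue_measure R).
Variables (T C : R) (f g : R -> 'cV[R]_d -> 'cV[R]_d).
Hypothesis T0 : 0 <= T.
Hypothesis C0 : 0 <= C.
Hypothesis f_meas : @measurable_fun _ _ (borel (R * 'cV[R]_d)%type)
  (borel 'cV[R]_d) (`[0, T] `*` setT) (fun tx => f tx.1 tx.2).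
Hypothesis f_diff : forall v x, 0 <= v <= T -> differentiable (f v) x.
Hypothesis f_jac : forall v x, 0 <= v <= T -> `|jac (f v) x| <= C.

Lemma integral_equation_bounded m n w (y0 : 'M[R]_(m, n)) (a b y : R -> 'M[R]_(m, n)) :
  integral_equation T w y0 a b y -> exists B, forall u, 0 <= u <= T -> `|y u| <= B.
Proof.
move=> [_ ia yE].
have iH := integrable_norm1 (ia : mx_integrable `[0, T] a).
exists (`|y0| + \int[mu]_(v in `[0, T]) norm1 (a v) + \sum_(i < w T) `|b (jump w i)|).
move=> u /[dup] uT /andP[u0 uT']; rewrite yE// sum_jump_times.
rewrite (le_trans (ler_normD _ _))// lerD//.
  rewrite (le_trans (ler_normD _ _))// lerD2l.
  apply: (@le_trans _ _ (\int[mu]_(v in `[0, u]) norm1 (a v))).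
    apply: norm_mx_integral_le; first exact: sub_mx_integrable ia.
      exact: sub_integrable iH.
    by move=> s _; exact: le_norm1.
  by apply: Rintegral_sub_le => // v _; exact: norm1_ge0.
rewrite (le_trans (ler_norm_sum _ _ _))//.
rewrite -(big_mkord xpredT (fun i => `|b (jump w i)|)).
rewrite -[leRHS](big_mkord xpredT (fun i => `|b (jump w i)|)).
rewrite [leRHS](big_cat_nat (n := w u))//=; last exact: path_val_homo.
by rewrite lerDl sumr_ge0.
Qed.

(** The equation gives integrability along a solution only; boundedness of that solution and the
    Lipschitz bound transfer it to a fixed point [x]. *)
Lemma drift_integrable w x0 (b X : R -> 'cV[R]_d) x :
  integral_equation T w x0 (fun s => f s (X s)) b X -> mx_integrable `[0, T] (fun v => f v x).
Proof.
move=> XE; have [B XB] := integral_equation_bounded XE; have [_ iX _] := XE.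
have iX' : mx_integrable `[0, T] (fun s => f s (X s)) := iX.
apply: (@eq_mx_integrable _ _ _ _ (fun v => (f v x - f v (X v)) + f v (X v))).
- exact: measurable_itv.
- by move=> v _; rewrite subrK.
apply: mx_integrableD => //; apply: (@mx_integrable_bounded _ _ _ _ _ _ (d%:R * C * (`|x| + B))).
  move=> i j; rewrite (_ : (fun v => _) = (fun v => f v x i 0 - f v (X v) i j)); last first.
    by apply/funext => v; rewrite !mxE (ord1 j).
  apply: measurable_funB.
    apply: (measurable_drift f_meas) => //.
    by move=> s; exact: cvg_cst.
  by have := measurable_int _ (iX i j); move/measurable_EFinP.
move=> v vT; rewrite (le_trans (drift_lipschitz C0 f_diff f_jac _ _ _))//.
rewrite ler_wpM2l ?mulr_ge0// (le_trans (ler_normB _ _))// lerD2l; exact: XB.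
Qed.

Lemma tangent_kernel a b z m (kap : R -> 'M[R]_(d, m)) (v : 'cV[R]_m) :
  0 <= a -> a <= b -> b <= T -> tangent f a b z kap -> kap a *m v = 0 -> kap b *m v = 0.
Proof.
move=> a0 ab bT [ik kE] av.
have yF u : a <= u <= b -> kap u *m v =
    kap a *m v + mx_integral `[a, u] (fun s => jac (f s) (z s) *m kap s *m v).
  move=> /[dup] uab /andP[au ub]; rewrite mx_integral_mulmxr; last exact: sub_mx_integrable ik.
  by rewrite (kE _ uab) mulmxDl.
have L0 : 0 <= d%:R * C by rewrite mulr_ge0.
have Fle s : a <= s <= b -> `|jac (f s) (z s) *m kap s *m v| <=
    d%:R * C * `|kap s *m v| + cst 0 s.
  move=> /andP[as_ sb]; rewrite addr0 -mulmxA; apply: (drift_jac_mulmx f_jac).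
  by rewrite (le_trans a0 as_) (le_trans sb).
have bab : a <= b <= b by rewrite ab lexx.
have := gronwall L0 (mx_integrable_mulmxr v ik) yF (integrable_cst a b 0)
  (fun v _ => lexx 0) Fle bab.
rewrite av normr0 Rintegral_cst_segment// mulr0 addr0 mulr0 mul0r normr_le0.
by move/eqP.
Qed.

(** A vector killed at one knot is killed at all later ones, by uniqueness between knots and
    linearity at jumps. Invertibility at [T] therefore propagates backwards. *)
Lemma skeleton_unit w x0 X K z kap i : path_skeleton T w f g x0 X K z kap ->
  K T \in unitmx -> (i <= w T)%N -> kap i (knot T w i) \in unitmx.
Proof.
move=> sk KT iT.
suff kill (v : 'cV[R]_d) : kap i (knot T w i) *m v = 0 -> K T *m v = 0.
  rewrite -unitmx_tr -row_free_unit; apply: inj_row_free => v.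
  move=> /(congr1 trmx); rewrite trmx_mul trmxK trmx0 => /kill.
  move=> /(congr1 (mulmx (invmx (K T)))); rewrite mulmxA mulVmx// mul1mx mulmx0.
  by move=> /(congr1 trmx); rewrite trmxK trmx0.
have step j : (j <= w T)%N -> kap j (knot T w j) *m v = 0 ->
    kap j (knot T w j.+1) *m v = 0.
  move=> jT; apply: tangent_kernel (skeleton_tangent sk jT) => //.
  - exact: knot_ge0.
  - exact: knot_le_succ.
  - exact: knot_le.
move=> iv; rewrite -(skeleton_tangent_end sk).
have -> : kap (w T) T = kap (w T) (knot T w (w T).+1) by rewrite knot_last.
apply: (step) => //.
suff H k : (i + k <= w T)%N -> kap (i + k)%N (knot T w (i + k)) *m v = 0.
  by have := H (w T - i)%N; rewrite subnKC//; apply.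
elim: k => [|k IH]; first by rewrite addn0.
rewrite addnS => ikT.
rewrite (skeleton_tangent_jump sk ikT) mulmxDl -mulmxA step ?mulmx0 ?addr0//.
  exact: ltnW.
by apply: IH; exact: ltnW.
Qed.

End skeleton_invertible.

Section jump_expansion.
Context {R : realType} {d : nat}.
Variables (T : R) (g : R -> 'cV[R]_d -> 'cV[R]_d) (delta : nat -> R).
Hypothesis delta_gt0 : forall k, 0 < delta k.
Hypothesis delta_cvg : delta k @[k --> \oo] --> 0.
Hypothesis g_diff : forall v x, 0 <= v <= T -> differentiable (g v) x.

(** The increment is split at [g (s k) x]: the time part is the derivative of [g^~ x], the space
    part is taken at time [s k]. The last hypothesis lets the Jacobian at [(t, x)] replace those at
    time [s k] near [x]. *)
Lemma jump_expansion t x (s : nat -> R) (y : nat -> 'cV[R]_d) :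
  derivable_within `[0, T] (g^~ x) t ->
  (forall k, 0 <= s k <= T) -> (forall k, `|s k - t| <= delta k) ->
  bigo delta (fun k => y k - x) ->
  (forall e, 0 < e -> exists2 r, 0 < r & \forall k \near \oo,
     forall z, `|z - x| <= r -> `|jac (g (s k)) z - jac (g t) x| <= e) ->
  smallo delta (fun k => g (s k) (y k) - g t x -
    (jac (g t) x *m (y k - x) + (s k - t) *: derive_within `[0, T] (g^~ x) t)).
Proof.
move=> gt sT st yx gj.
have delta_ge0 k : 0 <= delta k by exact: ltW.
have sc : s k @[k --> \oo] --> t.
  apply/cvgrPdist_le => e e0; have /cvgrPdist_le/(_ _ e0) := delta_cvg.
  apply: filterS => k; rewrite sub0r normrN ger0_norm// distrC.
  exact: le_trans.
have S1 : smallo delta (fun k => g (s k) x - g t x -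
    (s k - t) *: derive_within `[0, T] (g^~ x) t).
  move=> e e0; have := sc _ (near_derive_within e0 gt).
  rewrite /nbhs/=; apply: filterS => k /= /(_ _) h.
  apply: (le_trans (h _)); first by rewrite in_itv/=.
  by rewrite ler_wpM2l// ltW.
have S2 : smallo delta (fun k => g (s k) (y k) - g (s k) x - jac (g t) x *m (y k - x)).
  have [D D0 yD] := bigo_pos delta_ge0 yx.
  move=> e e0; have d1 : 0 < (d%:R + 1) * D by rewrite mulr_gt0// ltr_wpDl.
  have [r r0 gr] := gj _ (divr_gt0 e0 d1).
  have ysmall := bigo_cvg delta_ge0 delta_cvg yx r0.
  apply: filterS3 gr ysmall yD => k gk yk yDk.
  have e1 : 0 <= e / ((d%:R + 1) * D) by rewrite ltW// divr_gt0.
  have := @jac_increment_le _ _ (g (s k)) (jac (g t) x) x (y k) _ e1.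
  move=> /(_ _ _)/le_trans; apply.
  - by move=> z; exact: g_diff.
  - move=> q /andP[q0 q1]; apply: gk; rewrite addrC addKr normrZ ger0_norm//.
    by apply: le_trans yk; rewrite ler_piMl.
  apply: (@le_trans _ _ ((d%:R + 1) * (e / ((d%:R + 1) * D)) * (D * delta k))).
    apply: ler_pM => //; first exact: mulr_ge0.
    by rewrite ler_wpM2r// lerDl.
  suff -> : (d%:R + 1) * (e / ((d%:R + 1) * D)) * (D * delta k) = e * delta k by [].
  by field; rewrite !gt_eqF// ltr_wpDl.
apply: eq_smallo (smalloD S1 S2); apply: nearW => k; mx_ring.
Qed.

End jump_expansion.

(** * Propagation of the expansion from knot to knot *)

Section path_expansion.
Context {R : realType} {d : nat}.
Notation mu := (@lebesgue_measure R).
Variables (T C : R) (f g : R -> 'cV[R]_d -> 'cV[R]_d).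
Hypothesis T0 : 0 <= T.
Hypothesis C0 : 0 <= C.
Hypothesis f_meas : @measurable_fun _ _ (borel (R * 'cV[R]_d)%type)
  (borel 'cV[R]_d) (`[0, T] `*` setT) (fun tx => f tx.1 tx.2).
Hypothesis f_diff : forall v x, 0 <= v <= T -> differentiable (f v) x.
Hypothesis f_jac : forall v x, 0 <= v <= T -> `|jac (f v) x| <= C.
Hypothesis f_int : forall x, mx_integrable `[0, T] (fun v => f v x).
Hypothesis g_diff : forall v x, 0 <= v <= T -> differentiable (g v) x.
Hypothesis g_der : forall x t, 0 <= t <= T -> derivable_within `[0, T] (g^~ x) t.

Variables (delta : nat -> R) (w : counting_path R) (wk : nat -> counting_path R).
Hypothesis delta_gt0 : forall k, 0 < delta k.
Hypothesis delta_cvg : delta k @[k --> \oo] --> 0.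
Hypothesis wkT : forall k, wk k T = w T.
Notation tau := (knot T w).
Notation tauk k := (knot T (wk k)).
Hypothesis tau_dist : forall k i, (i < w T)%N -> `|tauk k i.+1 - tau i.+1| <= delta k.
Hypothesis tau_leb : forall i, (i < w T)%N -> drift_lebesgue_point T f (tau i.+1).
Hypothesis tau_last : tau (w T) < T.

Variables (x0 : 'cV[R]_d) (X : R -> 'cV[R]_d) (K : R -> 'M[R]_d).
Variables (Xk : nat -> R -> 'cV[R]_d) (Kk : nat -> R -> 'M[R]_d).
Variables (z : nat -> R -> 'cV[R]_d) (kap : nat -> R -> 'M[R]_d).
Variables (zk : nat -> nat -> R -> 'cV[R]_d) (kapk : nat -> nat -> R -> 'M[R]_d).
Hypothesis sk : path_skeleton T w f g x0 X K z kap.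
Hypothesis skk : forall k, path_skeleton T (wk k) f g x0 (Xk k) (Kk k) (zk k) (kapk k).
Hypothesis KT : K T \in unitmx.
Hypothesis jac_near : forall i, (i < w T)%N -> forall e, 0 < e ->
  exists2 r, 0 < r & \forall k \near \oo, forall x, `|x - z i (tau i.+1)| <= r ->
    `|jac (g (tauk k i.+1)) x - jac (g (tau i.+1)) (z i (tau i.+1))| <= e.

Let delta_ge0 k : 0 <= delta k. Proof. exact: ltW. Qed.

Let tau_distance k i : (i <= (w T).+1)%N -> `|tauk k i - tau i| <= delta k.
Proof.
case: i => [|i]; first by rewrite subrr normr0.
rewrite ltnS leq_eqVlt => /orP[/eqP ->|]; last exact: tau_dist.
by rewrite knot_last -(wkT k) knot_last subrr normr0.
Qed.

Let osc_small i x : (i <= (w T).+1)%N -> smallo delta (fun k =>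
  osc f x (tau i) (Num.min (tau i) (tauk k i)) (Num.max (tau i) (tauk k i))).
Proof.
move=> iT.
(* This covers the knots [0] and [T], which are the same for all paths: the interval is then a
   point. *)
have triv : (forall k, tauk k i = tau i) -> smallo delta (fun k =>
    osc f x (tau i) (Num.min (tau i) (tauk k i)) (Num.max (tau i) (tauk k i))).
  move=> E; apply: eq_smallo (smallo0 delta_ge0 _); apply: nearW => k.
  by rewrite E minxx maxxx /osc set_itv1 Rintegral_set1.
case: i iT triv => [|i]; first by move=> _; apply.
rewrite ltnS leq_eqVlt => /orP[/eqP -> triv|iT _].
  by apply: triv => k; rewrite knot_last -(wkT k) knot_last.
apply: tau_leb => //; last by move=> k; apply: tau_distance; exact: ltnW.
by move=> k; rewrite knot_ge0// knot_le.
Qed.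

(** [D i k] compares the two paths at their own [i]-th knots; [Er i k] corrects it for the drift
    during the shift of the knot. [S i k] adds up the effects of the earlier jumps, pulled back to
    time 0 by [invmx (M j.+1)]. The invariant is [Er i k = - M i *m S i k] up to o(delta). *)
Let M i := kap i (tau i).
Let h i k := tauk k i.+1 - tau i.+1.
Let Vphi i := phi T f g (tau i.+1) (z i (tau i.+1)).
Let D i k := zk k i (tauk k i) - z i (tau i).
Let Er i k := D i k - (tauk k i - tau i) *: f (tau i) (z i (tau i)).
Let S i k := \sum_(j < i) invmx (M j.+1) *m (h j k *: Vphi j).

Let M_unit i : (i <= w T)%N -> M i \in unitmx.
Proof. exact: (skeleton_unit T0 C0 f_jac sk KT). Qed.

Let bigo_tau i : (i <= (w T).+1)%N -> bigo delta (fun k => tauk k i - tau i).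
Proof. by move=> iT; exists 1; apply: nearW => k; rewrite mul1r; exact: tau_distance. Qed.

Let S_bigo i : (i <= w T)%N -> bigo delta (S i).
Proof.
move=> iT.
have bs : forall j : 'I_i, bigo delta (fun k => invmx (M j.+1) *m (h j k *: Vphi j)).
  move=> j; apply: bigo_mulmx; apply: bigo_scale; apply: bigo_tau.
  by rewrite ltnS (leq_trans (ltnW (ltn_ord j))).
exact: (bigo_sum delta_ge0).
Qed.

Let D_bigo i : (i <= w T)%N -> smallo delta (fun k => Er i k + M i *m S i k) ->
  bigo delta (D i).
Proof.
move=> iT sE.
have := bigoD (bigoB (smallo_bigo sE) (bigo_mulmx (M i) (S_bigo iT)))
  (bigo_scale (f (tau i) (z i (tau i))) (bigo_tau (leqW iT))).
apply: eq_bigo; apply: nearW => k; rewrite /Er; mx_ring.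
Qed.

Let piece_expansion i : (i <= w T)%N -> tau i < tau i.+1 ->
  smallo delta (fun k => Er i k + M i *m S i k) ->
  smallo delta (fun k => zk k i (tauk k i.+1) - z i (tau i.+1) -
    (kap i (tau i.+1) *m (invmx (M i) *m Er i k) +
     (tauk k i.+1 - tau i.+1) *: f (tau i.+1) (z i (tau i.+1)))).
Proof.
move=> iT it sE.
apply: (@flow_expansion _ _ T C f C0 f_meas f_diff f_jac f_int delta delta_gt0 delta_cvg
  (tau i) (tau i.+1) (z i) (kap i) (fun k => tauk k i) (fun k => tauk k i.+1)
  (fun k => zk k i)) => //.
- exact: knot_ge0.
- exact: knot_le.
- exact: (skeleton_flow sk).
- exact: (skeleton_tangent sk).
- exact: M_unit.
- move=> k; split; [exact: knot_ge0| |exact: knot_le|].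
    by apply: knot_le_succ => //; rewrite wkT.
  by apply: (skeleton_flow (skk k)); rewrite wkT.
- by move=> k; apply: tau_distance; exact: leqW.
- by move=> k; exact: tau_distance.
- exact: D_bigo sE.
- by move=> x; apply: osc_small; exact: leqW.
- by move=> x; exact: osc_small.
Qed.

(** This is where [phi] appears. Before the jump the displacement contains [h i k] times the drift
    at [x]; the jump multiplies it by [1%:M + J] and adds [h i k] times the time derivative of [g];
    the correction in [Er i.+1 k] subtracts [h i k] times the drift at [x + g t x]. The sum of the
    three is [- h i k *: Vphi i]. *)
Let knot_expansion i : (i <= w T)%N -> smallo delta (fun k => Er i k + M i *m S i k).
Proof.
elim: i => [_|i IH iT].
  apply: eq_smallo (smallo0 delta_ge0 _); apply: nearW => k.
  rewrite /Er /D /S big_ord0 mulmx0 addr0 /= subrr scale0r subr0.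
  by rewrite (skeleton_start sk) (skeleton_start (skk k)) subrr.
have iT' := ltnW iT; have sE := IH iT'.
set t := tau i.+1; set x := z i t.
pose y k := zk k i (tauk k i.+1); pose J := jac (g t) x.
have s1 := piece_expansion iT' (knot_lt iT) sE.
have by_ : bigo delta (fun k => y k - x).
  have b1 := bigo_mulmx (kap i t) (bigo_mulmx (invmx (M i)) (bigoB (D_bigo iT' sE)
    (bigo_scale (f (tau i) (z i (tau i))) (bigo_tau (leqW iT'))))).
  have b2 := bigo_scale (f t x) (bigo_tau (leqW iT)).
  apply: eq_bigo (bigoD (smallo_bigo s1) (bigoD b1 b2)).
  by apply: nearW => k; rewrite /y /x /t /Er; mx_ring.
have t01 : 0 <= t <= T by rewrite knot_ge0// knot_le.
have s2 : smallo delta (fun k => g (tauk k i.+1) (y k) - g t x -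
    (J *m (y k - x) + (tauk k i.+1 - t) *: derive_within `[0, T] (g^~ x) t)).
  apply: jump_expansion => //.
  - exact: g_der.
  - by move=> k; rewrite knot_ge0// knot_le.
  - by move=> k; apply: tau_distance; exact: leqW.
  - exact: jac_near.
have s3 := smallo_mulmx (1%:M + J) s1.
have s4 := smallo_mulmx (M i.+1) (smallo_mulmx (invmx (M i)) sE).
apply: eq_smallo (smalloD (smalloD s2 s3) s4); apply: nearW => k.
have MS : M i.+1 = (1%:M + J) *m kap i t.
  by rewrite /M (skeleton_tangent_jump sk iT) mulmxDl mul1mx.
have zS : z i.+1 t = x + g t x by rewrite (skeleton_jump sk iT).
have zkS : zk k i.+1 (tauk k i.+1) = y k + g (tauk k i.+1) (y k).
  by rewrite (skeleton_jump (skk k)) ?wkT.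
have -> : M i.+1 *m S i.+1 k = M i.+1 *m S i k + h i k *: Vphi i.
  rewrite /S big_ord_recr/= mulmxDr mulmxA mulmxV ?mul1mx//; exact: M_unit.
have -> : M i.+1 *m (invmx (M i) *m (Er i k + M i *m S i k)) =
    (1%:M + J) *m (kap i t *m (invmx (M i) *m Er i k)) + M i.+1 *m S i k.
  move: (Er i k) (S i k) => e s; rewrite !mulmxDr; congr (_ + _); first by rewrite MS -mulmxA.
  by rewrite [invmx _ *m (_ *m _)]mulmxA mulVmx ?mul1mx//; exact: M_unit.
rewrite /Er -/t /D -/t zS zkS -/x /Vphi /phi -/t -/x -/J /h -/t.
rewrite -/(y k); move: (kap i t *m _) => e; set u := y k - x.
rewrite [_ *m (u - _)]mulmxBr [_ *m (e + _)]mulmxDr -scalemxAr.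
rewrite [(1%:M + J) *m u]mulmxDl mul1mx /u.
mx_ring.
Qed.

Lemma terminal_expansion : smallo delta (fun k => Xk k T - X T +
  \sum_(i < w T) (knot T (wk k) i.+1 - knot T w i.+1) *:
    (K T *m invmx (K (knot T w i.+1)) *m
       phi T f g (knot T w i.+1) (z i (knot T w i.+1)))).
Proof.
have sE := knot_expansion (leqnn _).
have s1 : smallo delta (fun k => Xk k T - X T - K T *m (invmx (M (w T)) *m Er (w T) k)).
  (* The last knot [T] does not move, so no drift correction remains; [tau_last] makes the last
     piece nondegenerate. *)
  have := piece_expansion (leqnn _); rewrite knot_last => /(_ tau_last sE).
  rewrite (skeleton_end sk) (skeleton_tangent_end sk); apply: eq_smallo; apply: nearW => k.
  rewrite -(wkT k) knot_last (skeleton_end (skk k)) subrr scale0r addr0; congr (_ - _).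
have s2 := smallo_mulmx (K T) (smallo_mulmx (invmx (M (w T))) sE).
apply: eq_smallo (smalloD s1 s2); apply: nearW => k.
rewrite !mulmxDr [invmx _ *m (_ *m _)]mulmxA mulVmx ?mul1mx; last exact: M_unit.
rewrite addrA subrK; congr (_ + _); rewrite mulmx_sumr; apply: eq_bigr => i _.
by rewrite -scalemxAr -scalemxAr mulmxA /M (skeleton_tangent_knot sk).
Qed.

End path_expansion.

(** * Localization and conclusion *)

(* A statement about convergent sequences becomes uniform on countably many pieces when
   convergence is tested on countably many predicates [B]. *)
Lemma countable_localization (W : Type) (I : countType) (B : I -> set W) (S : set W)
    (bad : W -> nat -> W -> Prop) :
  (forall w wk, S w -> (forall k, S (wk k)) ->
     (forall c, B c w -> \forall k \near \oo, B c (wk k)) ->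
     (forall k, bad w k (wk k)) -> False) ->
  exists Sm : nat -> set W, S `<=` \bigcup_m Sm m /\
    forall m, Sm m `<=` S /\ exists j, forall w w', Sm m w -> Sm m w' -> ~ bad w j w'.
Proof.
move=> nobad.
pose Sm (s : seq I) (j : nat) : set W := [set w | [/\ S w, forall c, c \in s -> B c w &
  forall w', S w' -> (forall c, c \in s -> B c w') -> ~ bad w j w']].
pose code m := if @unpickle (seq I * nat)%type m is Some sj then Sm sj.1 sj.2 else set0.
exists code; split => [w Sw|m]; last first.
  rewrite /code; case: unpickle => [[s j]|]; last by split => //; exists 0%N.
  split; first by move=> w [].
  exists j => w w' [_ _ h] [Sw' Bw' _]; exact: h.
suff [s [j sj]] : exists s j, Sm s j w by exists (pickle (s, j)) => //; rewrite /code pickleK.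
apply: contrapT => no_piece.
(* If [w] lies in no piece, then for each [k] the predicates true at [w] among the first [k] codes
   do not exclude a bad partner [wk k]; these partners form a forbidden sequence. *)
pose s k : seq I := [seq c <- pmap unpickle (iota 0 k) | `[< B c w >]].
have /choice[wk wkP] : forall k, exists w', [/\ S w', forall c, c \in s k -> B c w' & bad w k w'].
  move=> k; apply: contrapT => H; apply: no_piece; exists (s k), k; split => //.
    by move=> c; rewrite mem_filter => /andP[/asboolP].
  by move=> w' Sw' Bw' bw'; apply: H; exists w'.
apply: (nobad w wk Sw) => [k|c Bc|k]; [by case: (wkP k)| |by case: (wkP k)].
exists (pickle c).+1 => // k /= ck; have [_ + _] := wkP k; apply.
rewrite mem_filter; apply/andP; split; first exact/asboolP.
by rewrite mem_pmap; apply/mapP; exists (pickle c); rewrite ?mem_iota ?pickleK.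
Qed.

(** A row vector orthogonal to all [v i] is a linear form vanishing on their span, hence 0. So the
    matrix with rows [(v i)^T] has rank [d], and [d] independent rows can be extracted. *)
Lemma spanning_selection (F : fieldType) (d n : nat) (v : 'I_n -> 'cV[F]_d) :
  (<<[seq v i | i : 'I_n]>> = fullv)%VS ->
  exists2 sel : {ffun 'I_d -> 'I_n}, injective sel &
    \matrix_(a, b) v (sel b) a 0 \in unitmx.
Proof.
move=> vspan; pose A : 'M[F]_(n, d) := \matrix_(i, a) v i a 0.
have rowA i : row i A = (v i)^T by apply/rowP => a; rewrite !mxE.
have Afree : row_free A^T.
  apply: inj_row_free => r rA.
  have rv i : r *m v i = 0.
    have := congr1 (col i) rA; rewrite col0 colE -mulmxA -colE => <-; congr (_ *m _).
    by apply/colP => a; rewrite !mxE.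
  have : (fullv <= lker (linfun (mulmx r : 'cV[F]_d -> 'M[F]_1)))%VS.
    rewrite -vspan; apply/span_subvP => u /mapP[i _ ->].
    by rewrite memv_ker lfunE/= rv.
  move=> /subvP H; apply/rowP => a; rewrite mxE.
  have := H (delta_mx a 0) (memvf _); rewrite memv_ker lfunE/= => /eqP/matrixP/(_ 0 0).
  by rewrite -colE !mxE.
have rA : row_full A by rewrite /row_full -mxrank_tr.
exists (fullrankfun rA); first exact: fullrankfun_inj.
rewrite -unitmx_tr; have := fullrowsub_full rA; rewrite row_full_unit.
by congr (_ \in unitmx); apply/matrixP => a b; rewrite !mxE.
Qed.

(** * Pieces on which the jump times are Lipschitz *)

Section localization.
Context {R : realType} {d : nat}.
Notation mu := (@lebesgue_measure R).
Variables (T C : R) (f g : R -> 'cV[R]_d -> 'cV[R]_d).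
Hypothesis T0 : 0 <= T.
Hypothesis C0 : 0 <= C.
Hypothesis f_meas : @measurable_fun _ _ (borel (R * 'cV[R]_d)%type)
  (borel 'cV[R]_d) (`[0, T] `*` setT) (fun tx => f tx.1 tx.2).
Hypothesis f_diff : forall v x, 0 <= v <= T -> differentiable (f v) x.
Hypothesis f_jac : forall v x, 0 <= v <= T -> `|jac (f v) x| <= C.
Hypothesis f_int : forall x, mx_integrable `[0, T] (fun v => f v x).
Hypothesis g_diff : forall v x, 0 <= v <= T -> differentiable (g v) x.
Hypothesis g_jac_continuous : forall v, 0 <= v <= T -> continuous (jac (g v)).
Hypothesis g_der : forall x t, 0 <= t <= T -> derivable_within `[0, T] (g^~ x) t.

(* [inl (b, i, q)] compares the [i]-th jump time with the rational [q];
   [inr (i, (q, r), (Q, e))] says that the Jacobian of [g] at the [i]-th jump time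
   maps the ball of center [q] and radius [r] into the ball of center [Q] and radius [e]. *)
Definition code : countType :=
  ((bool * nat * rat) + (nat * ('cV[rat]_d * rat) * ('M[rat]_d * rat)))%type.

Definition code_holds (c : code) (w : counting_path R) : Prop :=
  match c with
  | inl (true, i, q) => jump w i < ratr q
  | inl (false, i, q) => ratr q < jump w i
  | inr (i, (q, r), (Q, e)) => forall x, `|x - map_mx ratr q| <= ratr r ->
      `|jac (g (jump w i)) x - map_mx ratr Q| <= ratr e
  end.

Lemma small_rational (rho : R) : 0 < rho -> exists r : rat, [/\ 0 < ratr r :> R,
  0 < ratr r / 2 :> R, ratr r / 2 + ratr r < rho & ratr r / 2 + ratr r / 2 <= ratr r :> R].
Proof.
move=> rho0; have /rat_in_itvoo[r] : 0 < rho / 2 by rewrite divr_gt0.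
by rewrite in_itv/= => /andP[r0 r1]; exists r; split; lra.
Qed.

Section code_convergence.
Variables (w : counting_path R) (wk : nat -> counting_path R).
Hypothesis wk_codes : forall c, code_holds c w -> \forall k \near \oo, code_holds c (wk k).

Lemma code_jump_cvg i (e : R) : 0 < e ->
  \forall k \near \oo, `|jump (wk k) i - jump w i| <= e.
Proof.
move=> e0.
have /rat_in_itvoo[q1] : jump w i - e < jump w i by lra.
rewrite in_itv/= => /andP[h1 h2].
have /rat_in_itvoo[q2] : jump w i < jump w i + e by lra.
rewrite in_itv/= => /andP[h3 h4].
have := wk_codes (c := inl (true, i, q2)) h3.
apply: filterS2 (wk_codes (c := inl (false, i, q1)) h2) => k /= h5 h6.
by rewrite ler_norml; apply/andP; split; lra.
Qed.

(** By continuity of the Jacobian at the fixed time [jump w i], a small ball with rational data is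
    mapped into a ball with rational data. This is a code satisfied by [w], hence by [wk k]
    eventually. *)
Lemma code_jac_near i x (e : R) : 0 <= jump w i <= T -> 0 < e ->
  exists2 r, 0 < r & \forall k \near \oo, forall y, `|y - x| <= r ->
    `|jac (g (jump (wk k) i)) y - jac (g (jump w i)) x| <= e.
Proof.
move=> iT e0.
have e4 : 0 < e / 4 by rewrite divr_gt0.
(* The radius [e'] must absorb the continuity error and that of the rational center [Q], [e / 4]
   each, and leave [e / 4] to return from [Q] to the Jacobian at [x]. *)
have /rat_in_itvoo[e'] : e / 2 < 3 / 4 * e by lra.
rewrite in_itv/= => /andP[e'1 e'2].
have he1 : e / 4 + e / 4 <= ratr e' by lra.
have he2 : ratr e' + e / 4 <= e by lra.
have /cvgrPdist_le/(_ _ e4)/nbhs_normP[rho rho0 hrho] := g_jac_continuous iT (x := x).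
have [Q QJ] := rational_matrix_dense (jac (g (jump w i)) x) e4.
have [r [r0 r2 r3 r4]] : exists r : rat, [/\ 0 < ratr r :> R, 0 < ratr r / 2 :> R,
    ratr r / 2 + ratr r < rho & ratr r / 2 + ratr r / 2 <= ratr r :> R].
  exact: small_rational.
have [q qx] := rational_matrix_dense x r2.
exists (ratr r / 2) => //.
have cw : code_holds (inr (i, (q, r), (Q, e'))) w.
  move=> y yq /=.
  have yx : `|x - y| < rho.
    apply: (le_lt_trans (ler_distD (map_mx ratr q) _ _)); apply: le_lt_trans r3.
    by rewrite distrC [`|_ - y|]distrC; exact: lerD.
  have := hrho y yx; rewrite /= distrC => yJ.
  apply: (le_trans (ler_distD (jac (g (jump w i)) x) _ _)); apply: le_trans he1.
  by rewrite [X in _ + X]distrC; exact: lerD.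
apply: filterS (wk_codes cw) => k /= hk y yx.
have yq : `|y - map_mx ratr q| <= ratr r.
  apply: (le_trans (ler_distD x _ _)); apply: le_trans r4.
  by rewrite [X in _ + X]distrC; exact: lerD.
apply: (le_trans (ler_distD (map_mx ratr Q) _ _)); apply: le_trans he2.
by apply: lerD => //; exact: hk.
Qed.

End code_convergence.

Variables (n : nat) (x0 : 'cV[R]_d).
Variables (X : R -> counting_path R -> 'cV[R]_d) (K : R -> counting_path R -> 'M[R]_d).
Variables (z : counting_path R -> nat -> R -> 'cV[R]_d).
Variables (kap : counting_path R -> nat -> R -> 'M[R]_d).

Definition regular_path (w : counting_path R) : Prop :=
  [/\ w T = n, path_skeleton T w f g x0 (X^~ w) (K^~ w) (z w) (kap w), K T w \in unitmx,
      forall i, (i < n)%N -> drift_lebesgue_point T f (jump w i) & knot T w n < T].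

(* Minus the derivative of [X_T] with respect to the [i]-th jump time. *)
Definition response w i : 'cV[R]_d :=
  transition K (jump w i) T w *m phi T f g (jump w i) (z w i (jump w i)).

Variable sel : {ffun 'I_d -> 'I_n}.
Hypothesis sel_inj : injective sel.

Definition selected_paths : set (counting_path R) := [set w | regular_path w /\
  \matrix_(a, b) response w (sel b) a 0 \in unitmx].

(* The [d] jump times selected by [sel] are replaced by the coordinates of [X_T]. *)
Definition mixed_coordinates w (i : 'I_n) : R :=
  if [pick c | sel c == i] is Some c then X T w c 0 else jump w i.

Lemma mixed_coordinates_sel w c : mixed_coordinates w (sel c) = X T w c 0.
Proof.
rewrite /mixed_coordinates; case: pickP => [c' /eqP/sel_inj -> //|/(_ c)].
by rewrite eqxx.
Qed.

Lemma mixed_coordinates_jump w i : i \notin codom sel -> mixed_coordinates w i = jump w i.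
Proof.
move=> ic; rewrite /mixed_coordinates; case: pickP => // c /eqP ci.
by case/negP: ic; rewrite -ci codom_f.
Qed.

(** A violation of the Lipschitz bound with constant [j.+1] for the jump times as functions of the
    mixed coordinates. *)
Definition expanding_pair w (j : nat) w' : Prop := exists (e : R) (i : 'I_n),
  (forall a, `|mixed_coordinates w a - mixed_coordinates w' a| <= e) /\
  j.+1%:R * e < `|jump w i - jump w' i|.

(** The mixed coordinates move by o(delta), hence so do X_T and the unselected jump times. The
    expansion then bounds [V] applied to the displacements of the selected jump times by o(delta),
    and inverting [V] gives [delta] = o(delta), absurd since [delta] is positive. *)
Lemma no_expanding_sequence w wk : selected_paths w -> (forall k, selected_paths (wk k)) ->
  (forall c, code_holds c w -> \forall k \near \oo, code_holds c (wk k)) ->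
  (forall k, expanding_pair w k (wk k)) -> False.
Proof.
move=> [[wT sk KT leb lastT] Vu] Swk cw bad.
have wkT k : wk k T = w T by rewrite wT; have [[]] := Swk k.
have skk k : path_skeleton T (wk k) f g x0 (X^~ (wk k)) (K^~ (wk k)) (z (wk k)) (kap (wk k)).
  by have [[]] := Swk k.
pose h (i : 'I_n) k := jump (wk k) i - jump w i.
pose delta k := \sum_(i < n) `|h i k|.
have hd k i : `|h i k| <= delta k by rewrite /delta (bigD1 i)//= lerDl sumr_ge0.
have ek k : exists e, [/\ 0 <= e, k.+1%:R * e < delta k &
    forall a, `|mixed_coordinates (wk k) a - mixed_coordinates w a| <= e].
  have [e [i [he hi]]] := bad k; exists e; split => [||a].
  - exact: le_trans (he i).
  - by apply: lt_le_trans hi _; rewrite distrC; exact: hd.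
  - by rewrite distrC.
have delta_gt0 k : 0 < delta k.
  have [e [e0 + _]] := ek k; apply: le_lt_trans; exact: mulr_ge0.
have delta_ge0 k : 0 <= delta k by exact: ltW.
have delta_cvg : delta k @[k --> \oo] --> 0.
  have hc (i : 'I_n) : `|h i k| @[k --> \oo] --> (0 : R).
    apply/cvgrPdist_le => e e0; apply: filterS (code_jump_cvg cw i e0) => k.
    by rewrite sub0r normrN normr_id.
  rewrite (_ : (0 : R) = \sum_(i < n) 0); last by rewrite big1.
  by apply: cvg_big => //; exact: add_continuous.
(* Each mixed coordinate moves by less than [delta k / k.+1]. *)
have dG a : smallo delta (fun k => mixed_coordinates (wk k) a - mixed_coordinates w a).
  move=> e e0.
  near=> k; have [e' [e'0 e'd /(_ a)/le_trans]] := ek k; apply.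
  have ke : 1 <= e * k.+1%:R.
    rewrite mulrC -ler_pdivrMr// div1r.
    near: k; exists (Num.truncn e^-1) => // k /= hk.
    apply: ltW; apply: (lt_le_trans (truncnS_gt _)); by rewrite ler_nat.
  have : e' <= e * (k.+1%:R * e') by rewrite mulrA ler_peMl.
  by move=> /le_trans; apply; rewrite ler_wpM2l ?ltW.
have iT (i : 'I_n) : (i < w T)%N by rewrite wT.
have expansion : smallo delta (fun k => X T (wk k) - X T w +
    \sum_(i < n) h i k *: response w i).
  have E := @terminal_expansion _ _ T C f g T0 C0 f_meas f_diff f_jac f_int g_diff g_der
    delta w wk delta_gt0 delta_cvg wkT.
  have {E} := E _ _ _ x0 (X^~ w) (K^~ w) (fun k => X^~ (wk k)) (fun k => K^~ (wk k))
    (z w) (kap w) (fun k => z (wk k)) (fun k => kap (wk k)) sk skk KT.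
  move=> /(_ _ _ _ _)/eq_smallo; apply.
  - apply: nearW => k; congr (_ + _).
    pose F i := (jump (wk k) i - jump w i) *: response w i.
    rewrite -[RHS](big_mkord xpredT F) -[in RHS]wT big_mkord; apply: eq_bigr => i _.
    by rewrite !knot_jump ?wkT.
  - move=> k i iw; rewrite !knot_jump ?wkT//.
    have i_n : (i < n)%N by rewrite -wT.
    exact: (hd k (Ordinal i_n)).
  - by move=> i iw; rewrite knot_jump//; apply: leb; rewrite -wT.
  - by rewrite wT.
  - move=> i iw e e0; rewrite knot_jump//.
    have jT : 0 <= jump w i <= T by rewrite (ltW (jump_gt0 iw)) jump_le.
    have [r r0 hr] := code_jac_near cw (z w i (jump w i)) jT e0.
    exists r; first exact: r0.
    apply: filterS hr => k hk x xr; rewrite knot_jump; last by rewrite wkT.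
    exact: hk xr.
have dX : smallo delta (fun k => X T (wk k) - X T w).
  have s1 c : smallo delta (fun k => (X T (wk k) - X T w) c 0 *: (delta_mx c 0 : 'cV[R]_d)).
    apply: (smallo_dominated (c := `|delta_mx c 0 : 'cV[R]_d|) _ (dG (sel c))).
    by apply: nearW => k; rewrite normrZ !mixed_coordinates_sel !mxE mulrC.
  apply: eq_smallo (smallo_sum delta_ge0 (index_enum 'I_d) xpredT s1).
  apply: nearW => k; rewrite [RHS]matrix_sum_delta; apply: eq_bigr => c _.
  by rewrite big_ord1.
have h_jump (i : 'I_n) : i \notin codom sel -> smallo delta (h i).
  move=> ic; apply: eq_smallo (dG i); apply: nearW => k.
  by rewrite !mixed_coordinates_jump.
pose V := \matrix_(a, b) response w (sel b) a 0.
have h_sel : smallo delta (fun k => V *m \col_c h (sel c) k).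
  have s1 : smallo delta (fun k => \sum_(i < n | i \notin codom sel) h i k *: response w i).
    rewrite (_ : (fun k => _) = fun k => \sum_(i < n)
        (if i \notin codom sel then h i k *: response w i else 0)); last first.
      by apply/funext => k; rewrite big_mkcond.
    apply: smallo_sum => // i; case ic: (i \notin codom sel); last exact: smallo0.
    apply: (smallo_dominated (c := `|response w i|) _ (h_jump i ic)).
    by apply: nearW => k; rewrite normrZ mulrC.
  apply: eq_smallo (smalloB (smalloB expansion dX) s1); apply: nearW => k.
  rewrite [X in X - _]addrAC subrr add0r (bigID (mem (codom sel)))/= addrK.
  rewrite -big_uniq; last by rewrite map_inj_uniq ?enum_uniq.
  rewrite big_map big_enum; apply/colP => a; rewrite summxE mxE.
  by apply: eq_bigr => c _; rewrite !mxE mulrC.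
have h_small (i : 'I_n) : smallo delta (h i).
  have [/codomP[c ->]|] := boolP (i \in codom sel); last exact: h_jump.
  apply: (smallo_dominated (c := 1) _ (smallo_mulmx (invmx V) h_sel)).
  apply: nearW => k; rewrite mulmxA mulVmx// mul1mx mul1r.
  by have := mx_norm_coord (\col_c h (sel c) k) c 0; rewrite mxE.
have : smallo delta delta.
  have s1 (i : 'I_n) : smallo delta (fun k => `|h i k|).
    by move=> e /(h_small i); apply: filterS => k; rewrite normr_id.
  exact: (smallo_sum delta_ge0 (index_enum 'I_n) xpredT s1).
have half : 0 < 2^-1 :> R by rewrite invr_gt0.
move=> /(_ _ half)/filter_ex[k]; rewrite ger0_norm//.
have := delta_gt0 k; lra.
Unshelve. all: by end_near. Qed.

End localization.

(** * Covering argument and conclusion *)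

Lemma bigprod_selection (R : comRingType) (d n : nat) (sel : {ffun 'I_d -> 'I_n})
    (u : 'I_d -> R) (c : R) : injective sel ->
  \prod_(i < n) (if [pick a | sel a == i] is Some a then u a else c) =
  (\prod_(a < d) u a) * \prod_(i < n | i \notin codom sel) c.
Proof.
move=> sel_inj; rewrite (bigID (mem (codom sel)))/=; congr (_ * _); last first.
  apply: eq_bigr => i ic; case: pickP => // a /eqP ai.
  by case/negP: ic; rewrite -ai codom_f.
rewrite -big_uniq; last by rewrite map_inj_uniq ?enum_uniq.
rewrite big_map big_enum; apply: eq_bigr => a _.
by case: pickP => [b /eqP/sel_inj -> //|/(_ a)]; rewrite eqxx.
Qed.

Section negligible.
Context {R : realType} {d : nat}.

Lemma null_box_cover (A : set 'cV[R]_d) (e : R) : @lebesgue_cV R d A = 0%E -> 0 < e ->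
  exists2 ab : nat -> 'cV[R]_d * 'cV[R]_d, A `<=` \bigcup_k box (ab k) &
    (\sum_(0 <= k <oo) (box_volume (ab k))%:E < e%:E)%E.
Proof.
move=> A0 e0; have : (@lebesgue_cV R d A < e%:E)%E by rewrite A0 lte_fin.
by move=> /ereal_inf_lt[_ [ab Aab <-] vol]; exists ab.
Qed.

(** The selected coordinates are covered by boxes around [A] and each remaining jump time by
    [[0, T]]. This multiplies volumes by the constant [c0], so boxes of total volume below [e / c0]
    are taken. *)
Lemma mixed_cover (A : set 'cV[R]_d) (n : nat) (sel : {ffun 'I_d -> 'I_n}) (T e : R)
    (X : R -> counting_path R -> 'cV[R]_d) :
  0 < T -> injective sel -> @lebesgue_cV R d A = 0%E -> 0 < e ->
  exists lo l : nat -> 'I_n -> R,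
    [/\ forall k i, 0 <= l k i,
        forall w : counting_path R, w T = n -> A (X T w) ->
          exists k, forall i, lo k i <= mixed_coordinates T X sel w i <= lo k i + l k i &
        (\sum_(0 <= k <oo) (\prod_i l k i)%:E <= e%:E)%E].
Proof.
move=> T0 sel_inj A0 e0.
pose c0 : R := \prod_(i < n | i \notin codom sel) T.
have c00 : 0 < c0 by exact: prodr_gt0.
have [ab Aab vol] := null_box_cover A0 (divr_gt0 e0 c00).
exists (fun k i => if [pick c | sel c == i] is Some c then (ab k).1 c 0 else 0).
exists (fun k i => if [pick c | sel c == i] is Some c
  then Num.max 0 ((ab k).2 c 0 - (ab k).1 c 0) else T).
split => [k i|w wT /Aab[k _ abX]|].
- by case: pickP => [c _|_]; [rewrite le_max lexx|exact: ltW].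
- exists k => i; rewrite /mixed_coordinates; case: pickP => [c _|_].
    have /andP[h1 h2] := abX c; rewrite h1/= (le_trans h2)//.
    by rewrite -lerBlDl le_max lexx orbT.
  have iT : (i < w T)%N by rewrite wT.
  by rewrite add0r (ltW (jump_gt0 iT)) jump_le.
- under eq_eseriesr do rewrite bigprod_selection// mulrC EFinM.
  have vol0 k : (0 <= (box_volume (ab k))%:E)%E.
    by rewrite lee_fin; apply: prodr_ge0 => i _; rewrite le_max lexx.
  rewrite nneseriesZl; last by move=> k _; exact: vol0.
  have c0e : (0 <= c0%:E)%E by rewrite lee_fin ltW.
  apply: (le_trans (lee_wpmul2l c0e (ltW vol))).
  by rewrite -EFinM lee_fin mulrC divfK// gt_eqF.
Qed.

End negligible.

Section selected_negligible.
Context {R : realType} {d : nat}.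
Variables (T C : R) (f g : R -> 'cV[R]_d -> 'cV[R]_d).
Hypothesis T0 : 0 < T.
Hypothesis C0 : 0 <= C.
Hypothesis f_meas : @measurable_fun _ _ (borel (R * 'cV[R]_d)%type)
  (borel 'cV[R]_d) (`[0, T] `*` setT) (fun tx => f tx.1 tx.2).
Hypothesis f_diff : forall v x, 0 <= v <= T -> differentiable (f v) x.
Hypothesis f_jac : forall v x, 0 <= v <= T -> `|jac (f v) x| <= C.
Hypothesis f_int : forall x, mx_integrable `[0, T] (fun v => f v x).
Hypothesis g_diff : forall v x, 0 <= v <= T -> differentiable (g v) x.
Hypothesis g_jac_continuous : forall v, 0 <= v <= T -> continuous (jac (g v)).
Hypothesis g_der : forall x t, 0 <= t <= T -> derivable_within `[0, T] (g^~ x) t.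
Variables (P : probability (path_space R) R) (lam mu gamma : R -> R).
Hypothesis hN : hawkes_process P lam mu gamma.
Variables (n : nat) (x0 : 'cV[R]_d).
Variables (X : R -> counting_path R -> 'cV[R]_d) (K : R -> counting_path R -> 'M[R]_d).
Variables (z : counting_path R -> nat -> R -> 'cV[R]_d).
Variables (kap : counting_path R -> nat -> R -> 'M[R]_d).

Lemma selected_paths_negligible (sel : {ffun 'I_d -> 'I_n}) (A : set 'cV[R]_d) :
  injective sel -> @lebesgue_cV R d A = 0%E ->
  P.-negligible (selected_paths T f g x0 X K z kap sel `&` [set w | A (X T w)]).
Proof.
move=> sel_inj A0; have [hpar PL] := hN.
have [M M0 LM] := hawkes_intensity_bound n (ltW T0) hpar.
have bound := fun r a b (r0 : 0 <= r) => jumps_in_bound PL M0 r0 LM (leqnn n) (a := a) (b := b).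
have [Sm [SSm Smj]] := countable_localization (no_expanding_sequence (ltW T0) C0 f_meas
  f_diff f_jac f_int g_diff g_jac_continuous g_der (n := n) (x0 := x0) (X := X) (K := K)
  (z := z) (kap := kap) sel_inj).
suff H m : P.-negligible (Sm m `&` [set w | A (X T w)]).
  apply: negligibleS (negligible_bigcup H) => w [/SSm[m _ Smw] Aw].
  by exists m.
have [SmS [j Smbad]] := Smj m.
have j0 : 0 < j.+1%:R :> R by [].
have wTn w : (Sm m `&` [set w | A (X T w)]) w -> w T = n.
  by move=> [/SmS[[]]].
apply: (lipschitz_preimage_negligible T0 M0 j0 bound (G := mixed_coordinates T X sel)) => //.
  move=> w w' e [Sw _] [Sw' _] Ge i i_n; rewrite leNgt; apply/negP => bad.
  by apply: (Smbad _ _ Sw Sw'); exists e, (Ordinal i_n).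
move=> e e0; have [lo [l [l0 cover vol]]] := mixed_cover X T0 sel_inj A0 e0.
exists lo, l; split => // w [Sw Aw]; apply: cover => //; exact: wTn.
Qed.

End selected_negligible.

Theorem proposition5p13 (R : realType) (T : R) (hT : 0 < T)
  (d : nat) (hd : (1 <= d)%N)
  (P : probability (path_space R) R) (lam mu gamma : R -> R)
  (hN : hawkes_process P lam mu gamma)
  (x0 : 'cV[R]_d) (f g : R -> 'cV[R]_d -> 'cV[R]_d)
  (hfg : sde_coefficients T f g)
  (X : R -> counting_path R -> 'cV[R]_d)
  (hX : sde_solution P T x0 f g X)
  (K : R -> counting_path R -> 'M[R]_d)
  (hK : tangent_solution P T f g X K)
  (l : nat)
  (hspan : {ae P, forall w : counting_path R,
     forall n : nat, (l <= n)%N ->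
     forall (t : 'I_n -> R) (x : 'I_n -> 'cV[R]_d),
       (forall i, 0 <= t i <= T) ->
       (forall i j : 'I_n, (i < j)%N -> t i < t j) ->
       <<[seq transition K (t i) T w *m phi T f g (t i) (x i) | i : 'I_n]>>%VS
         = fullv}) :
  conditional_law P [set w : counting_path R | (l <= w T)%N] (X T) `<< @lebesgue_cV R d.
Proof.
have [hpar PL] := hN; have T0 := ltW hT.
have [f_meas _ c1 [C hC] g_der _ _] := hfg.
have [adX aeX] := hX; have [_ aeK] := hK.
have f_jac v x : 0 <= v <= T -> `|jac (f v) x| <= `|C|.
  move=> /(hC _ x) h; apply: le_trans (ler_norm C); apply: le_trans h.
  by rewrite lerDl.
have f_diff v x : 0 <= v <= T -> differentiable (f v) x by move=> /c1[[]].
have g_diff v x : 0 <= v <= T -> differentiable (g v) x by move=> /c1[_ []].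
have g_jac v : 0 <= v <= T -> continuous (jac (g v)) by move=> /c1[_ []].
(* The conditioning event is the countable union of the events [w T = n] with [n >= l], which are
   treated separately. *)
pose null A := forall n, (l <= n)%N ->
  P.-negligible [set w : counting_path R | w T = n /\ A (X T w)].
suff main A : @lebesgue_cV R d A = 0%E -> null A.
  move=> A nullA B mB BA.
  have nB := main B (nullA B mB BA).
  rewrite /conditional_law measure_negligible ?mul0e//.
    apply: measurableI; first exact: (measurable_path [set k | (l <= k)%N] T0).
    have TT : 0 <= T <= T by rewrite T0 lexx.
    apply: (@history_sub _ T); rewrite -[X in measurable X]setTI.
    exact: (adX _ TT measurableT _ mB).
  have nBk (k : nat) : P.-negligible [set w : counting_path R | w T = (l + k)%N /\ B (X T w)].
    by apply: nB; exact: leq_addr.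
  apply: negligibleS (negligible_bigcup nBk) => w [/= lw Bw].
  by exists (w T - l)%N => //=; rewrite subnKC.
move=> A0 n ln.
pose good (w : counting_path R) :=
  [/\ integral_equation T w x0 (fun s => f s (X s w))
        (fun s => g s (left_limit (X^~ w) s)) (X^~ w),
      integral_equation T w 1%:M (fun s => jac (f s) (X s w) *m K s w)
        (fun s => jac (g s) (left_limit (X^~ w) s) *m left_limit (K^~ w) s) (K^~ w) &
      forall n : nat, (l <= n)%N -> forall (t : 'I_n -> R) (x : 'I_n -> 'cV[R]_d),
       (forall i, 0 <= t i <= T) -> (forall i j : 'I_n, (i < j)%N -> t i < t j) ->
       <<[seq transition K (t i) T w *m phi T f g (t i) (x i) | i : 'I_n]>>%VS = fullv].
have ae_good : {ae P, forall w, good w}.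
  apply: negligibleS (negligibleU (negligibleU aeX aeK) hspan) => w /= bad.
  apply: contrapT => /not_orP[/not_orP[/contrapT h1 /contrapT h2] /contrapT h3].
  by apply: bad.
(* One good path is enough to make the drift integrable in time; if there is none, the whole space
   is negligible. *)
have [[w0 [Xw0 _ _]]|no_good] := pselect (exists w, good w); last first.
  by apply: negligibleS ae_good => w _ gw; apply: no_good; exists w.
have f_int x : mx_integrable `[0, T] (f^~ x).
  exact: (drift_integrable (normr_ge0 C) f_meas f_diff f_jac x Xw0).
have [N N0 leb] := drift_lebesgue_points (normr_ge0 C) f_diff f_jac f_int.
(* Adding [T] to the exceptional times excludes a jump at the horizon. *)
have N1 : lebesgue_measure.-negligible (N `|` [set T]).
  apply: negligibleU => //; apply/negligibleP; first exact: measurable_set1.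
  exact: lebesgue_measure_set1.
have ae_jump := no_jump_in_null_set PL N1.
have /choice[zk zkP] w : exists zk : (nat -> R -> 'cV[R]_d) * (nat -> R -> 'M[R]_d),
    good w -> path_skeleton T w f g x0 (X^~ w) (K^~ w) zk.1 zk.2.
  have [[Xw Kw _]|gw] := pselect (good w); last by exists (fun=> fun=> 0, fun=> fun=> 0).
  by have [z [kap sk]] := solution_skeleton T0 Xw Kw; exists (z, kap).
pose z w := (zk w).1; pose kap w := (zk w).2.
pose sel_set (sel : {ffun 'I_d -> 'I_n}) := [set w | injective sel] `&`
  (selected_paths T f g x0 X K z kap sel `&` [set w | A (X T w)]).
have sel_null sel : P.-negligible (sel_set sel).
  have [si|si] := pselect (injective sel); last first.
    by apply: negligibleS (negligible_set0 _) => w [].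
  have := selected_paths_negligible hT (normr_ge0 C) f_meas f_diff f_jac f_int g_diff
    g_jac g_der hN x0 X K z kap si A0.
  by apply: negligibleS => w [].
pose sels k := if @unpickle {ffun 'I_d -> 'I_n} k is Some sel then sel_set sel else set0.
have sels_null k : P.-negligible (sels k).
  by rewrite /sels; case: unpickle => // *; exact: negligible_set0.
apply: negligibleS (negligibleU (negligible_bigcup sels_null)
  (negligibleU ae_good ae_jump)) => w [wT Aw].
have [gw|gw] := pselect (good w); last by right; left.
have [jw|jw] := pselect (forall s, jump_times w s -> ~ (N `|` [set T]) s);
  last by right; right.
left.
have sk := zkP w gw; have [_ _ span] := gw.
have iT (i : 'I_n) : (i < w T)%N by rewrite wT.
have jT i : (i < w T)%N -> 0 <= jump w i <= T.
  by move=> iw; rewrite (ltW (jump_gt0 iw)) jump_le.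
(* The spanning hypothesis is used at the jump times of [w] and at the states just before these
   jumps. *)
have [sel sel_inj V] := spanning_selection (span n ln (fun i => jump w i)
  (fun i => z w i (jump w i)) (fun i => jT _ (iT i)) (fun i j => jump_lt (iT j))).
exists (pickle sel) => //; rewrite /sels pickleK; split => //; split => //; split => //.
split => //.
(* [K T w] is a left factor of the selected response matrix, so its invertibility is read off that
   of the product. *)
- have VE : \matrix_(a, b) (transition K (jump w (sel b)) T w *m
      phi T f g (jump w (sel b)) (z w (sel b) (jump w (sel b)))) a 0 =
    K T w *m \matrix_(a, b) (invmx (K (jump w (sel b)) w) *m
      phi T f g (jump w (sel b)) (z w (sel b) (jump w (sel b)))) a 0.
    apply/matrixP => a b; rewrite mxE /transition -mulmxA !mxE.
    by apply: eq_bigr => c _; rewrite [in RHS]mxE.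
  by move: V; rewrite VE unitmx_mul => /andP[].
- move=> i i_n; have iw : (i < w T)%N by rewrite wT.
  apply: leb; first exact: jT.
  by move=> Ni; apply: (jw _ (jump_jump_times iw)); left.
(* Without jumps the last knot is [0 < T]; otherwise it is a jump time, which differs from [T]. *)
- case: n wT {ln A0 span iT sel sel_inj V sel_set sel_null sels sels_null} => [//|m] wT.
  have mT : (m < w T)%N by rewrite wT.
  rewrite knot_jump// lt_neqAle jump_le// andbT; apply/eqP => jE.
  by apply: (jw _ (jump_jump_times mT)); right.
Qed.
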